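(* Suppose $\gamma_0=\frac{E[M^2]}{(E[M])^2}<\infty$, where $M=\max_{t=1,\ldots,T}Z_t$, and that the simulation and reward-evaluation oracles with unit costs $C$ and $G$ described in the context are available. Then for any $\epsilon\in(0,1)$ there is a choice of parameters (an accuracy parameter $\epsilon'\in(0,1)$ and a truncation level $U>0$) such that the truncated Algorithm $\mathcal A'$ of the context, run with parameters $(\epsilon',U)$, implements a randomized stopping time $\tau_\epsilon$ satisfying $$\frac{E[Z_{\tau_\epsilon}]}{\mathrm{OPT}}\ge1-\epsilon .$$ In addition, at each time step, the decision of whether to stop (if one has not yet stopped) requires total computational time at most $$(C+G+4)\times\exp\big(1.6\times10^{9}\times\gamma_0^8\times\epsilon^{-6}\big)\times T^{3\times10^4\times\gamma_0^4\times\epsilon^{-3}} .$$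
   Context: Problem. Let $T,D\ge 1$ be integers. $\mathbf Y=(Y_1,\ldots,Y_T)$ is an arbitrary (possibly non-Markovian) discrete-time stochastic process, each $Y_t$ being a random vector in $\mathbb R^D$; $Y_{[t]}=(Y_1,\ldots,Y_t)$. For a $D\times T$ matrix $M$, $M_{[t]}$ denotes its first $t$ columns. $\mathcal F$ is the natural filtration of $\mathbf Y$. For each $t$, $g_t:\mathbb R^{D\times t}\to\mathbb R$ is measurable and $Z_t=g_t(Y_{[t]})$ is the (integrable, non-negative, possibly unbounded) reward for stopping at $t$. $\mathcal T$ is the set of stopping times adapted to $\mathcal F$ with values in $\{1,\ldots,T\}$, and $\mathrm{OPT}=\sup_{\tau\in\mathcal T}E[Z_\tau]$, assumed strictly positive. (In the paper, the squared coefficient of variation $\gamma_0-1$ of the maximum reward is assumed bounded by a constant independent of $T$ and $D$.) A randomized stopping time is a $\{1,\ldots,T\}$-valued random time for which the decision to stop at $t$ depends only on $Y_{[t]}$ and on auxiliary randomness generated up to time $t$ which, given $Y_{[t]}$, is independent of $(Y_{t+1},\ldots,Y_T)$. Oracles. For every $t\in\{0,\ldots,T\}$ and $\gamma\in\mathbb R^{D\times t}$, a call $\mathcal B(t,\gamma)$ returns a fresh independent sample of a $D\times T$ matrix distributed as $\mathbf Y$ conditioned on $\{Y_{[t]}=\gamma\}$, at cost $C$ units of time; evaluating any $g_t$ on any given partial trajectory costs $G$ units of time. ($C$ and $G$ are assumed to scale at most polynomially in $T$ and $D$.) Computational model. Computation is over real numbers. Each addition, subtraction, multiplication, division, maximum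 or minimum of two numbers, or raising of a number to a power, costs one unit; the median of $n$ numbers costs $n$ units; reading, writing, storing and passing numbers is free; sampling a standard Bernoulli, uniform on $[0,1]$ or standard normal variable costs one unit. The median of $x_1\le\cdots\le x_n$ is $\frac12(x_{\lfloor (n+1)/2\rfloor}+x_{\lfloor n/2\rfloor+1})$. Let $N(\epsilon,\eta)=\lceil\frac1{2\epsilon^2}\log(\frac2\eta)\rceil$. Algorithms $\mathcal B^k(t,\gamma,\epsilon,\delta)$, $k\ge1$, for a given family of rewards $(g_t)$ (recursively defined; all calls use independent randomness). $\mathcal B^1(t,\gamma,\epsilon,\delta)$ returns $g_t(\gamma)$. $\mathcal B^{k+1}(t,\gamma,\epsilon,\delta)$: let $N=N(\frac\epsilon4,\frac1{16})$. For each $s=1,\ldots,\lceil 8\log(2\delta^{-1})\rceil$: let $A^3$ be the output of $\mathcal B^k(t,\gamma,\frac\epsilon2,\frac18)$; for $i=1,\ldots,N$, draw $\mathbf A^1$ by a call $\mathcal B(t,\gamma)$, let $A^2_j$ be the output of $\mathcal B^k(j,\mathbf A^1_{[j]},\frac\epsilon4,\frac1{16NT})$ for $j=1,\ldots,T$, and set $A^0_i=\max_jA^2_j$; set $A^m_s=A^3-N^{-1}\sum_{i=1}^NA^0_i$. Return the median of $(A^m_s)_s$. Algorithm $\mathcal A'$ with accuracy $\epsilon$: at each time $t=1,\ldots,T-1$ at which one has not yet stopped, after observing $Y_{[t]}$, make an independent call to $\mathcal B^{\lceil4\epsilon^{-1}\rceil+1}\big(t,Y_{[t]},\frac\epsilon4,\frac{\epsilon}{4T}\big)$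 and stop at time $t$ if the returned value is at least $-\frac12\epsilon$; otherwise continue. If one has not stopped before time $T$, stop at time $T$. Truncated Algorithm $\mathcal A'$ with parameters $(\epsilon',U)$: run $\mathcal A'$ with accuracy $\epsilon'$ and with every reward function $g_t$ replaced by $U^{-1}\min(U,g_t)$ (truncation and normalization being performed after each reward evaluation). The parameters are regarded as given to the algorithm; they may depend on $\epsilon$ and on the problem's constants. *)

(* Defs.v *)
From HB Require Import structures.
From mathcomp Require Import all_boot all_order all_algebra finmap.
From mathcomp Require Import all_classical all_reals all_analysis.
Set Implicit Arguments.
Unset Strict Implicit.
Unset Printing Implicit Defensive.
Import Order.TTheory GRing.Theory Num.Theory.
Import numFieldNormedType.Exports.
Local Open Scope classical_set_scope.
Local Open Scope ring_scope.

(* Matrices carry the product sigma-algebra of their entries; over a real type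
   this is the Borel sigma-algebra of R^(m x n). *)
Definition measure_matrix_display : measure_display -> measure_display.
Proof. exact. Qed.

Section measurable_matrix.
Context {d : measure_display} {E : measurableType d} (m n : nat).

Definition matrix_cylinders : set (set 'M[E]_(m, n)) :=
  [set A | exists i j, exists2 B : set E,
     measurable B & A = (fun M : 'M[E]_(m, n) => M i j) @^-1` B].

Let matrix_set0 : <<s matrix_cylinders >> set0.
Proof. exact: sigma_algebra0. Qed.

Let matrix_setC A :
  <<s matrix_cylinders >> A -> <<s matrix_cylinders >> (~` A).
Proof. exact: sigma_algebraC. Qed.

Let matrix_bigcup (F : (set 'M[E]_(m, n))^nat) :
  (forall i, <<s matrix_cylinders >> (F i)) ->
  <<s matrix_cylinders >> (\bigcup_i (F i)).
Proof. exact: sigma_algebra_bigcup. Qed.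

HB.instance Definition _ := @isMeasurable.Build (measure_matrix_display d)
  'M[E]_(m, n) (<<s matrix_cylinders >>) matrix_set0 matrix_setC matrix_bigcup.

End measurable_matrix.

(* Dates are indexed from 0: the date [t : 'I_T] stands for the time t + 1, at
   which [obs t] = t + 1 columns of the trajectory have been observed. *)
Definition obs (T : nat) (t : 'I_T) : 'I_T.+1 := lift ord0 t.

Section trajectories.
Context (R : realType) (D T : nat).

Definition first_cols (n : 'I_T.+1) (M : 'M[R]_(D, T)) : 'M[R]_(D, n) :=
  \matrix_(i, j) M i (widen_ord (leq_ord n) j).

Definition last_cols (n : 'I_T.+1) (M : 'M[R]_(D, T)) : 'M[R]_(D, T - n) :=
  \matrix_(i, j) M i (cast_ord (subnKC (leq_ord n)) (rshift n j)).

End trajectories.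

Section stopping_problem.
Context (R : realType) (D T : nat) (d : measure_display)
  (Omega : measurableType d) (P : probability Omega R)
  (Y : Omega -> 'M[R]_(D, T)) (g : forall t : 'I_T, 'M[R]_(D, obs t) -> R).

Definition reward (t : 'I_T) (w : Omega) : R := g (first_cols (obs t) (Y w)).

Definition natural_filtration (t : 'I_T) : set_system Omega :=
  preimage_set_system setT (fun w => first_cols (obs t) (Y w)) measurable.

Definition stopping_time (tau : Omega -> 'I_T) :=
  forall t, natural_filtration t [set w | tau w = t].

Definition OPT : \bar R :=
  ereal_sup [set 'E_P[fun w => reward (tau w) w]%E | tau in stopping_time].

(* The neutral element 0 is harmless: rewards are nonnegative and 0 < T. *)
Definition max_reward (w : Omega) : R :=
  \big[Num.max/0]_(t < T) reward t w.

Definition gamma0 : R :=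
  fine 'E_P[(fun w => max_reward w ^+ 2)%R]%E / fine 'E_P[max_reward]%E ^+ 2.

End stopping_problem.

Section randomized_stopping.
Context (R : realType) (d : measure_display) (Omega : measurableType d)
  (P : probability Omega R).

(* [f \o X] is a version of the conditional probability of [E] given [X] *)
Definition is_cond_proba (dV : measure_display) (V : measurableType dV)
    (X : Omega -> V) (E : set Omega) (f : V -> R) :=
  measurable_fun setT f /\
  forall A, measurable A ->
    P (E `&` X @^-1` A) = (\int[P]_(w in X @^-1` A) (f (X w))%:E)%E.

Definition cond_indep (dV : measure_display) (V : measurableType dV)
    (X : Omega -> V) (F1 F2 : set_system Omega) :=
  forall E1 E2, F1 E1 -> F2 E2 -> exists f1 f2 : V -> R,
    [/\ is_cond_proba X E1 f1, is_cond_proba X E2 f2 &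
        is_cond_proba X (E1 `&` E2) (f1 \* f2)].

(* [H t] is the sigma-algebra of the auxiliary randomness generated up to
   date [t]. *)
Definition randomized_stopping_time (D T : nat) (Y : Omega -> 'M[R]_(D, T))
    (tau : Omega -> 'I_T) :=
  exists H : 'I_T -> set_system Omega,
    [/\ forall t, sigma_algebra setT (H t) /\ H t `<=` measurable,
        forall s t : 'I_T, (s <= t)%N -> H s `<=` H t,
        forall t, cond_indep (fun w => first_cols (obs t) (Y w)) (H t)
          (preimage_set_system setT (fun w => last_cols (obs t) (Y w)) measurable) &
        forall t, <<s natural_filtration Y t `|` H t >> [set w | tau w = t]].

End randomized_stopping.

Section oracles.
Context (R : realType) (D T : nat) (d dX : measure_display)
  (Omega : measurableType d) (P : probability Omega R)
  (Y : Omega -> 'M[R]_(D, T)) (Xi : measurableType dX) (nu : probability Xi R).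

(* A simulator is presented through its internal randomness: a call with
   argument [c] and fresh seed [x] of law [nu] returns [S n c x].  The law of
   [S n c] under [nu] must be a regular conditional distribution of [Y] given
   its first [n] columns. *)
Definition conditional_sampler
    (S : forall n : 'I_T.+1, 'M[R]_(D, n) -> Xi -> 'M[R]_(D, T)) :=
  forall n : 'I_T.+1,
    measurable_fun setT (fun cx : 'M[R]_(D, n) * Xi => S n cx.1 cx.2) /\
    forall (A : set 'M[R]_(D, n)) (B : set 'M[R]_(D, T)),
      measurable A -> measurable B ->
      P ((fun w => first_cols n (Y w)) @^-1` A `&` Y @^-1` B) =
      (\int[P]_(w in (fun w => first_cols n (Y w)) @^-1` A)
         nu (S n (first_cols n (Y w)) @^-1` B))%E.

(* [Y] and the seeds [xi t i] (the [i]-th seed available at date [t]) are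
   mutually independent, and every seed has law [nu]. *)
Definition fresh_seeds (xi : 'I_T -> nat -> Omega -> Xi) :=
  (forall t i, measurable_fun setT (xi t i)) /\
  forall (J : {fset 'I_T * nat}) (B : set 'M[R]_(D, T))
      (A : 'I_T * nat -> set Xi),
    measurable B -> (forall j, measurable (A j)) ->
    P (Y @^-1` B `&` \bigcap_(j in [set` J]) xi j.1 j.2 @^-1` A j) =
    (P (Y @^-1` B) * \prod_(j <- J) nu (A j))%E.

End oracles.

Variant arith_op := Add | Sub | Mul | Div | Max | Min | Pow.

Definition arith_val (R : realType) (op : arith_op) (x y : R) : R :=
  match op with
  | Add => x + y
  | Sub => x - y
  | Mul => x * y
  | Div => x / y
  | Max => Num.max x y
  | Min => Num.min x y
  | Pow => x `^ y
  end.

Definition median (R : realType) (s : seq R) : R :=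
  let s' := sort <=%R s in let n := size s in
  (nth 0 s' (n.+1)./2.-1 + nth 0 s' n./2) / 2.

Definition nat_ceil (R : realType) (x : R) : nat := `|Num.ceil x|%N.

(* Programs are trees of priced operations.  Logarithms, ceilings and
   comparisons have no price in the model and are performed at the meta level,
   as is all bookkeeping. *)
Inductive prog (R : realType) (D T : nat) (A : Type) : Type :=
| Ret of A
| SimulateK (n : 'I_T.+1) of 'M[R]_(D, n) & ('M[R]_(D, T) -> prog R D T A)
| RewardK (t : 'I_T) of 'M[R]_(D, obs t) & (R -> prog R D T A)
| ArithK of arith_op & R & R & (R -> prog R D T A)
| MedianK of seq R & (R -> prog R D T A).
Arguments Ret {R D T A}.
Arguments SimulateK {R D T A}.
Arguments RewardK {R D T A}.
Arguments ArithK {R D T A}.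
Arguments MedianK {R D T A}.

Section programs.
Context (R : realType) (D T : nat).
Local Notation prog := (prog R D T).

Fixpoint bind (A B : Type) (p : prog A) (f : A -> prog B) : prog B :=
  match p with
  | Ret a => f a
  | SimulateK n c k => SimulateK n c (fun M => bind (k M) f)
  | RewardK t c k => RewardK t c (fun x => bind (k x) f)
  | ArithK op x y k => ArithK op x y (fun z => bind (k z) f)
  | MedianK s k => MedianK s (fun x => bind (k x) f)
  end.

Definition do_simulate (n : 'I_T.+1) (c : 'M[R]_(D, n)) : prog 'M[R]_(D, T) :=
  SimulateK n c Ret.
Definition do_reward (t : 'I_T) (c : 'M[R]_(D, obs t)) : prog R :=
  RewardK t c Ret.
Definition do_arith (op : arith_op) (x y : R) : prog R := ArithK op x y Ret.
Definition do_median (s : seq R) : prog R := MedianK s Ret.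

Fixpoint map_prog (I A : Type) (f : I -> prog A) (s : seq I) : prog (seq A) :=
  if s is i :: s' then
    bind (f i) (fun a => bind (map_prog f s') (fun l => Ret (a :: l)))
  else Ret [::].

Fixpoint fold_arith (op : arith_op) (x : R) (s : seq R) : prog R :=
  if s is y :: s' then bind (do_arith op x y) (fun z => fold_arith op z s')
  else Ret x.

(* n - 1 operations for n numbers; only used on nonempty lists *)
Definition fold1_arith (op : arith_op) (s : seq R) : prog R :=
  if s is x :: s' then fold_arith op x s' else Ret 0.

End programs.

Notation "'let!' x := p 'in' q" := (bind p (fun x => q))
  (at level 200, x name, p at level 100, q at level 200).

(* A run consumes a stream of seeds, one new seed per simulator call. *)
Section execution.
Context (R : realType) (D T : nat) (Xi : Type).

Fixpoint output (S : forall n : 'I_T.+1, 'M[R]_(D, n) -> Xi -> 'M[R]_(D, T))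
    (g : forall t : 'I_T, 'M[R]_(D, obs t) -> R) (A : Type)
    (p : prog R D T A) (s : nat -> Xi) : A :=
  match p with
  | Ret a => a
  | SimulateK n c k => output S g (k (S n c (s 0%N))) (fun i => s i.+1)
  | RewardK t c k => output S g (k (g t c)) s
  | ArithK op x y k => output S g (k (arith_val op x y)) s
  | MedianK l k => output S g (k (median l)) s
  end.

Fixpoint running_time
    (S : forall n : 'I_T.+1, 'M[R]_(D, n) -> Xi -> 'M[R]_(D, T))
    (g : forall t : 'I_T, 'M[R]_(D, obs t) -> R) (C G : R) (A : Type)
    (p : prog R D T A) (s : nat -> Xi) : R :=
  match p with
  | Ret _ => 0
  | SimulateK n c k =>
      C + running_time S g C G (k (S n c (s 0%N))) (fun i => s i.+1)
  | RewardK t c k => G + running_time S g C G (k (g t c)) s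
  | ArithK op x y k => 1 + running_time S g C G (k (arith_val op x y)) s
  | MedianK l k => (size l)%:R + running_time S g C G (k (median l)) s
  end.

End execution.

Section algorithms.
Context (R : realType) (D T : nat).
Local Notation prog := (prog R D T).

(* N(eps, eta) = ceil (1 / (2 eps^2) * log (2 / eta)) *)
Definition sample_size (eps eta : R) : prog nat :=
  let! e2 := do_arith _ _ Pow eps 2 in
  let! e := do_arith _ _ Mul 2 e2 in
  let! a := do_arith _ _ Div 1 e in
  let! b := do_arith _ _ Div 2 eta in
  let! x := do_arith _ _ Mul a (ln b) in
  Ret (nat_ceil x).

(* ceil (8 log (2 / delta)) *)
Definition repetitions (delta : R) : prog nat :=
  let! b := do_arith _ _ Div 2 delta in
  let! x := do_arith _ _ Mul 8 (ln b) in
  Ret (nat_ceil x).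

(* [calB ev k] is B^k for the rewards evaluated by [ev]; levels start at
   k = 1, and the value at k = 0 is a dummy. *)
Fixpoint calB (ev : forall t : 'I_T, 'M[R]_(D, obs t) -> prog R) (k : nat)
    (t : 'I_T) (c : 'M[R]_(D, obs t)) (eps delta : R) : prog R :=
  if k is k'.+1 then
    if k' is 0%N then ev t c else
    let! eps2 := do_arith _ _ Div eps 2 in
    let! eps4 := do_arith _ _ Div eps 4 in
    let! N := sample_size eps4 (1 / 16) in
    let! u := do_arith _ _ Mul 16 N%:R in
    let! v := do_arith _ _ Mul u T%:R in
    let! eta := do_arith _ _ Div 1 v in
    let! L := repetitions delta in
    let! Am := map_prog (fun _ =>
      let! A3 := calB ev k' c eps2 (1 / 8) in
      let! A0 := map_prog (fun _ =>
        let! A1 := do_simulate c in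
        let! A2 := map_prog
          (fun j : 'I_T => calB ev k' (first_cols (obs j) A1) eps4 eta)
          (enum 'I_T) in
        fold1_arith _ _ Max A2) (iota 1 N) in
      let! total := fold1_arith _ _ Add A0 in
      let! mean := do_arith _ _ Div total N%:R in
      do_arith _ _ Sub A3 mean) (iota 1 L) in
    do_median _ _ Am
  else Ret 0.

(* U^-1 min(U, g_t) *)
Definition truncated_reward (U : R) (t : 'I_T) (c : 'M[R]_(D, obs t)) : prog R :=
  let! z := do_reward c in
  let! m := do_arith _ _ Min U z in
  do_arith _ _ Div m U.

(* The decision of algorithm A' at date [t] with history [c]: [true] means
   stop; at the last date one stops without any computation. *)
Definition decide (ev : forall t : 'I_T, 'M[R]_(D, obs t) -> prog R) (eps : R)
    (t : 'I_T) (c : 'M[R]_(D, obs t)) : prog bool :=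
  if t.+1 == T then Ret true else
  let! q := do_arith _ _ Div 4 eps in
  let! eps4 := do_arith _ _ Div eps 4 in
  let! v := do_arith _ _ Mul 4 T%:R in
  let! delta := do_arith _ _ Div eps v in
  let! b := calB ev (nat_ceil q).+1 c eps4 delta in
  let! h := do_arith _ _ Mul (- (1 / 2)) eps in
  Ret (h <= b).

Definition truncated_decide (eps U : R) (t : 'I_T) (c : 'M[R]_(D, obs t)) :
    prog bool :=
  decide (truncated_reward U) eps c.

Definition first_stop (stop : 'I_T -> bool) (t : 'I_T) :=
  stop t /\ forall s : 'I_T, (s < t)%N -> ~~ stop s.

End algorithms.

(* Main.v *)
Require Import Defs.
From HB Require Import structures.
From mathcomp Require Import all_boot all_order all_algebra finmap.
From mathcomp Require Import all_classical all_reals all_analysis.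
From mathcomp Require Import measurable_realfun ring lra zify.
Set Implicit Arguments.
Unset Strict Implicit.
Unset Printing Implicit Defensive.
Import Order.TTheory GRing.Theory Num.Theory.
Import numFieldNormedType.Exports.
Local Open Scope classical_set_scope.
Local Open Scope ring_scope.

(** Let [Z^1] be the rewards truncated at [U] and divided by [U], and let
    [Z^(k+1)_t = Z^k_t - E (max_s Z^k_s | F_t)].  What is subtracted is a
    martingale, so optional stopping gives, for every stopping time [tau],
    randomized or not,
      [E Z^1_tau = E Z^(k+1)_tau + sum_(l <= k) E (max_s Z^l_s)],
    where only the first term depends on [tau] ([resid_at]).  For [k >= 1] the
    residuals [Z^(k+1)] lie in [[-1, 0]], so the sum bounds the optimal truncated
    value, and stopping where the residual is close to 0 nearly attains it.  Such a
    date exists on almost every trajectory: at the last date the conditional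
    expectations are trivial, so the losses [- max_s Z^l_s], [l >= 2], sum to at
    most 1; they also decrease in [l], hence [max_s Z^(k+1)_s >= - 1 / k]
    ([best_ge]).  With [k] about [4 / eps'] and estimates of accuracy [eps' / 4],
    the first date whose estimated residual exceeds [- eps' / 2] loses at most
    [eps'] ([resid_tau]).

    [B^k] estimates [Z^k] by nested simulation.  In the inductive step
    ([accurate_step]) the conditional expectation is replaced by an empirical
    mean, controlled by Hoeffding's inequality; the exact maxima are replaced by
    maxima of estimates, which is harmless outside an event of small
    probability; and the median of independent repetitions turns a failure
    probability 1/4 into [delta].  These bounds are proved in a calculus of
    upper expectations [wp], which is defined for arbitrary functions and follows
    the program step by step.  Measurability enters only where [wp] is compared
    with actual runs on random seeds ([mprog_expectation]).

    Optional stopping for the algorithm rests on one fact ([decision_law]):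
    given the history and the seeds used so far, the trajectory is distributed
    as a fresh simulation that continues this history.

    Undoing the truncation costs [E M^2 / U], where [M] is the largest reward,
    and the algorithm loses [U eps'].  Stopping at the first reward above
    [E M / 2] shows, by a Paley-Zygmund inequality, that the optimal value is at
    least [E M / (8 gamma0)]; the choices [eps' = eps^2 / (256 gamma0^3)] and
    [U = 16 gamma0^2 E M / eps] then make each loss at most [eps / 2] times the
    optimal value ([approximation_ratio]).

    The running time satisfies a recursion over the levels whose factor at
    accuracy [e] is of order [e^(-4) T^2]; the accuracy shrinks by 4 at each of
    the about [4 / eps'] levels, hence an exponent of order [eps'^(-2)] for the
    constant and [1 / eps'] for [T] ([decide_time]). *)

(** * Upper integrals *)

Section upper_integral.
Context {d : measure_display} {T : measurableType d} {R : realType}.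

(** The upper integral is monotone and sublinear without any measurability
    condition. *)
Definition upper_int (mu : {measure set T -> \bar R}) (f : T -> \bar R) : \bar R :=
  ereal_inf [set (\int[mu]_x h x)%E | h in
    [set h : T -> \bar R | [/\ measurable_fun setT h, forall x, (0 <= h x)%E &
                 forall x, (f x <= h x)%E]]].

Variable mu : probability T R.
Local Open Scope ereal_scope.
Implicit Types f g h : T -> \bar R.

Lemma integral_prob_cst (a : \bar R) : \int[mu]_x a = a.
Proof.
by rewrite (integral_cst mu measurableT a) [X in _ * X](@probability_setT _ _ _ mu) mule1.
Qed.

Lemma upper_int_ge0 f : 0 <= upper_int mu f.
Proof. by apply: le_ereal_inf_tmp => _ [h [_ h0 _] <-]; exact: integral_ge0. Qed.

Lemma upper_int_le_int f h : measurable_fun setT h -> (forall x, 0 <= h x) ->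
  (forall x, f x <= h x) -> upper_int mu f <= \int[mu]_x h x.
Proof. by move=> mh h0 fh; apply: ereal_inf_lbound; exists h. Qed.

Lemma upper_intE f : measurable_fun setT f -> (forall x, 0 <= f x) ->
  upper_int mu f = \int[mu]_x f x.
Proof.
move=> mf f0; apply/eqP; rewrite eq_le upper_int_le_int//=.
by apply: le_ereal_inf_tmp => _ [h [mh h0 fh] <-]; exact: ge0_le_integral.
Qed.

Lemma ae_le_upper_int (N : set T) f g : measurable N -> mu N = 0 ->
  (forall x, ~ N x -> f x <= g x) -> upper_int mu f <= upper_int mu g.
Proof.
move=> mN N0 fg; apply: le_ereal_inf_tmp => _ [h [mh h0 gh] <-].
(* an infinite value on the null set costs nothing *)
pose h' x := if x \in N then +oo else h x.
have mh' : measurable_fun setT h'.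
  apply: measurable_fun_ifT => //; apply: (measurable_fun_bool true) => /=.
  rewrite setTI (_ : _ @^-1` _ = N) //.
  by apply/seteqP; split=> x /=; [exact: set_mem|exact: mem_set].
have h'0 x : 0 <= h' x by rewrite /h'; case: ifP.
apply: (@le_trans _ _ (\int[mu]_x h' x)).
  apply: upper_int_le_int => // x; rewrite /h'; case: ifPn => [_|]; first by rewrite leey.
  by rewrite notin_setE => /fg /le_trans; apply.
apply: ae_ge0_le_integral => //.
exists N; split=> // x /= /not_implyP[_ /negP]; rewrite /h'.
by case: ifPn; rewrite ?inE// lexx.
Qed.

Lemma le_upper_int f g : (forall x, f x <= g x) ->
  upper_int mu f <= upper_int mu g.
Proof. by move=> fg; apply: (@ae_le_upper_int set0). Qed.

Lemma upper_int_affine (a b : R) f : (0 <= a)%R -> (0 <= b)%R ->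
  upper_int mu (fun x => a%:E + b%:E * f x) <= a%:E + b%:E * upper_int mu f.
Proof.
move=> a0; rewrite le_eqVlt => /orP[/eqP <-|b0].
  rewrite mul0e adde0 (@le_trans _ _ (\int[mu]_x (cst a%:E) x))//.
    by apply: upper_int_le_int => // x; rewrite ?lee_fin// mul0e adde0.
  by rewrite integral_prob_cst.
rewrite -leeBlDl// -lee_pdivrMl//; apply: le_ereal_inf_tmp => _ [h [mh h0 fh] <-].
rewrite lee_pdivrMl// leeBlDl//.
rewrite (_ : a%:E + _ = \int[mu]_x (a%:E + b%:E * h x)); last first.
  rewrite ge0_integralD//; first last.
  - exact: measurable_funeM.
  - by move=> x _; rewrite mule_ge0// lee_fin ltW.
  by rewrite integral_prob_cst ge0_integralZl_EFin// ltW.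
apply: upper_int_le_int => [|x|x].
- by apply: emeasurable_funD => //; exact: measurable_funeM.
- by rewrite adde_ge0 ?lee_fin// mule_ge0// lee_fin ltW.
- by rewrite leeD2l// lee_pmul2l// lte_fin.
Qed.

End upper_integral.

(** * Programs: weakest pre-expectations *)

Section program_semantics.
Context {R : realType} {D T : nat} {dX : measure_display}
  {Xi : measurableType dX} (nu : probability Xi R).
Variables (S : forall n : 'I_T.+1, 'M[R]_(D, n) -> Xi -> 'M[R]_(D, T))
  (g : forall t : 'I_T, 'M[R]_(D, obs t) -> R).

Lemma bindA (A B C : Type) (p : prog R D T A) (f : A -> prog R D T B)
    (h : B -> prog R D T C) :
  bind (bind p f) h = bind p (fun a => bind (f a) h).
Proof.
elim: p => //= [n c k IH|t c k IH|op x y k IH|l k IH];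
  by congr (_ _); apply/funext => ?; rewrite IH.
Qed.

(** The expectation of [f] at the outcome of [p] for independent seeds,
    computed seed by seed.  With upper integrals it is defined for every
    program and every [f], and it is monotone and sublinear, which is all that
    a probability bound requires. *)
Fixpoint wp (A : Type) (p : prog R D T A) (f : A -> \bar R) : \bar R :=
  match p with
  | Ret a => f a
  | SimulateK n c k => upper_int nu (fun x => wp (k (S c x)) f)
  | RewardK t c k => wp (k (g c)) f
  | ArithK op x y k => wp (k (arith_val op x y)) f
  | MedianK l k => wp (k (median l)) f
  end.

Local Open Scope ereal_scope.

Lemma wp_bind (A B : Type) (p : prog R D T A) (f : A -> prog R D T B) F :
  wp (bind p f) F = wp p (fun a => wp (f a) F).
Proof. by elim: p => //= n c k IH; congr (upper_int _ _); apply/funext => x. Qed.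

Lemma le_wp (A : Type) (p : prog R D T A) (F G : A -> \bar R) :
  (forall a, F a <= G a) -> wp p F <= wp p G.
Proof. by move=> FG; elim: p => //= n c k IH; exact: le_upper_int. Qed.

Lemma wp_affine (A : Type) (p : prog R D T A) (F : A -> \bar R) (a b : R) :
  (0 <= a)%R -> (0 <= b)%R ->
  wp p (fun x => a%:E + b%:E * F x) <= a%:E + b%:E * wp p F.
Proof.
move=> a0 b0; elim: p => //= n c k IH.
exact: le_trans (le_upper_int _ _) (upper_int_affine _ _ a0 b0).
Qed.

Lemma wp_scale (A : Type) (p : prog R D T A) (F : A -> \bar R) (b : R) :
  (0 <= b)%R -> wp p (fun x => b%:E * F x) <= b%:E * wp p F.
Proof.
move=> b0; have := wp_affine p F (lexx 0%R) b0; rewrite add0e.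
by apply: le_trans; apply: le_wp => a; rewrite add0e.
Qed.

Lemma wp_le_affine (A : Type) (p : prog R D T A) (F G : A -> \bar R) (a b e : R) :
  (0 <= a)%R -> (0 <= b)%R -> (forall x, F x <= a%:E + b%:E * G x) ->
  wp p G <= e%:E -> wp p F <= (a + b * e)%:E.
Proof.
move=> a0 b0 FG pG; apply: (le_trans (le_wp p FG)).
apply: (le_trans (wp_affine _ _ a0 b0)).
by rewrite EFinD EFinM leeD2l// lee_wpmul2l// lee_fin.
Qed.

Lemma wp_ge0 (A : Type) (p : prog R D T A) (F : A -> \bar R) :
  (forall a, 0 <= F a) -> 0 <= wp p F.
Proof. by move=> F0; elim: p => //= n c k IH; exact: upper_int_ge0. Qed.

Lemma wp_le_cst (A : Type) (p : prog R D T A) (F : A -> \bar R) (e : R) :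
  (0 <= e)%R -> (forall a, F a <= e%:E) -> wp p F <= e%:E.
Proof.
move=> e0 Fe.
have := @wp_le_affine A p F (fun=> 0) e 0 0 e0 (lexx _).
rewrite mulr0 addr0; apply.
  by move=> x; rewrite mule0 adde0.
elim: p => //= n c k IH; rewrite -[leRHS](integral_prob_cst nu) -upper_intE//.
by apply: le_upper_int => x; exact: IH.
Qed.

End program_semantics.

(** * Concentration *)

Section hoeffding.
Context {R : realType}.

Lemma is_derive_ge0_homo (f f' : R -> R) :
  (forall x : R, 0 <= x -> is_derive x 1 f (f' x)) ->
  (forall x : R, 0 <= x -> 0 <= f' x) -> forall x : R, 0 <= x -> f 0 <= f x.
Proof.
move=> df f'0 x x0.
have dfx y : 0 <= y -> derivable f y 1 by move=> /df [].
apply: (@ger0_derive1_ndecry R f 0) => //.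
- by move=> y /[!in_itv]/= /andP[/ltW y0 _]; exact: dfx.
- move=> y /[!in_itv]/= /andP[/ltW y0 _].
  by rewrite derive1E (@derive_val _ _ _ _ _ _ _ (df y y0)); exact: f'0.
- apply: derivable_within_continuous => y /[!in_itv]/= /andP[y0 _]; exact: dfx.
Qed.

Section pointwise_rules.
Variables (f g : R -> R) (x a b : R).
Hypotheses (fa : is_derive x 1 f a) (gb : is_derive x 1 g b).

Lemma derive_add : is_derive x 1 (fun y => f y + g y) (a + b).
Proof. exact: is_deriveD. Qed.

Lemma derive_sub : is_derive x 1 (fun y => f y - g y) (a - b).
Proof. exact: is_deriveB. Qed.

Lemma derive_mul : is_derive x 1 (fun y => f y * g y) (f x * b + g x * a).
Proof. exact: is_deriveM. Qed.

Lemma derive_inv : f x != 0 -> is_derive x 1 (fun y => (f y)^-1) (- (f x) ^- 2 * a).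
Proof. by move=> fx0; exact: is_deriveV. Qed.

Lemma derive_const (c : R) : is_derive x 1 (fun=> c) 0.
Proof. exact: is_derive_cst. Qed.

Lemma derive_idfun : is_derive x 1 (fun y : R => y) 1.
Proof. exact: is_derive_id. Qed.

End pointwise_rules.

(** Hoeffding's bound on the moment generating function of a Bernoulli variable:
    the second derivative of its logarithm is a variance, hence at most 1/4. *)
Lemma bernoulli_mgf_ge0 (m s : R) : 0 <= m <= 1 -> 0 <= s ->
  1 - m + m * expR s <= expR (s * m + s ^+ 2 / 8).
Proof.
move=> /andP[m0 m1] s0.
pose q (x : R) : R := 1 - m + m * expR x.
have q0 x : 0 < q x.
  rewrite /q; have := expR_gt0 x.
  have [->|mn0] := eqVneq m 0; first by rewrite mul0r addr0 subr0.
  have mp : 0 < m by rewrite lt_neqAle eq_sym mn0.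
  by move=> e0; rewrite ltr_wpDl ?subr_ge0// mulr_gt0.
pose h (x : R) : R := m + x / 4 - m * expR x / q x.
pose f (x : R) : R := x * m + x ^+ 2 / 8 - ln (q x).
have dq (x : R) : is_derive x 1 q (m * expR x).
  have := derive_add (derive_const x (1 - m))
    (derive_mul (derive_const x m) (is_derive_expR x)).
  by move=> /is_derive_eq; apply; rewrite mulr0 addr0 add0r.
have h_ge0 (x : R) : 0 <= x -> 0 <= h x.
  move=> x0; rewrite (_ : 0 = h 0); last first.
    by rewrite /h /q expR0 !mulr1 subrK divr1 mul0r addr0 subrr.
  apply: (@is_derive_ge0_homo h (fun x => 1 / 4 - m * (1 - m) * expR x / q x ^+ 2)); [| |exact: x0].
  - move=> y _; have qy0 := lt0r_neq0 (q0 y).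
    have := derive_sub (derive_add (derive_const y m)
      (derive_mul (derive_idfun y) (derive_const y 4^-1)))
      (derive_mul (derive_mul (derive_const y m) (is_derive_expR y))
        (derive_inv (dq y) qy0)).
    by move=> /is_derive_eq; apply; move: qy0; rewrite /q => qy0; field.
  - move=> y _; rewrite subr_ge0 ler_pdivrMr ?exprn_gt0//.
    rewrite -subr_ge0 (_ : _ - _ = (1 - m - m * expR y) ^+ 2 / 4).
      by rewrite divr_ge0 ?sqr_ge0.
    by rewrite /q; field.
have : 0 <= f s.
  rewrite (_ : 0 = f 0); last first.
    by rewrite /f /q expR0 mulr1 subrK ln1 mul0r expr0n/= mul0r addr0 subr0.
  apply: (@is_derive_ge0_homo f h); [move=> x x0|exact: h_ge0|exact: s0].
  have dl : is_derive x 1 (fun x => ln (q x)) ((q x)^-1 * (m * expR x)).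
    by apply: is_derive1_comp; exact: is_derive1_ln.
  have := derive_sub (derive_add
    (derive_mul (derive_idfun x) (derive_const x m))
    (derive_mul (derive_mul (derive_idfun x) (derive_idfun x)) (derive_const x 8^-1))) dl.
  by move=> /is_derive_eq; apply; rewrite /h; field; exact: lt0r_neq0.
by rewrite /f subr_ge0 -ler_expR lnK// posrE.
Qed.

(** Negative [s] reduce to positive ones by exchanging the two outcomes. *)
Lemma bernoulli_mgf (m s : R) : 0 <= m <= 1 ->
  1 - m + m * expR s <= expR (s * m + s ^+ 2 / 8).
Proof.
move=> m01; have [s0|s0] := leP 0 s; first exact: bernoulli_mgf_ge0.
have [m0 m1] := andP m01.
have H : 1 - (1 - m) + (1 - m) * expR (- s) <=
    expR (- s * (1 - m) + (- s) ^+ 2 / 8) by apply: bernoulli_mgf_ge0; lra.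
rewrite (_ : s * m + _ = s + (- s * (1 - m) + (- s) ^+ 2 / 8)); last by ring.
rewrite expRD -ler_pdivrMl ?expR_gt0// -expRN (le_trans _ H)//.
by rewrite mulrDr mulrCA -expRD addNr expR0; lra.
Qed.

Lemma expR_chord (s x : R) : 0 <= x <= 1 -> expR (s * x) <= 1 - x + x * expR s.
Proof.
move=> /andP[x0 x1].
have := @convex_expR R (Itv01 x0 x1) s 0; rewrite !convRE/=.
by rewrite mulr0 addr0 expR0 mulr1 [s * x]mulrC addrC.
Qed.

End hoeffding.

Section bounded_variables.
Context {d : measure_display} {T : measurableType d} {R : realType}
  (mu : probability T R).

Lemma bounded_integrable (f : T -> R) (B : R) : measurable_fun setT f ->
  (forall x, `|f x| <= B) -> mu.-integrable setT (EFin \o f).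
Proof.
move=> mf fB; apply: measurable_bounded_integrable => //.
  by rewrite (le_lt_trans (probability_le1 _ _))// ltry.
by exists B; split=> [|M BM x _]; [exact: num_real|exact: le_trans (fB x) (ltW BM)].
Qed.

Lemma Rintegral_prob_cst (r : R) : \int[mu]_x r = r.
Proof. by rewrite /Rintegral integral_prob_cst. Qed.

Lemma Rintegral_bounds (f : T -> R) (a b : R) : measurable_fun setT f ->
  (forall x, a <= f x <= b) -> a <= \int[mu]_x f x <= b.
Proof.
move=> mf fab.
have fi : mu.-integrable setT (EFin \o f).
  apply: (@bounded_integrable _ (`|a| + `|b|)) => // x.
  have := fab x; rewrite ler_norml => /andP[af fb].
  by have := ler_norm b; have := ler_norm (- a); have := normr_ge0 a;
  have := normr_ge0 b; rewrite normrN; lra.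
have ci r : mu.-integrable setT (EFin \o cst r).
  by apply: (@bounded_integrable _ `|r|).
apply/andP; split.
  rewrite -(Rintegral_prob_cst a); apply: le_Rintegral => //; first exact: ci.
  by move=> x _; case/andP: (fab x).
rewrite -(Rintegral_prob_cst b); apply: le_Rintegral => //; first exact: ci.
by move=> x _; case/andP: (fab x).
Qed.

(** Convexity dominates the exponential of a variable ranging over an interval
    of length 1 by its chord, which reduces to the Bernoulli case. *)
Lemma hoeffding_mgf (Z : T -> R) (lo r : R) : measurable_fun setT Z ->
  (forall x, lo <= Z x <= lo + 1) ->
  (upper_int mu (fun x => (expR (r * (Z x - \int[mu]_x Z x)))%:E) <=
   (expR (r ^+ 2 / 8))%:E)%E.
Proof.
move=> mZ Zlo; set m := \int[mu]_x Z x.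
have /andP[] := Rintegral_bounds mZ Zlo; rewrite -/m => lom mlo.
pose e := expR (- (r * (m - lo))).
pose h x := e * (1 - (Z x - lo) + (Z x - lo) * expR r).
have hE x : h x = e * (1 + lo - lo * expR r) + e * (expR r - 1) * Z x.
  by rewrite /h; ring.
have Zi : mu.-integrable setT (EFin \o Z).
  apply: (@bounded_integrable _ (`|lo| + 1)) => // x.
  have := Zlo x; rewrite ler_norml => /andP[af fb].
  by have := ler_norm lo; have := ler_norm (- lo); have := normr_ge0 lo;
  rewrite normrN; lra.
have cZi c : mu.-integrable setT (EFin \o (fun x => c * Z x)).
  by rewrite (_ : _ \o _ = (fun x => (c%:E * (Z x)%:E)%E))//; exact: integrableZl.
have ci c : mu.-integrable setT (EFin \o cst c).
  by apply: (@bounded_integrable _ `|c|).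
have hi : mu.-integrable setT (EFin \o h).
  rewrite (_ : _ \o _ = (fun x => ((e * (1 + lo - lo * expR r))%:E +
     ((e * (expR r - 1)) * Z x)%:E)%E)); last by apply/funext => x/=; rewrite hE.
  exact: (integrableD _ (ci _) (cZi _)).
have h_ge0 x : 0 <= h x.
  rewrite mulr_ge0 ?expR_ge0//; have := Zlo x => Zx.
  by rewrite addr_ge0 ?mulr_ge0 ?expR_ge0//; lra.
apply: (@le_trans _ _ (\int[mu]_x (h x)%:E)%E).
  apply: upper_int_le_int => [|x|x]; first by case/integrableP: hi.
    by rewrite lee_fin.
  rewrite lee_fin /h.
  rewrite (_ : r * (Z x - m) = - (r * (m - lo)) + r * (Z x - lo)); last by ring.
  rewrite expRD ler_wpM2l ?expR_ge0// expR_chord//.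
  by have := Zlo x; lra.
rewrite -[leLHS]fineK; last exact: integrable_fin_num.
rewrite lee_fin -[fine _]/(\int[mu]_x h x).
rewrite (eq_Rintegral _ (fun x _ => hE x)) (RintegralD measurableT (ci _) (cZi _)).
rewrite (Rintegral_prob_cst (e * (1 + lo - lo * expR r))) RintegralZl// -/m.
rewrite [leLHS](_ : _ = e * (1 - (m - lo) + (m - lo) * expR r)); last by ring.
rewrite /e expRN mulrC ler_pdivrMr ?expR_gt0// -expRD [_ + r * _]addrC.
by apply: bernoulli_mgf; lra.
Qed.

Local Open Scope ereal_scope.

Lemma upper_intD (f g : T -> \bar R) :
  upper_int mu (fun x => f x + g x) <= upper_int mu f + upper_int mu g.
Proof.
have fin_or a x : 0 <= a -> (a \is a fin_num -> x <= a + upper_int mu g) ->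
    x <= a + upper_int mu g.
  case: a => [r _|_ _|//]; first by apply.
  by rewrite addye ?leey// gt_eqF// (lt_le_trans _ (upper_int_ge0 _ _))// ltNyr.
have step h : measurable_fun setT h -> (forall x, 0 <= h x) -> (forall x, f x <= h x) ->
    upper_int mu (fun x => f x + g x) <= \int[mu]_x h x + upper_int mu g.
  move=> mh h0 fh; apply: fin_or => [|ifin]; first exact: integral_ge0.
  rewrite -leeBlDl//; apply: le_ereal_inf_tmp => _ [k [mk k0 gk] <-].
  rewrite leeBlDl// -ge0_integralD//; apply: upper_int_le_int => [|x|x].
  - exact: emeasurable_funD.
  - exact: adde_ge0.
  - exact: leeD.
have [->|gfin] := eqVneq (upper_int mu g) +oo.
  by rewrite addey ?leey// gt_eqF// (lt_le_trans _ (upper_int_ge0 _ _))// ltNyr.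
have {}gfin : upper_int mu g \is a fin_num.
  by rewrite ge0_fin_numE ?upper_int_ge0// ltey.
rewrite -leeBlDr//; apply: le_ereal_inf_tmp => _ [k [mk k0 fk] <-].
by rewrite leeBlDr//; exact: step.
Qed.

End bounded_variables.

Section median_theory.
Context {R : realType}.
Implicit Types s : seq R.

Lemma count_lt_sorted_nth s (a : R) i : sorted <=%R s ->
  (count (< a) s <= i < size s)%N -> a <= nth 0 s i.
Proof.
move=> ss /andP[ci is_]; rewrite leNgt; apply/negP => lta.
suff : (i < count (< a) s)%N by rewrite ltnNge ci.
rewrite -(cat_take_drop i.+1 s) count_cat -[X in (X <= _)%N]addn0.
apply: leq_add => //.
suff /eqP -> : count (< a) (take i.+1 s) == size (take i.+1 s).
  by rewrite size_takel.
rewrite -all_count; apply/(all_nthP 0) => j; rewrite size_takel// => ji.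
rewrite nth_take//; apply: le_lt_trans lta.
by apply: (sorted_leq_nth le_trans lexx) => //; rewrite inE//; apply: leq_trans is_.
Qed.

Lemma count_ge_sorted_nth s (b : R) i : sorted <=%R s ->
  (i + count (> b) s < size s)%N -> nth 0 s i <= b.
Proof.
move=> ss ci; rewrite leNgt; apply/negP => ltb.
have is_ : (i < size s)%N by apply: leq_ltn_trans ci; rewrite leq_addr.
suff : (size s - i <= count (> b) s)%N by lia.
rewrite -(cat_take_drop i s) count_cat; apply: leq_trans (leq_addl _ _).
rewrite cat_take_drop -size_drop.
suff /eqP -> : count (> b) (drop i s) == size (drop i s) by [].
rewrite -all_count; apply/(all_nthP 0) => j; rewrite size_drop => ji /=.
rewrite nth_drop; apply: lt_le_trans ltb _.
have ij : (i + j < size s)%N by rewrite -ltn_subRL.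
by apply: (sorted_leq_nth le_trans lexx) => //; rewrite ?inE// leq_addr.
Qed.

(** If fewer than half of the entries lie outside an interval, neither of the two
    middle positions of the sorted list can hold one of them. *)
Lemma median_between s (a b : R) :
  ((count (fun x => ~~ (a <= x <= b)%R) s).*2 < size s)%N ->
  a <= median s <= b.
Proof.
set bad := count _ s => bads; rewrite /median; set s' := sort _ _.
have ss : sorted <=%R s' by apply: sort_sorted; exact: le_total.
have szs : size s' = size s by rewrite size_sort.
have badE : bad = count (fun x => ~~ (a <= x <= b)%R) s' by rewrite /s' count_sort.
have below : (count (< a) s' <= bad)%N.
  rewrite badE; apply: sub_count => x /= xa.
  by rewrite negb_and -ltNge xa.
have above : (count (> b) s' <= bad)%N.
  rewrite badE; apply: sub_count => x /= xb.
  by rewrite negb_and -!ltNge xb orbT.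
have lo i : ((size s).+1./2.-1 <= i < size s)%N -> a <= nth 0 s' i.
  move=> /andP[i1 i2]; apply: count_lt_sorted_nth => //; rewrite szs i2 andbT.
  by apply: leq_trans below _; lia.
have hi i : (i <= (size s)./2)%N -> nth 0 s' i <= b.
  move=> i1; apply: count_ge_sorted_nth => //; rewrite szs.
  by apply: leq_ltn_trans (leq_add i1 above) _; lia.
have l1 : a <= nth 0 s' (size s).+1./2.-1 by apply: lo; lia.
have l2 : a <= nth 0 s' (size s)./2 by apply: lo; lia.
have h1 : nth 0 s' (size s).+1./2.-1 <= b by apply: hi; lia.
have h2 : nth 0 s' (size s)./2 <= b by apply: hi; lia.
by rewrite ler_pdivlMr// ler_pdivrMr//; lra.
Qed.

End median_theory.

(** * Upper probabilities and couplings *)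

Section upper_probability.
Context {R : realType} {D T : nat} {dX : measure_display}
  {Xi : measurableType dX} (nu : probability Xi R).
Variables (S : forall n : 'I_T.+1, 'M[R]_(D, n) -> Xi -> 'M[R]_(D, T))
  (g : forall t : 'I_T, 'M[R]_(D, obs t) -> R).
Local Notation wp := (wp nu S g).
Local Notation prog := (prog R D T).

(** An upper probability, defined and subadditive for arbitrary events *)
Definition wpr (A : Type) (p : prog A) (E : A -> bool) : \bar R :=
  wp p (fun a => (E a)%:R%:E).

Lemma wpD (A : Type) (p : prog A) (F G : A -> \bar R) :
  (wp p (fun a => F a + G a) <= wp p F + wp p G)%E.
Proof.
elim: p => //= n c k IH; apply: le_trans (upper_intD _ _ _).
by apply: le_upper_int => x.
Qed.

Lemma wpr_le1 (A : Type) (p : prog A) E : (wpr p E <= 1)%E.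
Proof. by apply: wp_le_cst => // a; rewrite lee_fin lern1 leq_b1. Qed.

Lemma wpr_bind (A B : Type) (p : prog A) (f : A -> prog B) E1 E2 (e1 e2 : R) :
  0 <= e2 -> (wpr p E1 <= e1%:E)%E ->
  (forall a, ~~ E1 a -> (wpr (f a) E2 <= e2%:E)%E) ->
  (wpr (bind p f) E2 <= (e1 + e2)%:E)%E.
Proof.
move=> e20 pE1 fE2; rewrite /wpr wp_bind.
rewrite addrC -[e1]mul1r; apply: wp_le_affine pE1 => // a; rewrite mul1e -EFinD.
case: (boolP (E1 a)) => [_|/fE2 H]; last by rewrite addr0.
by apply: le_trans (wpr_le1 _ _) _; rewrite lee_fin ler_wpDl.
Qed.

Lemma wp_map_prog_cons (I A : Type) (f : I -> prog A) (i : I) (s : seq I) F :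
  wp (map_prog f (i :: s)) F =
  wp (f i) (fun a => wp (map_prog f s) (fun l => F (a :: l))).
Proof. by rewrite wp_bind; congr wp; apply/funext => a; rewrite wp_bind. Qed.

Lemma le_wp_map_prog (I A : Type) (f : I -> prog A) (s : seq I)
    (F G : seq A -> \bar R) : (forall l, size l = size s -> (F l <= G l)%E) ->
  (wp (map_prog f s) F <= wp (map_prog f s) G)%E.
Proof.
elim: s F G => [|i s IH] F G FG; first exact: FG.
rewrite !wp_map_prog_cons; apply: le_wp => a; apply: IH => l sl.
by apply: FG => /=; rewrite sl.
Qed.

(** [coupled close eta p q]: the outcome of [p] is, up to probability [eta],
    close to that of [q] for some joint run of the two programs.  It is stated
    through test functions, so that no joint law has to be constructed. *)
Definition coupled (A B : Type) (close : A -> B -> bool) (eta : R)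
    (p : prog A) (q : prog B) :=
  forall (phi : A -> \bar R) (psi : B -> \bar R),
    (forall a, phi a <= 1)%E -> (forall b, 0 <= psi b)%E ->
    (forall a b, close a b -> phi a <= psi b)%E ->
    (wp p phi <= wp q psi + eta%:E)%E.

(** Independent runs are coupled one by one, and the failures add up. *)
Lemma coupled_map_prog (I A B : Type) (close : A -> B -> bool) (eta : R)
    (p : I -> prog A) (q : I -> prog B) (s : seq I) : 0 <= eta ->
  (forall i, coupled close eta (p i) (q i)) ->
  coupled (all2 close) ((size s)%:R * eta) (map_prog p s) (map_prog q s).
Proof.
move=> eta0 pq; elim: s => [|i s IH] phi psi phi1 psi0 close_le.
  by rewrite mul0r adde0; exact: close_le.
rewrite !wp_map_prog_cons.
pose psi' b := (wp (map_prog q s) (fun l => psi (b :: l)) + ((size s)%:R * eta)%:E)%E.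
apply: (@le_trans _ _ (wp (q i) psi' + eta%:E)%E).
  apply: pq => [a|b|a b ab].
  - by apply: (wp_le_cst _ _ _ _ ler01) => l /=.
  - by rewrite adde_ge0 ?lee_fin ?mulr_ge0// wp_ge0.
  - apply: IH => [l|l|l l' ll']; [exact: phi1|exact: psi0|].
    by apply: close_le; rewrite /= ab.
rewrite -natr1 mulrDl mul1r EFinD addeA leeD2r//.
pose F b := wp (map_prog q s) (fun l => psi (b :: l)).
have c0 : 0 <= (size s)%:R * eta by rewrite mulr_ge0.
have := @wp_affine _ _ _ _ _ nu S g _ (q i) F _ 1 c0 ler01.
rewrite mul1e addeC; apply: le_trans; apply: le_wp => b.
by rewrite mul1e addeC.
Qed.

(** Where the outcomes are not close, the test function is bounded by 1; these
    runs have upper probability at most [eta]. *)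
Lemma coupled_simulate (A B : Type) (close : A -> B -> bool) (eta : R)
    (n : 'I_T.+1) (c : 'M[R]_(D, n)) (f : 'M[R]_(D, T) -> prog A) (h : 'M[R]_(D, T) -> B)
    (N : set Xi) :
  0 <= eta -> measurable N -> nu N = 0%E ->
  (forall x, ~ N x ->
    (wpr (f (S c x)) (fun a => ~~ close a (h (S c x))) <= eta%:E)%E) ->
  coupled close eta (bind (do_simulate c) f)
    (bind (do_simulate c) (fun M => Ret (h M))).
Proof.
move=> eta0 mN N0 fh phi psi phi1 psi0 close_le /=.
rewrite [leRHS]addeC -[X in (_ <= _ + X)%E]mul1e.
apply: le_trans (upper_int_affine _ _ _ _) => //.
apply: (ae_le_upper_int mN N0) => x Nx; rewrite mul1e.
have [psi1|psi1] := leP 1%E (psi (h (S c x))).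
  apply: le_trans (wp_le_cst _ _ _ _ ler01 phi1) _ => //.
  by rewrite (le_trans psi1)// leeDr// lee_fin.
have psifin : psi (h (S c x)) \is a fin_num.
  by rewrite ge0_fin_numE// (lt_trans psi1)// ltry.
rewrite -(fineK psifin) addeC -EFinD -[eta]mul1r.
apply: wp_le_affine (fh x Nx) => [||a]; rewrite ?fine_ge0// mul1e fineK//.
case: (boolP (close a _)) => [/close_le|_] /=; first by rewrite adde0.
by apply: le_trans (phi1 a) _; rewrite leeDr.
Qed.

End upper_probability.

(** * Monte Carlo estimation *)

Section monte_carlo.
Context {R : realType} {D T : nat} {dX : measure_display}
  {Xi : measurableType dX} (nu : probability Xi R).
Variables (S : forall n : 'I_T.+1, 'M[R]_(D, n) -> Xi -> 'M[R]_(D, T))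
  (g : forall t : 'I_T, 'M[R]_(D, obs t) -> R).
Local Notation wp := (wp nu S g).
Local Notation wpr := (wpr nu S g).
Local Notation coupled := (coupled nu S g).
Local Notation prog := (prog R D T).

Definition within (e v r : R) := `|r - v| <= e.

Lemma wp_fold_arith op (x : R) (s : seq R) F :
  wp (fold_arith D T op x s) F = F (foldl (arith_val op) x s).
Proof. by elim: s x => //= y s IH x; exact: IH. Qed.

Lemma foldl_add (x : R) (s : seq R) :
  foldl (arith_val Add) x s = \sum_(y <- x :: s) y.
Proof. by rewrite -foldlE. Qed.

Lemma foldl_max_map (I : Type) (v : I -> R) (lo x : R) (s : seq I) : lo <= x ->
  foldl (arith_val Max) x (map v s) = Num.max x (\big[Num.max/lo]_(i <- s) v i).
Proof.
elim: s x => [|i s IH] x lox /=; first by rewrite big_nil; apply/esym/max_idPl.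
by rewrite IH ?le_max ?lox// big_cons maxA.
Qed.

Lemma max_close (e a b a' b' : R) : `|a - a'| <= e -> `|b - b'| <= e ->
  `|Num.max a b - Num.max a' b'| <= e.
Proof.
rewrite !ler_norml => /andP[? ?] /andP[? ?].
by rewrite lerBrDl lerBlDl; apply/andP; split;
  rewrite ?ge_max ?le_max; case: (leP a b) => ?; case: (leP a' b') => ?; lra.
Qed.

Lemma foldl_max_close (I : Type) (v : I -> R) (e x y : R) (s : seq I) l :
  `|x - y| <= e -> all2 (fun r i => within e (v i) r) l s ->
  `|foldl (arith_val Max) x l - foldl (arith_val Max) y (map v s)| <= e.
Proof.
elim: s l x y => [|i s IH] [|r l] x y //= xy /andP[ri ls].
by apply: IH => //; exact: max_close.
Qed.

Lemma wpr_map_prog (I : Type) (f : I -> prog R) (v : I -> R) (e eta : R) (s : seq I) :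
  0 <= eta -> (forall i, (wpr (f i) (fun r => ~~ within e (v i) r) <= eta%:E)%E) ->
  (wpr (map_prog f s) (fun l => ~~ all2 (fun r i => within e (v i) r) l s) <=
   ((size s)%:R * eta)%:E)%E.
Proof.
move=> eta0 fi; elim: s => [|i s IH] /=; first by rewrite mul0r.
rewrite -natr1 mulrDl mul1r addrC.
apply: wpr_bind (fi i) _ => [|r]; first by rewrite mulr_ge0.
rewrite negbK => ri; rewrite -[(size s)%:R * eta]addr0.
by apply: wpr_bind IH _ => // l; rewrite negbK => ls; rewrite /wpr/= ri ls.
Qed.

Section empirical_mean.
Variables (n : 'I_T.+1) (c : 'M[R]_(D, n)) (Phi : 'M[R]_(D, T) -> R) (lo : R).
Hypotheses (mPhi : measurable_fun setT (fun x => Phi (S c x)))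
  (Phi_lo : forall x, lo <= Phi (S c x) <= lo + 1).
Let mu := \int[nu]_x Phi (S c x).
Let ideal := bind (do_simulate c) (fun M => Ret (Phi M)) : prog R.

(** The exponential moment of a sum of independent terms is at most the product
    of their exponential moments. *)
Lemma wp_exp_sum (I : Type) (r : R) (s : seq I) :
  (wp (map_prog (fun=> ideal) s)
     (fun l => (expR (r * \sum_(y <- l) (y - mu)))%:E) <=
   (expR ((size s)%:R * (r ^+ 2 / 8)))%:E)%E.
Proof.
elim: s => [|i s IH]; first by rewrite /= big_nil mulr0 mul0r expR0.
rewrite wp_map_prog_cons.
apply: (@le_trans _ _ (wp ideal (fun a =>
    (expR ((size s)%:R * (r ^+ 2 / 8)))%:E * (expR (r * (a - mu)))%:E)))%E.
  apply: le_wp => a.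
  apply: (@le_trans _ _ (wp (map_prog (fun=> ideal) s) (fun l =>
      (expR (r * (a - mu)))%:E * (expR (r * \sum_(y <- l) (y - mu)))%:E)))%E.
    apply: le_wp => l; rewrite big_cons mulrDr expRD EFinM//.
  apply: le_trans; first by apply: wp_scale; exact: expR_ge0.
  by rewrite muleC lee_wpmul2r// lee_fin expR_ge0.
apply: le_trans; first by apply: wp_scale; exact: expR_ge0.
rewrite (_ : (size (i :: s))%:R = (size s)%:R + 1); last by rewrite natr1.
rewrite mulrDl mul1r expRD EFinM lee_pmul2l ?lte_fin ?expR_gt0//.
exact: hoeffding_mgf.
Qed.

(** Chernoff's method at both tails; the exponents [4 a] and [- 4 a] minimize the
    bound for deviations of size [a]. *)
Lemma wpr_empirical_mean (a : R) (N : nat) : 0 < a ->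
  1 / (2 * a ^+ 2) * ln (2 / (1 / 16)) <= N%:R ->
  (wpr (map_prog (fun=> ideal) (iota 1 N))
     (fun l => (size l == N) && (N%:R * a < `|\sum_(y <- l) (y - mu)|)%R) <=
   (1 / 16)%:E)%E.
Proof.
move=> a0 aN.
have N32 : ln 32 <= 2 * a ^+ 2 * N%:R.
  move: aN; rewrite (_ : 2 / (1 / 16) = 32); last by field.
  by rewrite mul1r mulrC ler_pdivrMr ?mulr_gt0 ?exprn_gt0// mulrC.
pose K := expR (- (N%:R * (4 * a ^+ 2))).
have K0 : 0 <= K by exact: expR_ge0.
pose F r (l : seq R) := (expR (r * \sum_(y <- l) (y - mu)))%:E.
have wpF (r : R) : r ^+ 2 = 16 * a ^+ 2 ->
    (wp (map_prog (fun=> ideal) (iota 1 N)) (fun l => K%:E * F r l) <=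
     (1 / 32)%:E)%E.
  move=> r2; apply: le_trans; first exact: wp_scale.
  apply: (@le_trans _ _ (K%:E * (expR (N%:R * (r ^+ 2 / 8)))%:E)%E).
    by rewrite lee_wpmul2l ?lee_fin// -[in leRHS](size_iota 1 N) wp_exp_sum.
  rewrite -EFinM lee_fin -expRD r2.
  rewrite (_ : _ + _ = - (2 * a ^+ 2 * N%:R)); last by field.
  rewrite expRN mul1r lef_pV2 ?posrE ?expR_gt0//.
  by rewrite -[leLHS]lnK ?posrE// ler_expR.
apply: (@le_trans _ _ (wp (map_prog (fun=> ideal) (iota 1 N))
    (fun l => (K%:E * F (4 * a)%R l + K%:E * F (- (4 * a))%R l)%E))%E).
  apply: le_wp => l; rewrite /F -!EFinM -EFinD lee_fin.
  have e0 r : 0 <= K * expR r by rewrite mulr_ge0 ?expR_ge0.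
  case: (boolP (_ && _)) => [/andP[_]|_] /=; last by rewrite addr_ge0.
  set s := \sum_(y <- l) _; rewrite lter_normr => /orP[sa|sa].
    have sa0 : 0 <= 4 * a * (s - N%:R * a).
      by rewrite mulr_ge0 ?subr_ge0 ?ltW// mulr_gt0.
    by rewrite -[leLHS]addr0 lerD// -expRD -[leLHS]expR0 ler_expR; lra.
  have sa0 : 0 <= 4 * a * (- s - N%:R * a).
    by rewrite mulr_ge0 ?subr_ge0 ?ltW// mulr_gt0.
  by rewrite -[leLHS]add0r lerD// -expRD -[leLHS]expR0 ler_expR; lra.
apply: le_trans (wpD _ _ _ _ _ _) _.
apply: (@le_trans _ _ ((1 / 32)%:E + (1 / 32)%:E)%E).
  by rewrite leeD// wpF//; ring.
by rewrite -EFinD lee_fin; lra.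
Qed.

End empirical_mean.

End monte_carlo.

Section estimator.
Context {R : realType} {D T : nat} {dX : measure_display}
  {Xi : measurableType dX} (nu : probability Xi R).
Variables (S : forall n : 'I_T.+1, 'M[R]_(D, n) -> Xi -> 'M[R]_(D, T))
  (g : forall t : 'I_T, 'M[R]_(D, obs t) -> R).
Local Notation wp := (wp nu S g).
Local Notation wpr := (wpr nu S g).
Local Notation coupled := (coupled nu S g).
Local Notation prog := (prog R D T).

(** The weight [4 ^ bad / 2 ^ size] is at least 1 when at least half of the entries
    are bad, and each independent run multiplies its expectation by 7/8. *)
Lemma wp_median_weight (I : Type) (bad : R -> bool) (p : prog R) (s : seq I) :
  (wpr p bad <= (1 / 4)%:E)%E ->
  (wp (map_prog (fun=> p) s)
     (fun l => (4 ^+ count bad l / 2 ^+ size l)%:E) <= ((7 / 8) ^+ size s)%:E)%E.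
Proof.
move=> pbad; elim: s => [|i s IH]; first by rewrite /= !expr0 divr1.
rewrite wp_map_prog_cons.
apply: (@le_trans _ _ (wp p (fun a => ((1 / 2 + 3 / 2 * (bad a)%:R) *
    (7 / 8) ^+ size s)%:E))).
  apply: le_wp => a.
  have c0 : 0 <= 1 / 2 + 3 / 2 * (bad a)%:R :> R.
    by have : 0 <= (bad a)%:R :> R; [by []|lra].
  apply: (@le_trans _ _ (wp (map_prog (fun=> p) s) (fun l =>
    (1 / 2 + 3 / 2 * (bad a)%:R)%:E * (4 ^+ count bad l / 2 ^+ size l)%:E)%E)).
    apply: le_wp => l; rewrite -EFinM lee_fin /= exprS invfM.
    case: (bad a) => /=; rewrite ?add1n ?add0n ?exprS le_eqVlt; apply/orP; left;
      apply/eqP; by field.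
  apply: le_trans; first exact: wp_scale.
  by rewrite EFinM lee_wpmul2l// lee_fin.
rewrite (_ : (7 / 8) ^+ size (i :: s) = (7 / 8) ^+ size s / 2 +
    ((7 / 8) ^+ size s * (3 / 2)) * (1 / 4)); last by rewrite exprS; field.
have q0 : 0 <= (7 / 8 : R) ^+ size s by rewrite exprn_ge0//; lra.
apply: wp_le_affine pbad => [||a]; first by lra.
  by lra.
by rewrite -EFinM -EFinD lee_fin; lra.
Qed.

(** If the median is off, at least half of the runs are, and then the weight of
    [wp_median_weight] is at least 1. *)
Lemma wpr_median (e v : R) (p : prog R) (L : nat) : (0 < L)%N ->
  (wpr p (fun r => ~~ within e v r) <= (1 / 4)%:E)%E ->
  (wpr (bind (map_prog (fun=> p) (iota 1 L)) (do_median D T))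
     (fun r => ~~ within e v r) <= ((7 / 8) ^+ L)%:E)%E.
Proof.
move=> L0 pbad; rewrite /wpr wp_bind.
have := @wp_median_weight nat _ p (iota 1 L) pbad; rewrite size_iota.
apply: le_trans; apply: le_wp_map_prog => l; rewrite size_iota => lL /=.
rewrite lee_fin; set bad := count _ l.
case: (boolP (within _ _ _)) => [_|] /=; first by rewrite divr_ge0 ?exprn_ge0.
have [bl|bl] := ltnP bad.*2 (size l).
  have [] := andP (@median_between R l (v - e) (v + e) _).
    by move: bl; rewrite /bad; congr (_.*2 < _)%N; apply: eq_count => r;
      rewrite /within ler_distl.
  by move=> h1 h2; rewrite /within ler_distl h1 h2.
move=> _; rewrite ler_pdivlMr ?exprn_gt0// mul1r.
rewrite (_ : 4 = 2 ^+ 2); last by rewrite expr2; ring.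
by rewrite -exprM mulnC muln2 ler_weXn2l//; lra.
Qed.

Lemma le_nat_ceil (x : R) : 0 <= x -> x <= (nat_ceil x)%:R.
Proof.
move=> x0; by rewrite /nat_ceil natr_absz ger0_norm ?ceil_ge// ceil_ge0 (lt_le_trans _ x0)// ltrN10.
Qed.

Lemma nat_ceil_gt0 (x : R) : 0 < x -> (0 < nat_ceil x)%N.
Proof. by move=> x0; rewrite -(ltr_nat R); apply: lt_le_trans (le_nat_ceil (ltW x0)). Qed.

Lemma sum_sub_const (m : R) (l : seq R) :
  \sum_(y <- l) (y - m) = \sum_(y <- l) y - (size l)%:R * m.
Proof.
by rewrite sumrB; congr (_ - _); rewrite big_const_seq count_predT iter_addr_0 mulr_natl.
Qed.

Lemma sum_close (a : R) (l l' : seq R) : all2 (fun r b => within a b r) l l' ->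
  `|\sum_(y <- l) y - \sum_(y <- l') y| <= (size l)%:R * a.
Proof.
elim: l l' => [|y l IH] [|y' l'] //=; first by rewrite !big_nil subrr normr0 mul0r.
move=> /andP[yy' ll']; rewrite !big_cons -natr1 mulrDl mul1r [leRHS]addrC.
rewrite opprD addrACA; apply: le_trans (ler_normD _ _) _.
by rewrite lerD// IH.
Qed.

Variable ev : forall t : 'I_T, 'M[R]_(D, obs t) -> prog R.

(** The specification of [B^(k+1)]; [calB] counts its levels from 1. *)
Definition accurate (k : nat) (t : 'I_T) (c : 'M[R]_(D, obs t)) (v : R) :=
  forall e delta : R, 0 < e -> 0 < delta <= 1 ->
  (wpr (calB ev k.+1 c e delta) (fun r => ~~ within e v r) <= delta%:E)%E.

Section one_level.
Variables (k : nat) (v : forall j : 'I_T, 'M[R]_(D, obs j) -> R) (lo : R).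
Hypotheses (T_gt0 : (0 < T)%N)
  (v_lo : forall (j : 'I_T) (c : 'M[R]_(D, obs j)), lo <= v c <= lo + 1).
Variables (t : 'I_T) (c : 'M[R]_(D, obs t)) (N0 : set Xi).

Let Phi (M : 'M[R]_(D, T)) := \big[Num.max/lo]_(j < T) v (first_cols (obs j) M).

Hypotheses (mPhi : measurable_fun setT (fun x => Phi (S c x)))
  (mN0 : measurable N0) (N00 : nu N0 = 0%E)
  (acc_c : accurate k c (v c))
  (acc_S : forall x, ~ N0 x -> forall j : 'I_T,
     accurate k (first_cols (obs j) (S c x)) (v (first_cols (obs j) (S c x)))).
Let mu := \int[nu]_x Phi (S c x).

Lemma bigmax_bounds (I : finType) (w : I -> R) :
  (forall i, lo <= w i <= lo + 1) -> lo <= \big[Num.max/lo]_i w i <= lo + 1.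
Proof.
move=> wlo; rewrite bigmax_ge_id; apply/bigmax_leP; split=> [|i _]; first lra.
by case/andP: (wlo i).
Qed.

Definition sample_max (a eta : R) : prog R :=
  let! A1 := do_simulate c in
  let! A2 := map_prog (fun j : 'I_T => calB ev k.+1 (first_cols (obs j) A1) a eta)
    (enum 'I_T) in
  fold1_arith _ _ Max A2.

(** The maximum is 1-Lipschitz, so accurate estimates of all the entries yield a
    sample close to the exact maximum along the same simulated trajectory. *)
Lemma coupled_sample_max (a eta : R) : 0 < a -> 0 < eta <= 1 ->
  coupled (fun r b => within a b r) (T%:R * eta) (sample_max a eta)
    (bind (do_simulate c) (fun M => Ret (Phi M))).
Proof.
move=> a0 eta01; have eta0 : 0 <= eta by case/andP: eta01 => /ltW.
apply: (coupled_simulate _ mN0 N00) => [|x Nx]; first by rewrite mulr_ge0.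
rewrite -[_ * eta]addr0 -[X in X%:R * _](size_enum_ord T).
apply: wpr_bind (@wpr_map_prog _ _ _ _ _ nu S g _ _
  (fun j => v (first_cols (obs j) (S c x))) a eta _ eta0 _) _ => //.
  by move=> j; apply: acc_S.
move=> l; rewrite negbK => lv; rewrite /wpr (_ : Phi _ =
    \big[Num.max/lo]_(j <- enum 'I_T) v (first_cols (obs j) (S c x))); last first.
  by rewrite big_enum.
case: (enum 'I_T) (size_enum_ord T) l lv => [|j js].
  by move=> /= T0; exfalso; have := T_gt0; rewrite -T0.
move=> _ [|r l]//= /andP[rj ls]; rewrite wp_fold_arith lee_fin.
rewrite big_cons -foldl_max_map; last by case/andP: (v_lo (first_cols (obs j) (S c x))).
by rewrite [within _ _ _](foldl_max_close rj ls).
Qed.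

(** Half of the error budget goes to the empirical mean of the exact maxima, the
    other half to the distance between exact and estimated maxima. *)
Lemma wpr_sample_mean (a : R) (N : nat) : 0 < a -> (0 < N)%N ->
  1 / (2 * a ^+ 2) * ln (2 / (1 / 16)) <= N%:R ->
  (wpr (map_prog (fun=> sample_max a (1 / (16 * N%:R * T%:R))) (iota 1 N))
    (fun l => (size l != N) || ~~ within (2 * a) mu ((\sum_(y <- l) y) / N%:R)) <=
   (1 / 8)%:E)%E.
Proof.
move=> a0 N0' aN; set eta := 1 / _.
have NR : 0 < N%:R :> R by rewrite ltr0n.
have TR : 0 < T%:R :> R by rewrite ltr0n.
have N1 : 1 <= N%:R :> R by rewrite ler1n.
have T1 : 1 <= T%:R :> R by rewrite ler1n.
have eta01 : 0 < eta <= 1.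
  rewrite /eta divr_gt0 ?mulr_gt0//= ler_pdivrMr ?mulr_gt0// mul1r.
  by rewrite -[leLHS]mulr1 ler_pM//; lra.
pose F l : bool := (size l == N) && ~~ within (2 * a) mu ((\sum_(y <- l) y) / N%:R).
apply: (@le_trans _ _ (wpr (map_prog (fun=> sample_max a eta) (iota 1 N)) F)).
  by apply: le_wp_map_prog => l; rewrite size_iota /F => ->; rewrite eqxx.
have eta0 : 0 <= T%:R * eta by rewrite mulr_ge0//; case/andP: eta01 => /ltW.
have := @coupled_map_prog _ _ _ _ _ nu S g nat _ _ _ _ _ _ (iota 1 N) eta0
  (fun=> coupled_sample_max a0 eta01).
pose psi l : bool := (size l == N) && (N%:R * a < `|\sum_(y <- l) (y - mu)|).
move=> /(_ (fun l => (F l)%:R%:E) (fun l => (psi l)%:R%:E)) cpl.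
apply: le_trans (cpl _ _ _) _ => [l|l|l l' ll'|].
- by rewrite lee_fin lern1 leq_b1.
- by rewrite lee_fin.
- rewrite lee_fin ler_nat /F /psi.
  have [sl _] := andP (etrans (esym (all2E _ _ _)) ll'); rewrite -(eqP sl).
  case: eqP => //= slN; case: (boolP (within _ _ _)) => //= far.
  suff -> : (N%:R * a < `|\sum_(y <- l') (y - mu)|) by [].
  rewrite sum_sub_const -(eqP sl) slN.
  have := sum_close ll'; rewrite slN => cl; move: far; rewrite /within -ltNge.
  move: cl; set A := \sum_(y <- l) y; set B := \sum_(y <- l') y => cl.
  rewrite (_ : A / N%:R - mu = (A - N%:R * mu) / N%:R); last first.
    by rewrite mulrBl [N%:R * mu]mulrC mulfK ?lt0r_neq0.
  rewrite normrM normfV (gtr0_norm NR) ltr_pdivlMr// => AN.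
  have := ler_normD (A - B) (B - N%:R * mu); rewrite addrA subrK => tri.
  by lra.
rewrite size_iota; apply: (@le_trans _ _ ((1 / 16)%:E + (1 / 16)%:E)%E).
  rewrite leeD//.
    apply: (@wpr_empirical_mean _ _ _ _ _ nu S g _ c Phi lo mPhi _ a N a0 aN) => x.
    by apply: bigmax_bounds => j.
  rewrite lee_fin /eta le_eqVlt; apply/orP; left; apply/eqP.
  by field; rewrite !lt0r_neq0.
by rewrite -EFinD lee_fin; lra.
Qed.

(** A run fails with probability at most 1/4: 1/8 for the estimate of [v c] and
    1/8 for the sample mean.  The number of repetitions is such that the median
    fails with probability at most [delta]. *)
Lemma accurate_step : accurate k.+1 c (v c - mu).
Proof.
move=> e delta e0 /andP[d0 d1].
pose N := nat_ceil (1 / (2 * (e / 4) `^ 2) * ln (2 / (1 / 16))).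
pose L := nat_ceil (8 * ln (2 / delta)).
pose run : prog R :=
  let! A3 := calB ev k.+1 c (e / 2) (1 / 8) in
  let! A0 := map_prog (fun _ => sample_max (e / 4) (1 / (16 * N%:R * T%:R))) (iota 1 N) in
  let! total := fold1_arith _ _ Add A0 in
  let! mean := do_arith _ _ Div total N%:R in
  do_arith _ _ Defs.Sub A3 mean.
rewrite [wpr _ _](_ : _ = wpr (bind (map_prog (fun=> run) (iota 1 L)) (do_median D T))
  (fun r => ~~ within e (v c - mu) r)); last by [].
have ln_gt0 x : 1 < x -> 0 < ln x :> R by exact: ln_gt0.
have L0 : 0 < 8 * ln (2 / delta).
  by rewrite mulr_gt0// ln_gt0// ltr_pdivlMr//; lra.
have e4 : (e / 4) `^ 2 = (e / 4) ^+ 2 by rewrite -powR_mulrn//; lra.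
have N1 : 0 < 1 / (2 * (e / 4) `^ 2) * ln (2 / (1 / 16)).
  rewrite e4 mulr_gt0 ?divr_gt0 ?mulr_gt0 ?exprn_gt0 ?divr_gt0// ln_gt0//; lra.
apply: le_trans (wpr_median (nat_ceil_gt0 L0) _) _.
  rewrite (_ : 1 / 4 = 1 / 8 + (1 / 8 + 0)); last by lra.
  have [h1 h2] : 0 < e / 2 /\ 0 < e / 4 by split; lra.
  have d18 : 0 < (1 / 8 : R) <= 1 by lra.
  apply: wpr_bind (acc_c h1 d18) _ => [|A3]; first by lra.
  rewrite negbK => A3v; apply: wpr_bind (wpr_sample_mean h2 (nat_ceil_gt0 N1) _) _ => //.
    by rewrite -e4; apply: le_nat_ceil; apply: ltW.
  move=> l; rewrite negb_or !negbK -/N => /andP[/eqP lN lmu].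
  have NS : (0 < N)%N by exact: nat_ceil_gt0.
  rewrite /wpr; case: l lN lmu => [|y l] lN lmu; first by rewrite -lN in NS.
  rewrite wp_bind wp_fold_arith foldl_add /= lee_fin.
  rewrite (_ : within e _ _ = true)//.
  move: A3v lmu; rewrite /within; set m := _ / N%:R => A3v lmu.
  rewrite (_ : _ - _ = (A3 - v c) - (m - mu)); last by ring.
  by apply: le_trans (ler_normB _ _) _; lra.
rewrite lee_fin -/L; apply: (@le_trans _ _ (expR (- (1 / 8)) ^+ L)).
  have h78 : 7 / 8 <= expR (- (1 / 8)) :> R by have := @expR_ge1Dx R (- (1 / 8)); lra.
  by apply: lerXn2r => //; rewrite nnegrE ?expR_ge0// divr_ge0.
rewrite -expRM_natl.
apply: (@le_trans _ _ (expR (- ln (2 / delta)))).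
  by rewrite ler_expR; have := le_nat_ceil (ltW L0); rewrite -/L; lra.
by rewrite expRN lnK ?posrE ?divr_gt0// invf_div; lra.
Qed.

End one_level.
End estimator.

(** * Laws on product spaces *)

Section laws.
Context {R : realType}.

Definition law {d1 dW} {O : measurableType d1} {W : measurableType dW}
  (m : {measure set O -> \bar R}) (X : O -> W) (mX : measurable_fun setT X) :
  {measure set W -> \bar R} :=
  measure_function_pushforward__canonical__measure_function_Measure m mX.

Context {d1 d2 dW} {O1 : measurableType d1} {O2 : measurableType d2}
  {W : measurableType dW}.
Variables (m1 : {measure set O1 -> \bar R}) (m2 : {measure set O2 -> \bar R}).
Variables (A1 : set O1) (A2 : set O2) (X1 : O1 -> W) (X2 : O2 -> W).
Hypotheses (mA1 : measurable A1) (mA2 : measurable A2)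
  (mX1 : measurable_fun setT X1) (mX2 : measurable_fun setT X2).

Let flag {d'} {O : measurableType d'} (A : set O) (X : O -> W) x := (X x, x \in A).

Let measurable_flag d' (O : measurableType d') (A : set O) (X : O -> W) :
  measurable A -> measurable_fun setT X -> measurable_fun setT (flag A X).
Proof.
move=> mA mX; apply: measurable_fun_pair => //.
apply: (measurable_fun_bool true); rewrite setTI (_ : _ @^-1` _ = A) //.
by apply/seteqP; split=> x /=; [exact: set_mem|exact: mem_set].
Qed.

(** Change of variables between restricted laws.  Membership in the domains is
    carried along as a boolean coordinate, so that both integrals become
    integrals over the whole space. *)
Lemma integral_transfer (f : W -> \bar R) :
  (forall E, measurable E -> m1 (A1 `&` X1 @^-1` E) = m2 (A2 `&` X2 @^-1` E)) ->
  measurable_fun setT f -> (forall y, 0 <= f y)%E ->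
  (\int[m1]_(x in A1) f (X1 x) = \int[m2]_(x in A2) f (X2 x))%E.
Proof.
move=> m12 mf f0.
pose D : set (W * bool) := setT `*` [set true].
have mD : measurable D by exact: measurableX.
have pre d' (O : measurableType d') (A : set O) X : flag A X @^-1` D = A.
  by apply/seteqP; split=> x /=; [case=> _ /set_mem|move=> Ax; split=> //; exact: mem_set].
have mf' : measurable_fun D (fun y : W * bool => f y.1).
  by apply: measurable_funTS; exact: measurableT_comp mf measurable_fst.
have mF1 := measurable_flag mA1 mX1; have mF2 := measurable_flag mA2 mX2.
have f'0 : {in D, forall y : W * bool, (0 <= f y.1)%E} by [].
rewrite -[in LHS](pre _ _ A1 X1) -[in RHS](pre _ _ A2 X2).
rewrite -(ge0_integral_pushforward mF1 m1 mD mf' f'0).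
rewrite -(ge0_integral_pushforward mF2 m2 mD mf' f'0).
rewrite -[pushforward m1 _]/(law m1 mF1 : set _ -> _).
rewrite -[pushforward m2 _]/(law m2 mF2 : set _ -> _).
apply: eq_measure_integral => E mE ED; rewrite /law /=.
pose E' := (fun w => (w, true)) @^-1` E.
have mE' : measurable E'.
  by rewrite -[E']setTI; apply: (measurable_fun_pair (@measurable_id _ _ _) (measurable_cst true)).
have preE d' (O : measurableType d') (A : set O) X : flag A X @^-1` E = A `&` X @^-1` E'.
  apply/seteqP; split=> x /=.
    rewrite /flag /E' /= => Ex; have [_ /= xA] := ED _ Ex.
    by split; [exact: set_mem|rewrite xA in Ex].
  by rewrite /flag => -[/mem_set ->].
by rewrite /pushforward !preE m12.
Qed.

End laws.

(** Uniqueness of measures applies to the pi-system of rectangles. *)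
Lemma rectangles_determine {R : realType} {d1 d2 dU dV} {O1 : measurableType d1}
    {O2 : measurableType d2} {U : measurableType dU} {V : measurableType dV}
    (m1 : {measure set O1 -> \bar R}) (m2 : {measure set O2 -> \bar R})
    (X1 : O1 -> U * V) (X2 : O2 -> U * V) :
  measurable_fun setT X1 -> measurable_fun setT X2 -> (m1 setT < +oo)%E ->
  (forall A B, measurable A -> measurable B ->
    m1 (X1 @^-1` (A `*` B)) = m2 (X2 @^-1` (A `*` B))) ->
  forall E, measurable E -> m1 (X1 @^-1` E) = m2 (X2 @^-1` E).
Proof.
move=> mX1 mX2 fin rect E mE.
pose G := [set A `*` B | A in @measurable _ U & B in @measurable _ V].
have GI : setI_closed G.
  move=> _ _ [A mA [B mB <-]] [A' mA' [B' mB' <-]].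
  exists (A `&` A'); first exact: measurableI.
  by exists (B `&` B'); [exact: measurableI|rewrite setXI].
have GT : G setT by exists setT => //; exists setT => //; rewrite setXTT.
apply: (@measure_unique _ _ _ G (fun=> setT) (measurable_prod_measurableType U V) GI
  (fun=> GT) _ (law m1 mX1) (law m2 mX2)) => //.
- by rewrite bigcup_const.
- by move=> _ [A mA [B mB <-]]; exact: rect.
Qed.

(** * Trajectories *)

Section matrix_measurability.
Context {dE dV : measure_display} {E : measurableType dE} {V : measurableType dV}.

Lemma measurable_entry m n (i : 'I_m) (j : 'I_n) :
  measurable_fun setT (fun M : 'M[E]_(m, n) => M i j).
Proof.
move=> _ B mB; rewrite setTI; apply: sub_sigma_algebra.
by exists i, j; exists B.
Qed.

Lemma measurable_matrix m n (f : V -> 'M[E]_(m, n)) :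
  (forall i j, measurable_fun setT (fun v => f v i j)) -> measurable_fun setT f.
Proof.
move=> mf; apply: (measurability (@matrix_cylinders _ E m n)) => //.
by move=> _ [_ [i [j [B mB ->]]] <-]; exact: mf.
Qed.

End matrix_measurability.

Section column_measurability.
Context {R : realType} {D T : nat}.

Lemma measurable_first_cols (n : 'I_T.+1) :
  measurable_fun setT (@first_cols R D T n).
Proof.
apply: measurable_matrix => i j; under eq_fun do rewrite mxE.
exact: measurable_entry.
Qed.

Lemma measurable_last_cols (n : 'I_T.+1) :
  measurable_fun setT (@last_cols R D T n).
Proof.
apply: measurable_matrix => i j; under eq_fun do rewrite mxE.
exact: measurable_entry.
Qed.

Lemma measurable_matrix_eq m n : measurable [set x : 'M[R]_(m, n) * 'M[R]_(m, n) | x.1 = x.2].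
Proof.
rewrite [X in measurable X](_ : _ = \bigcap_(i in [set: 'I_m])
    \bigcap_(j in [set: 'I_n])
      [set x : 'M[R]_(m, n) * 'M[R]_(m, n) | x.1 i j == x.2 i j]); last first.
  apply/seteqP; split => [[A B] /= -> i _ j _ //=|[A B] AB /=].
  by apply/matrixP => i j; exact/eqP/(AB i I j I).
apply: fin_bigcap_measurable => // i _; apply: fin_bigcap_measurable => // j _.
rewrite -[X in measurable X]setTI.
apply: (measurable_fun_eqr _ _ measurableT (Y := [set true])) => //.
  by apply: measurableT_comp (measurable_entry i j) measurable_fst.
by apply: measurableT_comp (measurable_entry i j) measurable_snd.
Qed.

End column_measurability.
Arguments measurable_first_cols {R D T} n.
Arguments measurable_last_cols {R D T} n.
Arguments measurable_matrix_eq {R} m n.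

Lemma negligible_fin_bigcup {d} {O : measurableType d} {R : realType}
    (m : {measure set O -> \bar R}) n (F : 'I_n -> set O) :
  (forall i, m.-negligible (F i)) -> m.-negligible (\bigcup_(i in [set: 'I_n]) F i).
Proof.
move=> mF; pose F' k := if insub k is Some i then F i else set0.
apply: (@negligibleS _ _ _ _ (\bigcup_k F' k)).
  by move=> x [i _ Fix]; exists (val i) => //; rewrite /F' valK.
by apply: negligible_bigcup => k; rewrite /F'; case: insub => // *; exact: negligible_set0.
Qed.

Section conditional_simulation.
Context {R : realType} {D T : nat} {d dX : measure_display}
  {Omega : measurableType d} (P : probability Omega R)
  (Y : Omega -> 'M[R]_(D, T)) {Xi : measurableType dX} (nu : probability Xi R)
  (S : forall n : 'I_T.+1, 'M[R]_(D, n) -> Xi -> 'M[R]_(D, T)).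
Hypotheses (mY : measurable_fun setT Y) (S_sampler : conditional_sampler P Y nu S).

Definition past (n : 'I_T.+1) (w : Omega) := first_cols n (Y w).

Lemma measurable_past n : measurable_fun setT (past n).
Proof. exact: measurableT_comp (measurable_first_cols n) mY. Qed.
Arguments measurable_past n : clear implicits.

Lemma measurable_simulate dV (V : measurableType dV) (n : 'I_T.+1)
    (c : V -> 'M[R]_(D, n)) (x : V -> Xi) :
  measurable_fun setT c -> measurable_fun setT x ->
  measurable_fun setT (fun v => S (c v) (x v)).
Proof.
move=> mc mx; have [mS _] := S_sampler n.
exact: (measurableT_comp mS (measurable_fun_pair mc mx)).
Qed.

Let resample (n : 'I_T.+1) (wx : Omega * Xi) :=
  (past n wx.1, S (past n wx.1) wx.2).

Let measurable_resample n : measurable_fun setT (@resample n).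
Proof.
have mp : measurable_fun setT (fun wx : Omega * Xi => past n wx.1).
  exact: measurableT_comp (measurable_past n) measurable_fst.
exact: measurable_fun_pair mp (measurable_simulate mp measurable_snd).
Qed.
Arguments measurable_resample n : clear implicits.

(** The definition of a sampler gives this equality on rectangles. *)
Lemma sampler_law (n : 'I_T.+1) (E : set ('M[R]_(D, n) * 'M[R]_(D, T))) : measurable E ->
  P ((fun w : Omega => (past n w, Y w)) @^-1` E) = (P \x nu)%E (@resample n @^-1` E).
Proof.
apply: rectangles_determine => [|||A B mA mB].
- exact: measurable_fun_pair (measurable_past n) mY.
- exact: measurable_resample.
- by rewrite (le_lt_trans (probability_le1 _ _))// ltry.
rewrite [LHS]((S_sampler n).2 A B mA mB) integral_mkcond.
apply: eq_integral => w _ /=; rewrite patchE.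
case: ifPn => [/set_mem wA|/negP wA].
  congr (_ _); apply/seteqP; split=> x; rewrite /xsection /=.
    by move=> ?; exact: mem_set.
  by move=> /set_mem[].
rewrite (_ : xsection _ _ = set0) ?measure0//.
by apply/seteqP; split=> x; rewrite /xsection //= => /set_mem [/= wA' _];
  apply: wA; exact: mem_set.
Qed.

(** By [sampler_law] the integral of the conditional measure of a null set
    vanishes, hence so does the conditional measure itself almost surely. *)
Lemma sampler_null (n : 'I_T.+1) (E : set ('M[R]_(D, n) * 'M[R]_(D, T))) :
    measurable E -> P ((fun w : Omega => (past n w, Y w)) @^-1` E) = 0%E ->
  let N := [set M | nu ((fun x => (first_cols n M, S (first_cols n M) x)) @^-1` E) != 0%E] in
  measurable N /\ P (Y @^-1` N) = 0%E.
Proof.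
move=> mE PE N.
pose F := (fun Mx : 'M[R]_(D, T) * Xi => (first_cols n Mx.1, S (first_cols n Mx.1) Mx.2)) @^-1` E.
have mF : measurable F.
  rewrite -[F]setTI; apply: measurable_fun_pair measurableT _ mE.
    exact: measurableT_comp (measurable_first_cols n) measurable_fst.
  apply: measurable_simulate => //.
  exact: measurableT_comp (measurable_first_cols n) measurable_fst.
have secF M : xsection F M = (fun x => (first_cols n M, S (first_cols n M) x)) @^-1` E.
  by apply/seteqP; split => x; rewrite /xsection /= => ?; [exact: set_mem|exact: mem_set].
have mnu := measurable_fun_xsection nu mF.
have mN : measurable N.
  rewrite (_ : N = (nu \o xsection F) @^-1` (~` [set 0%E])); last first.
    by apply/seteqP; split=> M; rewrite /N /= secF => /eqP.
  by rewrite -[X in measurable X]setTI; apply: mnu => //; exact: measurableC.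
split=> //; have /eqP := PE; rewrite sampler_law// => /eqP I0.
pose h w := nu (xsection F (Y w)).
have mh : measurable_fun setT h by exact: measurableT_comp mnu mY.
have h0 : (\int[P]_x `|h x|)%E = 0%E.
  by rewrite -I0; apply: eq_integral => w _; rewrite /h gee0_abs.
have [A [mA A0 hA]] := (ae_eq_integral_abs P measurableT mh).1 h0.
apply/eqP; rewrite eq_le -{1}A0; apply/andP; split=> //; apply: le_measure.
- by rewrite inE -[Y @^-1` _]setTI; exact: mY.
- by rewrite inE.
- by move=> w Nw; apply: hA => /= /(_ I); move: Nw; rewrite /N /= -secF => /eqP.
Qed.

Variable g : forall t : 'I_T, 'M[R]_(D, obs t) -> R.
Hypotheses (mg : forall t, measurable_fun setT (@g t))
  (g_ge0 : forall t w, 0 <= reward Y g t w).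

Fixpoint good_upto (k : nat) : set 'M[R]_(D, T) :=
  if k is k'.+1 then good_upto k' `&` \bigcap_(t in [set: 'I_T])
    [set M | nu [set x | ~ (first_cols (obs t) (S (first_cols (obs t) M) x) =
                            first_cols (obs t) M /\
                            good_upto k' (S (first_cols (obs t) M) x))] = 0%E]
  else \bigcap_(t in [set: 'I_T]) [set M | 0 <= g (first_cols (obs t) M)].

(** Trajectories on which the rewards are nonnegative, and from which almost
    every simulation continues the given past and is good again, and so on.
    The algorithm simulates from simulated histories, to any depth; on this set
    of full probability none of these histories is exceptional. *)
Definition good := \bigcap_k good_upto k.

Let step_set k (t : 'I_T) : set ('M[R]_(D, obs t) * 'M[R]_(D, T)) :=
  [set cM | ~ (first_cols (obs t) cM.2 = cM.1 /\ good_upto k cM.2)].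

Let measurable_step_set k t : measurable (good_upto k) -> measurable (@step_set k t).
Proof.
move=> mG; apply: measurableC; apply: measurableI.
  pose f (cM : 'M[R]_(D, obs t) * 'M[R]_(D, T)) := (first_cols (obs t) cM.2, cM.1).
  have mf : measurable_fun setT f.
    apply: measurable_fun_pair => //.
    exact: measurableT_comp (measurable_first_cols _) measurable_snd.
  have := mf measurableT _ (measurable_matrix_eq D (obs t)).
  by rewrite setTI.
by rewrite -[X in measurable X]setTI; exact: measurable_snd.
Qed.

Lemma good_upto_ae k : measurable (good_upto k) /\ P (Y @^-1` (~` good_upto k)) = 0%E.
Proof.
elim: k => [|k [mG G0]] /=.
  split.
    apply: fin_bigcap_measurable => // t _; rewrite -[X in measurable X]setTI.
    have := measurableT_comp (@mg t) (measurable_first_cols (obs t)).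
    by move=> /(_ measurableT _ (measurable_itv `[0, +oo[%R)); congr measurable;
       apply/seteqP; split=> M [_]; rewrite /= in_itv/= andbT.
  rewrite (_ : _ @^-1` _ = set0) ?measure0//.
  by apply/seteqP; split=> w //=; apply => t _; exact: g_ge0.
pose B (t : 'I_T) := [set M | nu ((fun x => (first_cols (obs t) M,
  S (first_cols (obs t) M) x)) @^-1` @step_set k t) != 0%E].
have step t : measurable (B t) /\ P (Y @^-1` B t) = 0%E.
  apply: sampler_null; first exact: measurable_step_set.
  rewrite (_ : _ @^-1` _ = Y @^-1` (~` good_upto k))//.
  apply/seteqP; split=> w /=; rewrite /step_set /past /=.
    by move=> nG Gw; apply: nG.
  by move=> nG [_].
have BE t : [set M | nu [set x | ~ (first_cols (obs t) (S (first_cols (obs t) M) x) =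
      first_cols (obs t) M /\ good_upto k (S (first_cols (obs t) M) x))] = 0%E] = ~` B t.
  by apply/seteqP; split => M /= => [h /eqP|/negP]; [exact|rewrite negbK => /eqP].
have GE : good_upto k `&` \bigcap_(t in [set: 'I_T])
    [set M | nu [set x | ~ (first_cols (obs t) (S (first_cols (obs t) M) x) =
                            first_cols (obs t) M /\
                            good_upto k (S (first_cols (obs t) M) x))] = 0%E] =
    ~` (~` good_upto k `|` \bigcup_(t in [set: 'I_T]) B t).
  rewrite setCU setCK setC_bigcup; congr (_ `&` _).
  by apply: eq_bigcapr => t _; exact: BE.
have mB : measurable (~` good_upto k `|` \bigcup_(t in [set: 'I_T]) B t).
  apply: measurableU; first exact: measurableC.
  by apply: fin_bigcup_measurable => // t _; exact: (step t).1.
rewrite GE setCK; split; first exact: measurableC.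
have mYp A : measurable A -> measurable (Y @^-1` A).
  by move=> mA; rewrite -[Y @^-1` _]setTI; exact: mY.
apply/negligibleP; first exact: mYp.
rewrite preimage_setU; apply: negligibleU.
  by apply/negligibleP => //; apply: mYp; exact: measurableC.
rewrite preimage_bigcup; apply: negligible_fin_bigcup => t.
by apply/negligibleP; [apply: mYp; exact: (step t).1|exact: (step t).2].
Qed.

Lemma measurable_good : measurable good.
Proof. by apply: bigcapT_measurable => k; exact: (good_upto_ae k).1. Qed.

Lemma good_ae : P (Y @^-1` (~` good)) = 0%E.
Proof.
have mYp A : measurable A -> measurable (Y @^-1` A).
  by move=> mA; rewrite -[Y @^-1` _]setTI; exact: mY.
apply/negligibleP; first by apply: mYp; apply: measurableC; exact: measurable_good.
rewrite /good setC_bigcap preimage_bigcup; apply: negligible_bigcup => k.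
apply/negligibleP; last exact: (good_upto_ae k).2.
by apply: mYp; apply: measurableC; exact: (good_upto_ae k).1.
Qed.

Lemma good_ge0 M t : good M -> 0 <= g (first_cols (obs t) M).
Proof. by move=> /(_ 0%N I) /(_ t I). Qed.

Lemma good_resample M (t : 'I_T) : good M -> exists N : set Xi,
  [/\ measurable N, nu N = 0%E & forall x, ~ N x ->
    first_cols (obs t) (S (first_cols (obs t) M) x) = first_cols (obs t) M /\
    good (S (first_cols (obs t) M) x)].
Proof.
move=> gM; pose N k := [set x | ~ (first_cols (obs t) (S (first_cols (obs t) M) x) =
  first_cols (obs t) M /\ good_upto k (S (first_cols (obs t) M) x))].
have N0 k : nu (N k) = 0%E by have := gM k.+1 I => -[_ /(_ t I)].
have mN k : measurable (N k).
  have := @measurable_step_set k t (good_upto_ae k).1.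
  have : measurable_fun setT (fun x => (first_cols (obs t) M, S (first_cols (obs t) M) x)).
    by apply: measurable_fun_pair => //; apply: measurable_simulate.
  by move=> /[swap] mS /(_ measurableT _ mS); rewrite setTI.
exists (\bigcup_k N k); split.
- exact: bigcupT_measurable.
- apply/negligibleP; first exact: bigcupT_measurable.
  apply: negligible_bigcup => k.
  by exists (N k); split; [exact: mN|exact: N0|].
- move=> x Nx; have Gx k : ~ N k x by move=> Nkx; apply: Nx; exists k.
  split=> [|k _]; last by have /contrapT [] := Gx k.
  by have /contrapT [] := Gx 0%N.
Qed.

End conditional_simulation.

(** * Residual rewards *)

Section residual_rewards.
Context {R : realType} {D T : nat} {dX : measure_display}
  {Xi : measurableType dX} (nu : probability Xi R)
  (S : forall n : 'I_T.+1, 'M[R]_(D, n) -> Xi -> 'M[R]_(D, T))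
  (g : forall t : 'I_T, 'M[R]_(D, obs t) -> R) (U : R).

(** [Z^1] ranges over [[0, 1]] and the later residuals over [[-1, 0]]. *)
Definition floor_of (k : nat) : R := if k is 0 then 0 else -1.

(** With [Z^1] the truncated rewards and [Z^(k+1)_t = Z^k_t - E (max_s Z^k_s | F_t)],
    [resid k] computes [Z^(k+1)_t] from the history.  The clipping, inactive on
    almost every trajectory, keeps everything bounded on the others. *)
Fixpoint resid (k : nat) (t : 'I_T) (c : 'M[R]_(D, obs t)) : R :=
  if k is k'.+1 then
    Num.max (-1) (Num.min 0 (resid k' c - \int[nu]_x
      \big[Num.max/floor_of k']_(j < T) resid k' (first_cols (obs j) (S c x))))
  else Num.min U (Num.max 0 (g c)) / U.

Definition best (k : nat) (M : 'M[R]_(D, T)) : R :=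
  \big[Num.max/floor_of k]_(j < T) resid k (first_cols (obs j) M).

Definition price (k : nat) (t : 'I_T) (c : 'M[R]_(D, obs t)) : R :=
  \int[nu]_x best k (S c x).

Hypotheses (U_gt0 : 0 < U)
  (mS : forall n : 'I_T.+1,
     measurable_fun setT (fun cx : 'M[R]_(D, n) * Xi => S cx.1 cx.2))
  (mg : forall t, measurable_fun setT (@g t)).

Lemma resid_bounds k (t : 'I_T) (c : 'M[R]_(D, obs t)) :
  floor_of k <= resid k c <= floor_of k + 1.
Proof.
case: k => [|k] /=; last by rewrite le_max lexx /= ge_max ge_min; lra.
rewrite add0r divr_ge0 ?(ltW U_gt0)//=; last by rewrite le_min (ltW U_gt0) le_max lexx.
by rewrite ler_pdivrMr// mul1r ge_min lexx.
Qed.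

Lemma best_bounds k M : floor_of k <= best k M <= floor_of k + 1.
Proof. by apply: bigmax_bounds => j; exact: resid_bounds. Qed.

Lemma measurable_bigmax dV (V : measurableType dV) (I : Type) (s : seq I) (b : R)
    (F : I -> V -> R) : (forall i, measurable_fun setT (F i)) ->
  measurable_fun setT (fun v => \big[Num.max/b]_(i <- s) F i v).
Proof.
move=> mF; elim: s => [|i s IH].
  by under eq_fun do rewrite big_nil; exact: measurable_cst.
by under eq_fun do rewrite big_cons; exact: measurable_maxr.
Qed.

(** Tonelli's theorem applies after a shift that makes the integrand
    nonnegative. *)
Lemma measurable_price_of (n : 'I_T.+1) (f : 'M[R]_(D, T) -> R) (lo : R) :
  measurable_fun setT f -> (forall M, lo <= f M <= lo + 1) ->
  measurable_fun setT (fun c : 'M[R]_(D, n) => \int[nu]_x f (S c x)).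
Proof.
move=> mf flo.
have mfS : measurable_fun setT (fun cx : 'M[R]_(D, n) * Xi => f (S cx.1 cx.2) - lo).
  by apply: measurable_funB => //; exact: measurableT_comp mf (@mS n).
have mSc (c : 'M[R]_(D, n)) : measurable_fun setT (fun x => f (S c x)).
  apply: measurableT_comp mf _.
  exact: (measurableT_comp (@mS n) (measurable_fun_pair (measurable_cst c) (@measurable_id _ _ _))).
rewrite (_ : (fun c => _) = (fun c => fine (fubini_F nu
   (fun cx : 'M[R]_(D, n) * Xi => (f (S cx.1 cx.2) - lo)%:E) c) + lo)); last first.
  apply/funext => c; rewrite /fubini_F /= -[fine _]/(\int[nu]_x (f (S c x) - lo)).
  rewrite (RintegralB measurableT).
  - by rewrite Rintegral_prob_cst subrK.
  - apply: (@bounded_integrable _ _ _ _ _ (`|lo| + 1)) => // x.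
    have := flo (S c x) => fb; rewrite ler_norml.
    by have := ler_norm lo; have := ler_norm (- lo); have := normr_ge0 lo; rewrite normrN; lra.
  - by apply: (@bounded_integrable _ _ _ _ _ `|lo|).
apply: measurable_funD => //; apply: measurableT_comp; first exact: fine_measurable.
apply: measurable_fun_fubini_tonelli_F; first exact/measurable_EFinP.
by move=> [c x] /=; rewrite lee_fin subr_ge0; case/andP: (flo (S c x)).
Qed.

Lemma measurable_resid k t : measurable_fun setT (@resid k t).
Proof.
elim: k t => [|k IH] t /=.
  apply: measurable_funM => //; apply: measurable_minr => //.
  by apply: measurable_maxr => //; exact: mg.
apply: measurable_maxr => //; apply: measurable_minr => //.
apply: measurable_funB; first exact: IH.
apply: (@measurable_price_of (obs t) (best k) (floor_of k)); last exact: best_bounds.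
apply: measurable_bigmax => j.
exact: (measurableT_comp (@IH j) (measurable_first_cols (obs j))).
Qed.

Lemma measurable_best k : measurable_fun setT (best k).
Proof.
apply: measurable_bigmax => j.
exact: (measurableT_comp (@measurable_resid k j) (measurable_first_cols (obs j))).
Qed.

Lemma measurable_price k t : measurable_fun setT (@price k t).
Proof. exact: measurable_price_of (@measurable_best k) (@best_bounds k). Qed.

Lemma measurable_best_simulate k (n : 'I_T.+1) (c : 'M[R]_(D, n)) :
  measurable_fun setT (fun x => best k (S c x)).
Proof.
apply: (measurableT_comp (@measurable_best k)).
exact: (measurableT_comp (@mS n) (measurable_fun_pair (measurable_cst c) (@measurable_id _ _ _))).
Qed.

Lemma price_bounds k t (c : 'M[R]_(D, obs t)) :
  floor_of k <= price k c <= floor_of k + 1.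
Proof. by apply: Rintegral_bounds; [exact: measurable_best_simulate|move=> x; exact: best_bounds]. Qed.

Lemma ae_Rintegral_bounds (f : Xi -> R) (N : set Xi) (a b : R) :
  measurable_fun setT f -> measurable N -> nu N = 0%E ->
  (forall x, ~ N x -> a <= f x <= b) -> a <= b -> a <= \int[nu]_x f x <= b.
Proof.
move=> mf mN N0 fab ab; pose f' x := Num.max a (Num.min b (f x)).
have mf' : measurable_fun setT f' by apply: measurable_maxr => //; exact: measurable_minr.
rewrite (_ : \int[nu]_x f x = \int[nu]_x f' x).
  apply: Rintegral_bounds => // x; rewrite /f' le_max lexx ge_max ab ge_min lexx//.
congr fine; apply: ae_eq_integral => //; try exact/measurable_EFinP.
exists N; split=> // x /= ne; apply: contrapT => Nx; apply: ne => _.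
by have /andP[af fb] := fab x Nx; rewrite /f' (min_idPr fb) (max_idPr af).
Qed.

Section good_trajectories.
Hypothesis T_gt0 : (0 < T)%N.
Variable Gd : set 'M[R]_(D, T).
Hypotheses (Gd_ge0 : forall M (t : 'I_T), Gd M -> 0 <= g (first_cols (obs t) M))
  (Gd_resample : forall M (t : 'I_T), Gd M -> exists N : set Xi,
    [/\ measurable N, nu N = 0%E & forall x, ~ N x ->
      first_cols (obs t) (S (first_cols (obs t) M) x) = first_cols (obs t) M /\
      Gd (S (first_cols (obs t) M) x)]).
Variables (M : 'M[R]_(D, T)) (M_good : Gd M).
Implicit Types (k : nat) (t : 'I_T).

Lemma resid_le_best k t (M' : 'M[R]_(D, T)) : resid k (first_cols (obs t) M') <= best k M'.
Proof. exact: (le_bigmax _ (fun j : 'I_T => resid k (first_cols (obs j) M'))). Qed.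

Lemma resid_le_price k t : resid k (first_cols (obs t) M) <= price k (first_cols (obs t) M).
Proof.
have [N [mN N0 HN]] := Gd_resample t M_good.
have /andP[_ fb] := resid_bounds k (first_cols (obs t) M).
have [] // := andP (@ae_Rintegral_bounds _ N (resid k (first_cols (obs t) M)) (floor_of k + 1)
  (measurable_best_simulate k (first_cols (obs t) M)) mN N0 _ fb).
move=> x /HN [E _]; rewrite (andP (best_bounds _ _)).2 andbT.
by rewrite -{1}E resid_le_best.
Qed.

(** On good trajectories the clipping is inactive, because the current residual
    is at most the expectation of the maximum that it takes part in. *)
Lemma residS k t : resid k.+1 (first_cols (obs t) M) =
  resid k (first_cols (obs t) M) - price k (first_cols (obs t) M).
Proof.
rewrite [LHS]/= -/(best k _) -/(price k _).
have := resid_le_price k t.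
have := price_bounds k (first_cols (obs t) M).
have := resid_bounds k (first_cols (obs t) M).
move=> rb pb rp; rewrite (min_idPr _) ?(max_idPr _)//; last by lra.
by case: k rb pb rp => [|k] /=; lra.
Qed.

Lemma best_mono k : (0 < k)%N -> best k M <= best k.+1 M.
Proof.
case: k => // k _; apply/bigmax_leP; split=> [|j _].
  by case/andP: (best_bounds k.+2 M).
apply: le_trans (resid_le_best _ j _); rewrite (residS k.+1 j).
by have := price_bounds k.+1 (first_cols (obs j) M); rewrite /=; lra.
Qed.

Lemma first_cols_last t (A B : 'M[R]_(D, T)) : t.+1 = T ->
  first_cols (obs t) A = first_cols (obs t) B -> A = B.
Proof.
move=> tT AB; apply/matrixP => i j.
have jT : (j < obs t)%N by rewrite /= /bump /= add1n tT.
move/matrixP: AB => /(_ i (Ordinal jT)); rewrite !mxE.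
by rewrite (_ : widen_ord _ _ = j)//; exact: val_inj.
Qed.

(** At the last date a simulation reproduces the trajectory. *)
Lemma price_last k t : t.+1 = T -> price k (first_cols (obs t) M) = best k M.
Proof.
move=> tT; have [N [mN N0 HN]] := Gd_resample t M_good; apply/eqP; rewrite eq_le andbC.
apply: (ae_Rintegral_bounds _ mN N0) => // [|x /HN[E _]].
  exact: measurable_best_simulate.
by rewrite (first_cols_last tT E) lexx.
Qed.

(** The losses [- best l M] sum to at most 1 along the last date and decrease
    with [l], so the [k]-th is at most [1 / k]. *)
Lemma best_ge k : (0 < k)%N -> - k%:R^-1 <= best k M.
Proof.
move=> k0; have lastT : (T.-1 < T)%N by rewrite prednK.
pose t := Ordinal lastT; have tT : t.+1 = T by rewrite /= prednK.
pose c := first_cols (obs t) M.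
have cS l : resid l.+1 c = resid l c - best l M by rewrite residS price_last.
have sum_loss l : l.+1%:R * - best l.+1 M <= resid l.+2 c - resid 1 c.
  elim: l => [|l IH]; first by rewrite mul1r cS addrAC subrr add0r.
  rewrite -natr1 mulrDl mul1r (cS l.+2) -addrA [- best _ _ + _]addrC addrA lerD2r.
  by apply: le_trans IH; rewrite ler_wpM2l// lerN2 best_mono.
case: k k0 => // k _; rewrite lerNl -[leRHS]mul1r ler_pdivlMr ?ltr0n// mulrC.
apply: le_trans (sum_loss k) _.
by have := resid_bounds k.+2 c; have := resid_bounds 1 c; rewrite /=; lra.
Qed.

End good_trajectories.
End residual_rewards.

(** * Accuracy of the algorithm *)

Section accuracy.
Context {R : realType} {D T : nat} {dX : measure_display}
  {Xi : measurableType dX} (nu : probability Xi R)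
  (S : forall n : 'I_T.+1, 'M[R]_(D, n) -> Xi -> 'M[R]_(D, T))
  (g : forall t : 'I_T, 'M[R]_(D, obs t) -> R) (U : R).
Hypotheses (U_gt0 : 0 < U)
  (mS : forall n : 'I_T.+1,
     measurable_fun setT (fun cx : 'M[R]_(D, n) * Xi => S cx.1 cx.2))
  (mg : forall t, measurable_fun setT (@g t)).
Hypothesis T_gt0 : (0 < T)%N.
Variable Gd : set 'M[R]_(D, T).
Hypotheses (Gd_ge0 : forall M (t : 'I_T), Gd M -> 0 <= g (first_cols (obs t) M))
  (Gd_resample : forall M (t : 'I_T), Gd M -> exists N : set Xi,
    [/\ measurable N, nu N = 0%E & forall x, ~ N x ->
      first_cols (obs t) (S (first_cols (obs t) M) x) = first_cols (obs t) M /\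
      Gd (S (first_cols (obs t) M) x)]).
Local Notation resid := (resid nu S g U).

(** Goodness of the trajectory passes to almost all simulations, which is what
    the inductive step requires of the simulated histories. *)
Lemma calB_accurate k M (t : 'I_T) : Gd M ->
  accurate nu S g (truncated_reward U) k
    (first_cols (obs t) M) (resid k (first_cols (obs t) M)).
Proof.
elim: k M t => [|k IH] M t GM.
  move=> e delta e0 /andP[d0 _]; rewrite /wpr/= lee_fin.
  rewrite (max_idPr (Gd_ge0 t GM)) /within subrr normr0 (ltW e0)//=.
  exact: ltW.
rewrite (residS U_gt0 mS mg Gd_resample GM).
have [N [mN N0 HN]] := Gd_resample t GM.
apply: (accurate_step T_gt0 (resid_bounds nu S g U_gt0 k) _ mN N0 (IH M t GM)).
  exact: (measurable_best_simulate nu U_gt0 mS mg k).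
by move=> x /HN[_ GS] j; exact: IH.
Qed.

(** Estimates accurate up to [eps / 4], compared with the threshold [- eps / 2],
    exclude both cases. *)
Definition wrong_decision (eps : R) (t : 'I_T) (c : 'M[R]_(D, obs t)) (b : bool) : bool :=
  if b then resid (nat_ceil (4 / eps)) c < - (3 / 4 * eps)
  else - (eps / 4) <= resid (nat_ceil (4 / eps)) c.

Lemma wpr_decide (eps : R) M (t : 'I_T) : 0 < eps < 1 -> t.+1 != T -> Gd M ->
  (wpr nu S g (truncated_decide eps U (first_cols (obs t) M))
     (wrong_decision eps (first_cols (obs t) M)) <= (eps / (4 * T%:R))%:E)%E.
Proof.
move=> /andP[e0 e1] tT GM; rewrite /truncated_decide /decide (negbTE tT).
set c := first_cols _ M; set K := nat_ceil (4 / eps).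
rewrite [wpr _ _ _ _ _](_ : _ = wpr nu S g
  (bind (calB (truncated_reward U) K.+1 c (eps / 4) (eps / (4 * T%:R)))
    (fun r => let! h := do_arith D T Mul (- (1 / 2)) eps in Ret (h <= r)))
  (wrong_decision eps c)); last by [].
have e40 : 0 < eps / 4 by lra.
have TR : 1 <= T%:R :> R by rewrite ler1n.
have d01 : 0 < eps / (4 * T%:R) <= 1.
  by rewrite divr_gt0 ?mulr_gt0 ?ltr0n//= ler_pdivrMr ?mulr_gt0 ?ltr0n//; lra.
rewrite -[X in (_ <= X%:E)%E]addr0.
apply: (wpr_bind _ (calB_accurate K t GM e40 d01)) => // r.
rewrite negbK /within -/c ler_norml => /andP[r1 r2].
rewrite /wpr/= lee_fin /wrong_decision -/K.
set rs := resid K c in r1 r2 *; have [hr|hr] := leP (- (1 / 2) * eps) r.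
  by rewrite (_ : (rs < _) = false)//; apply/negbTE; rewrite -leNgt; lra.
by rewrite (_ : (_ <= rs) = false)//; apply/negbTE; rewrite -ltNge; lra.
Qed.

End accuracy.

(** * Measurable families of programs *)

Section measurable_programs.
Context {R : realType} {D T : nat} {dX : measure_display}
  {Xi : measurableType dX} (nu : probability Xi R)
  (S : forall n : 'I_T.+1, 'M[R]_(D, n) -> Xi -> 'M[R]_(D, T))
  (g : forall t : 'I_T, 'M[R]_(D, obs t) -> R).
Hypotheses (mS : forall n : 'I_T.+1,
     measurable_fun setT (fun cx : 'M[R]_(D, n) * Xi => S cx.1 cx.2))
  (mg : forall t, measurable_fun setT (@g t)).
Local Notation prog := (prog R D T).
Local Notation M_T := 'M[R]_(D, T).

(** Families of decision programs all of whose data depend measurably on a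
    parameter; every simulation adds its result to the parameter. *)
Inductive mprog : forall d (V : measurableType d), (V -> prog bool) -> Prop :=
| mprog_ret d (V : measurableType d) (b : V -> bool) :
    measurable_fun setT b -> mprog (fun v => Ret (b v))
| mprog_simulate d (V : measurableType d) (n : 'I_T.+1) (c : V -> 'M[R]_(D, n)) k :
    measurable_fun setT c -> mprog (fun vM : V * M_T => k vM.1 vM.2) ->
    mprog (fun v => SimulateK n (c v) (k v))
| mprog_reward d (V : measurableType d) (t : 'I_T) (c : V -> 'M[R]_(D, obs t)) k :
    mprog (fun v => k v (g (c v))) -> mprog (fun v => RewardK t (c v) (k v))
| mprog_arith d (V : measurableType d) op (x y : V -> R) k :
    mprog (fun v => k v (arith_val op (x v) (y v))) ->
    mprog (fun v => ArithK op (x v) (y v) (k v))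
| mprog_median d (V : measurableType d) (l : V -> seq R) k :
    mprog (fun v => k v (median (l v))) ->
    mprog (fun v => MedianK (l v) (k v)).

(** The sigma-algebra of the sample space is arbitrary, so the same induction
    shows that a decision is measurable for the information it is based on. *)
Lemma mprog_output d (V : measurableType d) (p : V -> prog bool) : mprog p ->
  forall d' (O : measurableType d') (X : O -> V) (xi : nat -> O -> Xi),
  measurable_fun setT X -> (forall i, measurable_fun setT (xi i)) ->
  measurable_fun setT (fun w => output S g (p (X w)) (fun i => xi i w)).
Proof.
elim=> {d V p}.
- by move=> d V b mb d' O X xi mX mxi; exact: measurableT_comp.
- move=> d V n c k mc mk IH d' O X xi mX mxi /=.
  have mM : measurable_fun setT (fun w => S (c (X w)) (xi 0%N w)).
    have mcX := measurableT_comp mc mX.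
    exact: (measurableT_comp (@mS n) (measurable_fun_pair mcX (mxi 0%N))).
  exact: (IH _ _ (fun w => (X w, S (c (X w)) (xi 0%N w))) (fun i => xi i.+1)
    (measurable_fun_pair mX mM) (fun i => mxi i.+1)).
- by move=> d V t c k mk IH d' O X xi mX mxi /=; exact: IH.
- by move=> d V op x y k mk IH d' O X xi mX mxi /=; exact: IH.
- by move=> d V l k mk IH d' O X xi mX mxi /=; exact: IH.
Qed.

Local Open Scope ereal_scope.

Lemma mprog_wp d (V : measurableType d) (p : V -> prog bool) : mprog p ->
  forall F : V -> bool -> \bar R, (forall v b, 0 <= F v b) ->
  (forall b, measurable_fun setT (fun v => F v b)) ->
  measurable_fun setT (fun v => wp nu S g (p v) (F v)).
Proof.
elim=> {d V p}.
- move=> d V b mb F F0 mF /=.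
  rewrite (_ : (fun v => _) = (fun v => if b v then F v true else F v false)).
    exact: measurable_fun_ifT.
  by apply/funext => v; case: (b v).
- move=> d V n c k mc mk IH F F0 mF /=.
  have mpair : measurable_fun setT (fun vx : V * Xi => (vx.1, S (c vx.1) vx.2)).
    apply: measurable_fun_pair => //.
    have mc1 := measurableT_comp mc (@measurable_fst _ _ V Xi).
    exact: (measurableT_comp (@mS n) (measurable_fun_pair mc1 measurable_snd)).
  pose h (vx : V * Xi) := wp nu S g (k vx.1 (S (c vx.1) vx.2)) (F vx.1).
  have mh : measurable_fun setT h.
    have mF1 b : measurable_fun setT (fun vM : V * M_T => F vM.1 b).
      exact: measurableT_comp (mF b) measurable_fst.
    have := IH (fun vM b => F vM.1 b) (fun vM b => F0 vM.1 b) mF1.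
    by move=> /measurableT_comp /(_ mpair).
  have h0 vx : 0 <= h vx by exact: wp_ge0.
  have mhv v : measurable_fun setT (fun x => h (v, x)).
    exact: measurableT_comp mh (measurable_fun_pair (measurable_cst v) (@measurable_id _ _ _)).
  rewrite (_ : (fun v => _) = fubini_F nu h).
    exact: measurable_fun_fubini_tonelli_F.
  by apply/funext => v; rewrite (upper_intE _ (mhv v)).
- by move=> d V t c k mk IH F F0 mF /=; exact: IH.
- by move=> d V op x y k mk IH F F0 mF /=; exact: IH.
- by move=> d V l k mk IH F F0 mF /=; exact: IH.
Qed.

Section fresh.
Context {dO : measure_display} {O : measurableType dO} (P : probability O R).

(** A parameter together with an infinite supply of seeds independent of it *)
Definition fresh {dV} {V : measurableType dV} (X : O -> V) (xi : nat -> O -> Xi) :=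
  [/\ measurable_fun setT X, forall i, measurable_fun setT (xi i) &
    forall m (B : set V) (A : nat -> set Xi), measurable B ->
      (forall i, measurable (A i)) ->
      P (X @^-1` B `&` \bigcap_(i in `I_m) xi i @^-1` A i) =
      P (X @^-1` B) * \prod_(i < m) nu (A i)].

Lemma fresh_comp {dV dW} {V : measurableType dV} {W : measurableType dW}
    (h : V -> W) (X : O -> V) xi : measurable_fun setT h -> fresh X xi ->
  fresh (fun w => h (X w)) xi.
Proof.
move=> mh [mX mxi ind]; split=> // [|m B A mB mA]; first exact: measurableT_comp.
rewrite (_ : (fun w => h (X w)) @^-1` B = X @^-1` (h @^-1` B))//.
by apply: ind => //; rewrite -[X in measurable X]setTI; exact: mh.
Qed.

Lemma fresh_head {dV} {V : measurableType dV} (X : O -> V) xi B A :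
  fresh X xi -> measurable B -> measurable A ->
  P (X @^-1` B `&` xi 0%N @^-1` A) = P (X @^-1` B) * nu A.
Proof.
move=> [mX mxi ind] mB mA.
have := ind 1%N B (fun=> A) mB (fun=> mA); rewrite big_ord1 => <-.
by congr (P (_ `&` _)); apply/seteqP; split=> [w Aw i /= | w /(_ 0%N)//=]; [|exact];
  rewrite ltnS leqn0 => /eqP ->.
Qed.

Lemma fresh_step {dV} {V : measurableType dV} (X : O -> V) xi : fresh X xi ->
  fresh (fun w => (X w, xi 0%N w)) (fun i => xi i.+1).
Proof.
move=> fX; have [mX mxi ind] := fX.
have mX0 := measurable_fun_pair mX (mxi 0%N).
split=> // m B A mB mA.
set E := \bigcap_(i in `I_m) _.
have mE : measurable E.
  apply: fin_bigcap_measurable => [|i _]; first exact: finite_II.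
  by rewrite -[X in measurable X]setTI; exact: mxi.
have q0 : (0 <= \prod_(i < m) fine (nu (A i)))%R by rewrite prodr_ge0// => i _; exact: fine_ge0.
have qE : \prod_(i < m) nu (A i) = (\prod_(i < m) fine (nu (A i)))%:E.
  rewrite -prodEFin; apply: eq_bigr => i _; rewrite fineK// ge0_fin_numE//.
  by rewrite (le_lt_trans (probability_le1 _ _))// ltry.
rewrite qE muleC.
have := @rectangles_determine _ _ _ _ _ _ _ _ _ (mrestr P mE)
  (mscale (NngNum q0) P) _ _ mX0 mX0 _ _ B mB.
rewrite /mrestr /mscale/=; apply.
  by rewrite /mrestr setTI (le_lt_trans (probability_le1 _ _))// ltry.
move=> U W mU mW; rewrite /mrestr /mscale /= -qE.
rewrite (_ : (fun w => _) @^-1` (U `*` W) = X @^-1` U `&` xi 0%N @^-1` W)//.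
rewrite fresh_head// muleC -muleA.
pose A' i := if i is j.+1 then A j else W.
have := ind m.+1 U A' mU; rewrite big_ord_recl /= => <-; last by case.
congr (P _); rewrite -setIA; congr (_ `&` _); apply/seteqP; split => w /=.
  by move=> [Ww Ew] [|i] //= im; exact: Ew.
by move=> H; split; [exact: (H 0%N)|move=> i im; exact: (H i.+1)].
Qed.

Lemma fresh_fubini {dV} {V : measurableType dV} (X : O -> V) xi (h : V * Xi -> \bar R) :
  fresh X xi -> measurable_fun setT h -> (forall vx, 0 <= h vx) ->
  \int[P]_w h (X w, xi 0%N w) = \int[P]_w \int[nu]_x h (X w, x).
Proof.
move=> fX mh h0; have [mX mxi _] := fX.
have mX0 := measurable_fun_pair mX (mxi 0%N).
have mX2 : measurable_fun setT (fun wx : O * Xi => (X wx.1, wx.2)).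
  by apply: measurable_fun_pair => //; exact: measurableT_comp mX measurable_fst.
have mh2 : measurable_fun setT (fun wx : O * Xi => h (X wx.1, wx.2)).
  exact: measurableT_comp mh mX2.
rewrite -(@fubini_tonelli1 _ _ _ _ _ P nu (fun wx : O * Xi => h (X wx.1, wx.2)))//.
apply: (@integral_transfer _ _ _ _ _ _ _ P (P \x nu) setT setT
  (fun w => (X w, xi 0%N w)) (fun wx : O * Xi => (X wx.1, wx.2))) => // E mE.
rewrite !setTI; apply: rectangles_determine => //.
  by rewrite (le_lt_trans (probability_le1 _ _))// ltry.
move=> U W mU mW.
rewrite (_ : (fun w => _) @^-1` (U `*` W) = X @^-1` U `&` xi 0%N @^-1` W)//.
rewrite [LHS](fresh_head fX mU mW); apply/esym.
apply: (product_measure1E P nu) => //.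
by rewrite -[X in measurable X]setTI; exact: mX.
Qed.

(** The first simulated trajectory joins the parameter, and the remaining seeds
    are fresh for the enlarged parameter.  On measurable functions the upper
    integrals are integrals, so the inductive step is Tonelli's theorem. *)
Lemma mprog_expectation dV (V : measurableType dV) (p : V -> prog bool) : mprog p ->
  forall (X : O -> V) xi (F : V -> bool -> \bar R), fresh X xi ->
  (forall v b, 0 <= F v b) -> (forall b, measurable_fun setT (fun v => F v b)) ->
  \int[P]_w F (X w) (output S g (p (X w)) (fun i => xi i w)) =
  \int[P]_w wp nu S g (p (X w)) (F (X w)).
Proof.
elim=> {dV V p}.
- by [].
- move=> d V n c k mc mk IH X xi F fX F0 mF /=.
  have mpair : measurable_fun setT (fun vx : V * Xi => (vx.1, S (c vx.1) vx.2)).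
    apply: measurable_fun_pair => //.
    have mc1 := measurableT_comp mc (@measurable_fst _ _ V Xi).
    exact: (measurableT_comp (@mS n) (measurable_fun_pair mc1 measurable_snd)).
  have fX' := fresh_comp mpair (fresh_step fX).
  have mF1 b : measurable_fun setT (fun vM : V * M_T => F vM.1 b).
    exact: measurableT_comp (mF b) measurable_fst.
  have := IH _ _ (fun vM b => F vM.1 b) fX' (fun vM b => F0 vM.1 b) mF1.
  move=> /= ->.
  pose h (vx : V * Xi) := wp nu S g (k vx.1 (S (c vx.1) vx.2)) (F vx.1).
  have mh : measurable_fun setT h.
    have := mprog_wp mk (fun vM b => F0 vM.1 b) mF1.
    by move=> /measurableT_comp /(_ mpair).
  have h0 vx : 0 <= h vx by exact: wp_ge0.
  rewrite (fresh_fubini fX mh h0).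
  apply: eq_integral => w _; rewrite upper_intE// => [|x]; last exact: wp_ge0.
  exact: measurableT_comp mh (measurable_fun_pair (measurable_cst (X w)) (@measurable_id _ _ _)).
- by move=> d V t c k mk IH X xi F fX F0 mF /=; exact: IH.
- by move=> d V op x y k mk IH X xi F fX F0 mF /=; exact: IH.
- by move=> d V l k mk IH X xi F fX F0 mF /=; exact: IH.
Qed.

End fresh.
End measurable_programs.

(** * Measurability of the algorithm *)

Section order_statistics.
Context {R : realType}.
Implicit Types (x : R) (s : seq R).

(** Insertion written with [min] and [max] makes the measurability of sorting, and
    of the median, immediate. *)
Fixpoint minmax_insert x s : seq R :=
  if s is y :: s' then Num.min x y :: minmax_insert (Num.max x y) s' else [:: x].

Lemma perm_minmax_insert x s : perm_eq (minmax_insert x s) (x :: s).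
Proof.
elim: s x => [|y s IH] x //=; have := IH (Num.max x y).
rewrite -(perm_cons (Num.min x y)) => /permPl ->.
by case: (leP x y) => // _; have /permPl := perm_catCA [:: y] [:: x] s.
Qed.

Lemma path_le_head x y s : x <= y -> path <=%R y s -> path <=%R x s.
Proof. by case: s => //= z s xy /andP[yz ->]; rewrite andbT (le_trans xy). Qed.

Lemma path_minmax_insert a x s : a <= x -> path <=%R a s ->
  path <=%R a (minmax_insert x s).
Proof.
elim: s a x => [|y s IH] a x ax /=; first by rewrite ax.
move=> /andP[ay ys]; rewrite le_min ax ay /=; apply: IH.
  by rewrite ge_min le_max lexx.
by apply: path_le_head ys; rewrite ge_min lexx orbT.
Qed.

Lemma sort_foldr_insert s : sort <=%R s = foldr minmax_insert [::] s.
Proof.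
apply: (sorted_eq le_trans le_anti); first exact: sort_sorted le_total _.
  elim: s => //= x s; case: (foldr _ _ s) => //= y s' ys.
  apply: path_minmax_insert; first by rewrite ge_min le_max lexx.
  by apply: path_le_head ys; rewrite ge_min lexx orbT.
rewrite perm_sort perm_sym; elim: s => //= x s IH.
by rewrite (perm_trans (perm_minmax_insert _ _))// perm_cons.
Qed.

Section measurable_sequences.
Context {d : measure_display} {V : measurableType d}.
Implicit Types l : V -> seq R.

Definition mseq (n : nat) l :=
  (forall v, size (l v) = n) /\ forall i, measurable_fun setT (fun v => nth 0 (l v) i).

Lemma mseq_nil : mseq 0 (fun=> [::]).
Proof. by split=> // i; under eq_fun do rewrite nth_nil; exact: measurable_cst. Qed.

Lemma mseq_cons n (x : V -> R) l : measurable_fun setT x -> mseq n l ->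
  mseq n.+1 (fun v => x v :: l v).
Proof. by move=> mx [sl ml]; split=> [v|[|i]] //=; rewrite sl. Qed.

Lemma mseq0 l : mseq 0 l -> l = fun=> [::].
Proof. by move=> [sl _]; apply/funext => v; exact: size0nil. Qed.

Lemma mseqS n l : mseq n.+1 l -> exists (x : V -> R) l',
  [/\ measurable_fun setT x, mseq n l' & l = fun v => x v :: l' v].
Proof.
move=> [sl ml]; exists (fun v => nth 0 (l v) 0%N), (fun v => behead (l v)); split.
- exact: ml.
- split=> [v|i]; first by rewrite size_behead sl.
  by under eq_fun do rewrite nth_behead; exact: ml.
- by apply/funext => v; case: (l v) (sl v).
Qed.

Lemma mseq_insert n (x : V -> R) l : measurable_fun setT x -> mseq n l ->
  mseq n.+1 (fun v => minmax_insert (x v) (l v)).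
Proof.
elim: n x l => [|n IH] x l mx ml.
  by rewrite (mseq0 ml); apply: mseq_cons mx mseq_nil.
have [y [l' [my ml' ->]]] := mseqS ml.
apply: (mseq_cons (n := n.+1)); first exact: measurable_minr.
by apply: IH ml'; exact: measurable_maxr.
Qed.

Lemma mseq_sort n l : mseq n l -> mseq n (fun v => sort <=%R (l v)).
Proof.
under eq_fun do rewrite sort_foldr_insert.
elim: n l => [|n IH] l ml; first by rewrite (mseq0 ml); exact: mseq_nil.
have [y [l' [my ml' ->]]] := mseqS ml.
by apply: mseq_insert my _; exact: IH.
Qed.

Lemma measurable_median n l : mseq n l -> measurable_fun setT (fun v => median (l v)).
Proof.
move=> ml; have [_ ms] := mseq_sort ml; rewrite /median.
under eq_fun do rewrite ml.1.
by apply: measurable_funM => //; exact: measurable_funD.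
Qed.

End measurable_sequences.
End order_statistics.

Section measurable_algorithm.
Context {R : realType} {D T : nat} {dX : measure_display}
  {Xi : measurableType dX} (nu : probability Xi R)
  (S : forall n : 'I_T.+1, 'M[R]_(D, n) -> Xi -> 'M[R]_(D, T))
  (g : forall t : 'I_T, 'M[R]_(D, obs t) -> R).
Hypotheses (mS : forall n : 'I_T.+1,
     measurable_fun setT (fun cx : 'M[R]_(D, n) * Xi => S cx.1 cx.2))
  (mg : forall t, measurable_fun setT (@g t)).
Local Notation prog := (prog R D T).
Local Notation mprog := (@mprog R D T g _ _).

Definition mcont {d} {V : measurableType d} (K : V -> R -> prog bool) :=
  forall d' (V' : measurableType d') (pi : V' -> V) (r : V' -> R),
  measurable_fun setT pi -> measurable_fun setT r ->
  mprog (fun v => K (pi v) (r v)).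

(** Measurability of a family of real-valued programs, tested against all
    continuations.  The continuations live over every extension [pi] of the
    parameter space, because they may depend on values computed before. *)
Definition mfam {d} {V : measurableType d} (p : V -> prog R) :=
  forall d' (V' : measurableType d') (pi : V' -> V) (K : V' -> R -> prog bool),
  measurable_fun setT pi -> mcont K -> mprog (fun v => bind (p (pi v)) (K v)).

Lemma mfam_comp {d d'} {V : measurableType d} {V' : measurableType d'}
    (p : V -> prog R) (pi : V' -> V) :
  measurable_fun setT pi -> mfam p -> mfam (fun v => p (pi v)).
Proof.
move=> mpi mp d2 V2 pi2 K mpi2 mK.
exact: mp (fun v => pi (pi2 v)) K (measurableT_comp mpi mpi2) mK.
Qed.

Lemma mfam_ret {d} {V : measurableType d} (r : V -> R) :
  measurable_fun setT r -> mfam (fun v => Ret (r v)).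
Proof.
move=> mr d' V' pi K mpi mK; apply: (mK _ _ id) => //.
exact: measurableT_comp mr mpi.
Qed.

Lemma mfam_arith {d} {V : measurableType d} op (x y : V -> R) (k : V -> R -> prog R) :
  mfam (fun v => k v (arith_val op (x v) (y v))) ->
  mfam (fun v => ArithK op (x v) (y v) (k v)).
Proof. by move=> mk d' V' pi K mpi mK; apply: mprog_arith; exact: mk. Qed.

Lemma mfam_median {d} {V : measurableType d} (l : V -> seq R) (k : V -> R -> prog R) :
  mfam (fun v => k v (median (l v))) -> mfam (fun v => MedianK (l v) (k v)).
Proof. by move=> mk d' V' pi K mpi mK; apply: mprog_median; exact: mk. Qed.

Lemma mfam_reward {d} {V : measurableType d} (t : 'I_T) (c : V -> 'M[R]_(D, obs t))
    (k : V -> R -> prog R) :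
  mfam (fun v => k v (g (c v))) -> mfam (fun v => RewardK t (c v) (k v)).
Proof. by move=> mk d' V' pi K mpi mK; apply: mprog_reward; exact: mk. Qed.

Lemma mfam_simulate {d} {V : measurableType d} (n : 'I_T.+1) (c : V -> 'M[R]_(D, n))
    (k : V -> 'M[R]_(D, T) -> prog R) :
  measurable_fun setT c -> mfam (fun vM : V * 'M[R]_(D, T) => k vM.1 vM.2) ->
  mfam (fun v => SimulateK n (c v) (k v)).
Proof.
move=> mc mk d' V' pi K mpi mK; apply: mprog_simulate.
  exact: measurableT_comp mc mpi.
apply: (mk _ _ (fun vM : V' * 'M[R]_(D, T) => (pi vM.1, vM.2)) (fun vM => K vM.1)).
  by apply: measurable_fun_pair => //; exact: measurableT_comp mpi measurable_fst.
move=> d2 V2 pi2 r mpi2 mr.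
by apply: (mK _ _ (fun v => (pi2 v).1)) => //; exact: measurableT_comp measurable_fst mpi2.
Qed.

Lemma mfam_bind {d} {V : measurableType d} (p : V -> prog R) (q : V -> R -> prog R) :
  mfam p -> (forall d' (V' : measurableType d') (pi : V' -> V) (r : V' -> R),
    measurable_fun setT pi -> measurable_fun setT r -> mfam (fun v => q (pi v) (r v))) ->
  mfam (fun v => bind (p v) (q v)).
Proof.
move=> mp mq d' V' pi K mpi mK; under eq_fun do rewrite bindA.
apply: (mp _ _ pi (fun v a => bind (q (pi v) a) (K v))) => // d2 V2 pi2 r mpi2 mr.
have := mq _ _ (fun v => pi (pi2 v)) r (measurableT_comp mpi mpi2) mr _ _ id (fun v => K (pi2 v)).
apply; first exact: measurable_id.
move=> d3 V3 pi3 r3 mpi3 mr3.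
exact: (mK _ _ (fun v => pi2 (pi3 v)) r3 (measurableT_comp mpi2 mpi3) mr3).
Qed.

Lemma mfam_map {I : Type} {d} {V : measurableType d} (f : V -> I -> prog R) (s : seq I)
    (q : V -> seq R -> prog R) :
  (forall i, mfam (fun v => f v i)) ->
  (forall d' (V' : measurableType d') (pi : V' -> V) (l : V' -> seq R),
    measurable_fun setT pi -> mseq (size s) l -> mfam (fun v => q (pi v) (l v))) ->
  mfam (fun v => bind (map_prog (f v) s) (q v)).
Proof.
elim: s d V f q => [|i s IH] d V f q mf mq.
  by apply: (mq _ _ id); [exact: measurable_id|exact: mseq_nil].
rewrite (_ : (fun v => _) = (fun v => bind (f v i)
    (fun a => bind (map_prog (f v) s) (fun l => q v (a :: l))))); last first.
  by apply/funext => v /=; rewrite bindA; congr (bind _ _); apply/funext => a; rewrite bindA.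
apply: mfam_bind => // d' V' pi r mpi mr.
apply: (IH _ _ (fun v => f (pi v)) (fun v l => q (pi v) (r v :: l))).
  by move=> j; exact: (mfam_comp mpi (mf j)).
move=> d2 V2 pi2 l mpi2 ml; apply: (mq _ _ (fun v => pi (pi2 v)) (fun v => r (pi2 v) :: l v)).
  exact: measurableT_comp mpi mpi2.
by apply: mseq_cons => //; exact: measurableT_comp mr mpi2.
Qed.

Lemma mfam_fold {d} {V : measurableType d} op n (x : V -> R) (l : V -> seq R) :
  (forall d' (V' : measurableType d') (x y : V' -> R), measurable_fun setT x ->
    measurable_fun setT y -> measurable_fun setT (fun v => arith_val op (x v) (y v))) ->
  measurable_fun setT x -> mseq n l -> mfam (fun v => fold_arith D T op (x v) (l v)).
Proof.
move=> mop; elim: n x l => [|n IH] x l mx ml.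
  by rewrite (mseq0 ml); exact: mfam_ret.
have [y [l' [my ml' ->]]] := mseqS ml.
by apply: mfam_arith; apply: IH ml'; exact: mop.
Qed.

Lemma mfam_fold1 {d} {V : measurableType d} op n (l : V -> seq R) :
  (forall d' (V' : measurableType d') (x y : V' -> R), measurable_fun setT x ->
    measurable_fun setT y -> measurable_fun setT (fun v => arith_val op (x v) (y v))) ->
  mseq n l -> mfam (fun v => fold1_arith D T op (l v)).
Proof.
move=> mop; case: n => [|n] ml.
  by rewrite (mseq0 ml); apply: mfam_ret; exact: measurable_cst.
have [y [l' [my ml' ->]]] := mseqS ml; exact: (mfam_fold mop my ml').
Qed.

Lemma mfam_calB (ev : forall t : 'I_T, 'M[R]_(D, obs t) -> prog R) :
  (forall d (V : measurableType d) (t : 'I_T) (c : V -> 'M[R]_(D, obs t)),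
    measurable_fun setT c -> mfam (fun v => ev t (c v))) ->
  forall k d (V : measurableType d) (t : 'I_T) (c : V -> 'M[R]_(D, obs t)) (e delta : R),
  measurable_fun setT c -> mfam (fun v => calB ev k (c v) e delta).
Proof.
move=> mev; elim=> [|k IH] d V t c e delta mc.
  by apply: mfam_ret; exact: measurable_cst.
case: k IH => [|k] IH; first exact: mev.
(* the operations that compute the sizes and the accuracies of the samples *)
do 12 apply: mfam_arith.
apply: mfam_map => [_|d1 V1 pi1 l1 mpi1 ml1]; last first.
  by apply: mfam_median; apply: mfam_ret; exact: measurable_median ml1.
apply: mfam_bind => [|d1 V1 pi1 A3 mpi1 mA3]; first exact: IH.
apply: mfam_map => [_|d2 V2 pi2 l2 mpi2 ml2].
  apply: mfam_simulate; first exact: measurableT_comp mc mpi1.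
  apply: mfam_map => [j|d3 V3 pi3 l3 mpi3 ml3].
    apply: IH; exact: measurableT_comp (measurable_first_cols (obs j)) measurable_snd.
  by apply: mfam_fold1 ml3 => d' V' x y mx my; exact: measurable_maxr.
apply: mfam_bind => [|d3 V3 pi3 r mpi3 mr].
  by apply: mfam_fold1 ml2 => d' V' x y mx my; exact: measurable_funD.
apply: mfam_arith; apply: mfam_arith; apply: mfam_ret => /=.
apply: measurable_funB; last exact: measurable_funM.
by apply: measurableT_comp mA3 _; exact: measurableT_comp mpi2 mpi3.
Qed.

Lemma mprog_decide (eps U : R) (t : 'I_T) :
  mprog (fun c : 'M[R]_(D, obs t) => truncated_decide eps U c).
Proof.
rewrite /truncated_decide /decide; case: eqP => _.
  by apply: mprog_ret; exact: measurable_cst.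
do 4 apply: mprog_arith.
have mev d (V : measurableType d) (t' : 'I_T) (c : V -> 'M[R]_(D, obs t')) :
    measurable_fun setT c -> mfam (fun v => truncated_reward U (c v)).
  move=> mc; apply: mfam_reward; do 2 apply: mfam_arith; apply: mfam_ret => /=.
  apply: measurable_funM => //; apply: measurable_minr => //.
  exact: measurableT_comp (@mg t') mc.
pose K (c : 'M[R]_(D, obs t)) (b : R) : prog bool :=
  let! h := do_arith D T Mul (- (1 / 2)) eps in Ret (h <= b).
have mid : measurable_fun setT (@idfun 'M[R]_(D, obs t)) by exact: measurable_id.
have := @mfam_calB _ mev (nat_ceil (4 / eps)).+1 _ _ t idfun (eps / 4)
  (eps / (4 * T%:R)) mid _ _ idfun K mid; apply.
move=> d V pi r mpi mr; apply: mprog_arith; apply: mprog_ret.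
exact: measurable_fun_ler.
Qed.

End measurable_algorithm.

(** * Independent seeds and optional stopping *)

(** Only a sub-sigma-algebra is determined here, so uniqueness of measures is
    applied to the images on that coarser space. *)
Lemma pi_agree {R : realType} {d} {O : measurableType d} (G : set_system O)
    (m1 m2 : {measure set O -> \bar R}) :
  G `<=` measurable -> setI_closed G -> G setT -> (m1 setT < +oo)%E ->
  (forall A, G A -> m1 A = m2 A) -> forall E, <<s G >> E -> m1 E = m2 E.
Proof.
move=> Gm GI GT fin m12 E GE.
have mid : measurable_fun setT (@idfun O : O -> g_sigma_algebraType G).
  move=> _ B mB; rewrite setTI; suff : <<s G >> `<=` @measurable _ O by apply.
  by apply: smallest_sub => //; exact: sigma_algebra_measurable.
apply: (@measure_unique _ _ (g_sigma_algebraType G) G (fun=> setT) erefl GI (fun=> GT) _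
  (law m1 mid) (law m2 mid)) => //.
by rewrite bigcup_const.
Qed.

Lemma mpreim {dV dW} {V : measurableType dV} {W : measurableType dW} (f : V -> W) A :
  measurable_fun setT f -> measurable A -> measurable (f @^-1` A).
Proof. by move=> mf mA; rewrite -[X in measurable X]setTI; exact: mf. Qed.

Section random_dates.
Context {R : realType} {d : measure_display} {O : measurableType d}
  (P : {measure set O -> \bar R}) {T : nat} (sigma : O -> 'I_T).
Hypothesis ms : forall t, measurable [set w | sigma w = t].

Let partition : \big[setU/set0]_(t <- enum 'I_T) [set w | sigma w = t] = setT.
Proof.
apply/seteqP; split=> // w _; rewrite -bigcup_seq /=.
by exists (sigma w) => //=; rewrite mem_enum.
Qed.

Lemma measurable_at {d'} {V : measurableType d'} (h : 'I_T -> O -> V) :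
  (forall t, measurable_fun setT (h t)) -> measurable_fun setT (fun w => h (sigma w) w).
Proof.
move=> mh _ B mB; rewrite setTI.
rewrite (_ : _ @^-1` B = \bigcup_(t in [set: 'I_T]) ([set w | sigma w = t] `&` h t @^-1` B)).
  apply: fin_bigcup_measurable => // t _; apply: measurableI => //; exact: mpreim.
by apply/seteqP; split=> [w Bw|w [t _ [/= <-]]]; first exists (sigma w).
Qed.

Lemma integral_at (h : O -> \bar R) : measurable_fun setT h -> (forall w, 0 <= h w)%E ->
  (\int[P]_w h w = \sum_(t < T) \int[P]_(w in [set w | sigma w = t]) h w)%E.
Proof.
move=> mh h0; rewrite -partition ge0_integral_bigsetU ?enum_uniq//.
- by rewrite big_enum.
- by move=> s t _ _ [w [/= <- <-]].
- exact: measurable_funTS.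
Qed.

End random_dates.

Section seeds.
Context {R : realType} {D T : nat} {d dX : measure_display}
  {Omega : measurableType d} (P : probability Omega R)
  (Y : Omega -> 'M[R]_(D, T)) {Xi : measurableType dX} (nu : probability Xi R)
  (S : forall n : 'I_T.+1, 'M[R]_(D, n) -> Xi -> 'M[R]_(D, T))
  (xi : 'I_T -> nat -> Omega -> Xi).
Hypotheses (mY : measurable_fun setT Y) (S_sampler : conditional_sampler P Y nu S)
  (xi_fresh : fresh_seeds P Y nu xi).
Local Notation past := (past Y).

Let mxi : forall t i, measurable_fun setT (xi t i). Proof. by case: xi_fresh. Qed.

Lemma fresh_past (t : 'I_T) : fresh nu P (past (obs t)) (xi t).
Proof.
split=> [|i|m B A mB mA]; [exact: measurable_past|exact: mxi|].
have [_ ind] := xi_fresh.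
pose J := [fset (t, nat_of_ord i) | i in 'I_m]%fset.
have := ind J ((@first_cols R D T (obs t)) @^-1` B) (fun j => A j.2)
  (mpreim (measurable_first_cols (obs t)) mB) (fun j => mA j.2).
rewrite (_ : \bigcap_(j in [set` J]) _ = \bigcap_(i in `I_m) xi t i @^-1` A i); last first.
  apply/seteqP; split=> w H.
    move=> i im; apply: (H (t, i)) => /=.
    by apply/imfsetP; exists (Ordinal im).
  by move=> j /= /imfsetP[i _ ->] /=; apply: H => /=.
rewrite [X in _ = X -> _](_ : _ = P (past (obs t) @^-1` B) * \prod_(i < m) nu (A i))%E//.
congr (_ * _)%E.
rewrite big_imfset /=; last by move=> i j _ _ [] /val_inj.
by rewrite big_enum.
Qed.

Definition seed_events (t : 'I_T) : set_system Omega :=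
  [set E | exists (s : 'I_T) i (B : set Xi),
    [/\ (s <= t)%N, measurable B & E = xi s i @^-1` B]].

(** The auxiliary randomness of the randomized stopping time *)
Definition seed_algebra (t : 'I_T) : set_system Omega := <<s seed_events t >>.

Lemma seed_algebra_measurable t : seed_algebra t `<=` measurable.
Proof.
apply: smallest_sub; first exact: sigma_algebra_measurable.
by move=> _ [s [i [B [_ mB ->]]]]; exact: mpreim.
Qed.

Lemma seed_algebra_mono (s t : 'I_T) : (s <= t)%N -> seed_algebra s `<=` seed_algebra t.
Proof.
move=> st; apply: sub_smallest2r; first exact: smallest_sigma_algebra.
move=> _ [r [i [B [rs mB ->]]]]; exists r, i, B; split=> //; exact: leq_trans rs st.
Qed.

Let cylinder (E : set Omega) := exists (J : {fset 'I_T * nat}) (A : 'I_T * nat -> set Xi),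
  (forall j, measurable (A j)) /\ E = \bigcap_(j in [set` J]) xi j.1 j.2 @^-1` A j.

Let mcylinder E : cylinder E -> measurable E.
Proof.
move=> [J [A [mA ->]]]; apply: fin_bigcap_measurable; first exact: finite_fset.
by move=> j _; exact: mpreim.
Qed.

Let cylinderT : cylinder setT.
Proof.
exists fset0, (fun=> setT); split=> //.
by apply/seteqP; split=> w //= _ j; rewrite /= inE.
Qed.

Let cylinderI : setI_closed cylinder.
Proof.
move=> _ _ [J [A [mA ->]]] [J' [A' [mA' ->]]].
pose A1 j := if j \in J then A j else setT; pose A2 j := if j \in J' then A' j else setT.
exists (J `|` J')%fset, (fun j => A1 j `&` A2 j); split.
  by move=> j; apply: measurableI; rewrite /A1 /A2; case: ifP.
apply/seteqP; split=> w /=.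
  move=> [H H'] j _; rewrite /A1 /A2; split; case: ifP => // jJ; [exact: H|exact: H'].
move=> H; split=> j /= jJ.
  have := H j; rewrite /= in_fsetU jJ /= => /(_ isT) [].
  by rewrite /A1 jJ.
have := H j; rewrite /= in_fsetU jJ orbT /= => /(_ isT) [_].
by rewrite /A2 jJ.
Qed.

(** Independence is given on finite intersections of seed events, a pi-system
    that generates the seeds. *)
Lemma seed_algebra_indep t E B : seed_algebra t E -> measurable B ->
  P (E `&` Y @^-1` B) = (P E * P (Y @^-1` B))%E.
Proof.
move=> HE mB.
have mYB : measurable (Y @^-1` B) by exact: mpreim.
have [_ ind] := xi_fresh.
have q0 : 0 <= fine (P (Y @^-1` B)) by exact: fine_ge0.
have qE : P (Y @^-1` B) = (fine (P (Y @^-1` B)))%:E.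
  by rewrite fineK// ge0_fin_numE// (le_lt_trans (probability_le1 _ _))// ltry.
rewrite muleC qE.
have : <<s cylinder >> E.
  apply: HE; split; first exact: smallest_sigma_algebra.
  move=> _ [s [i [A [_ mA ->]]]]; apply: sub_sigma_algebra.
  exists [fset (s, i)]%fset, (fun=> A); split=> //.
  apply/seteqP; split=> w /=; first by move=> wA j /=; rewrite inE => /eqP ->.
  by move=> /(_ (s, i)); apply; rewrite /= inE.
apply: (@pi_agree _ _ _ cylinder (mrestr P mYB) (mscale (NngNum q0) P)) => //.
  by rewrite /mrestr (le_lt_trans (probability_le1 _ _)) ?ltry//; exact: measurableI.
move=> _ [J [A [mA ->]]].
have indT := ind J setT A measurableT mA.
rewrite preimage_setT setTI [X in (X * _)%E](@probability_setT _ _ _ P) mul1e in indT.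
have := ind J B A mB mA; rewrite -indT setIC [X in _ = (X * _)%E -> _]qE; exact.
Qed.

Definition decision_algebra t : set_system Omega :=
  <<s natural_filtration Y t `|` seed_algebra t >>.

Lemma natural_filtrationP t E : natural_filtration Y t E ->
  exists2 A, measurable A & E = past (obs t) @^-1` A.
Proof. by move=> [A mA <-]; exists A => //; rewrite setTI. Qed.

Lemma decision_algebra_measurable t : decision_algebra t `<=` measurable.
Proof.
apply: smallest_sub; first exact: sigma_algebra_measurable.
move=> E [/natural_filtrationP [A mA ->]|]; last exact: seed_algebra_measurable.
by apply: mpreim => //; exact: measurable_past.
Qed.

Let simulated (t : 'I_T) (wx : Omega * Xi) := S (past (obs t) wx.1) wx.2.

Let measurable_simulated t : measurable_fun setT (@simulated t).
Proof.
apply: (measurable_simulate S_sampler) => //.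
have mp : measurable_fun setT (past (obs t)) by exact: measurable_past.
exact: measurableT_comp mp measurable_fst.
Qed.

Let rect (t : 'I_T) (E : set Omega) :=
  exists (A : set 'M[R]_(D, obs t)) (C : set Omega), [/\ measurable A, seed_algebra t C &
  E = past (obs t) @^-1` A `&` C].

Let decision_algebra_rect t : decision_algebra t `<=` <<s rect t >>.
Proof.
apply: smallest_sub; first exact: smallest_sigma_algebra.
move=> E [/natural_filtrationP [A mA ->]|HE]; apply: sub_sigma_algebra.
  exists A, setT; split=> //; last by rewrite setIT.
  exact: (@measurableT _ (g_sigma_algebraType (seed_events t))).
by exists setT, E; split=> //; rewrite preimage_setT setTI.
Qed.

Let rectT t : rect t setT.
Proof.
exists setT, setT; split=> //; last by rewrite preimage_setT setTI.
exact: (@measurableT _ (g_sigma_algebraType (seed_events t))).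
Qed.

Let rectI t : setI_closed (rect t).
Proof.
move=> _ _ [A [C [mA HC ->]]] [A' [C' [mA' HC' ->]]].
exists (A `&` A'), (C `&` C'); split.
- exact: measurableI.
- exact: (@measurableI _ (g_sigma_algebraType (seed_events t))).
- by rewrite preimage_setI setIACA.
Qed.

Let mrect t : rect t `<=` measurable.
Proof.
move=> _ [A [C [mA HC ->]]]; apply: measurableI.
  by apply: mpreim => //; exact: measurable_past.
exact: seed_algebra_measurable HC.
Qed.

(** Given what is known at date [t], the trajectory is distributed as a fresh
    simulation: the events determined by the past obey this by the definition of
    a sampler, and an independent seed event only contributes a factor. *)
Lemma decision_law t E B : decision_algebra t E -> measurable B ->
  P (E `&` Y @^-1` B) = (P \x nu)%E ((E `*` setT) `&` @simulated t @^-1` B).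
Proof.
move=> HE mB.
have mYB : measurable (Y @^-1` B) by exact: mpreim.
have mSB : measurable (@simulated t @^-1` B).
  by rewrite -[X in measurable X]setTI; exact: measurable_simulated.
have mfst : measurable_fun setT (@fst Omega Xi) by exact: measurable_fst.
have := decision_algebra_rect HE.
have -> : E `*` setT = (@fst Omega Xi) @^-1` E.
  by apply/seteqP; split=> [[w x] [] //|[w x]].
apply: (@pi_agree _ _ _ (rect t) (mrestr P mYB) (law (mrestr (P \x nu)%E mSB) mfst)) => //.
  by rewrite /mrestr (le_lt_trans (probability_le1 _ _)) ?ltry//; exact: measurableI.
move=> _ [A [C [mA HC ->]]].
have mC := seed_algebra_measurable HC.
rewrite /law /= /pushforward /mrestr /=.
pose A'' := [set M : 'M[R]_(D, T) | A (first_cols (obs t) M)].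
have mA'' : measurable A'' by exact: mpreim (measurable_first_cols (obs t)) mA.
pose F := [set Mx : 'M[R]_(D, T) * Xi | A'' Mx.1 /\ B (S (first_cols (obs t) Mx.1) Mx.2)].
have mF : measurable F.
  apply: measurableI; first exact: mpreim measurable_fst mA''.
  apply: (mpreim _ mB); apply: (measurable_simulate S_sampler) => //.
  exact: measurableT_comp (measurable_first_cols (obs t)) measurable_fst.
have mnu := measurable_fun_xsection nu mF.
have pC0 : 0 <= fine (P C) by exact: fine_ge0.
have pCE : P C = (fine (P C))%:E.
  by rewrite fineK// ge0_fin_numE// (le_lt_trans (probability_le1 _ _))// ltry.
transitivity (P C * \int[P]_w nu (xsection F (Y w)))%E.
  rewrite (_ : _ `&` _ = C `&` Y @^-1` (A'' `&` B)); last first.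
    by apply/seteqP; split=> w /=; [case=> [[]]|case=> ? []].
  rewrite (seed_algebra_indep HC (measurableI _ _ mA'' mB)); congr (_ * _)%E.
  rewrite preimage_setI; rewrite [LHS]((S_sampler (obs t)).2 A B mA mB) integral_mkcond.
  apply: eq_integral => w _; rewrite patchE.
  case: ifPn => [/set_mem wA|/negP wA].
    congr (_ _); apply/seteqP; split=> x; rewrite /xsection /=.
      by move=> ?; exact: mem_set.
    by move=> /set_mem[].
  rewrite (_ : xsection _ _ = set0) ?measure0//.
  by apply/seteqP; split=> x; rewrite /xsection //= => /set_mem [/= wA' _];
    apply: wA; exact: mem_set.
have -> : (P C * \int[P]_w nu (xsection F (Y w)) =
    \int[mscale (NngNum pC0) P]_w nu (xsection F (Y w)))%E.
  rewrite ge0_integral_mscale//= -?pCE//.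
  exact: measurableT_comp mnu mY.
transitivity (\int[P]_(w in C) nu (xsection F (Y w)))%E.
  apply/esym; apply: (integral_transfer (m1 := P) (m2 := mscale (NngNum pC0) P) mC
    measurableT mY mY (f := nu \o xsection F)) => // Z mZ.
  by rewrite setTI; apply: etrans (seed_algebra_indep HC mZ) _; rewrite [in LHS]pCE.
rewrite integral_mkcond; apply: eq_integral => w _; rewrite patchE.
case: ifPn => [/set_mem wC|/negP wC].
  congr (_ _); apply/seteqP; split=> x; rewrite /xsection /=.
    by move=> /set_mem [/= wA wB]; exact: mem_set.
  by move=> /set_mem [/= [wA _] wB]; exact: mem_set.
rewrite [RHS]/= (_ : xsection _ _ = set0) ?measure0//.
by apply/seteqP; split=> x; rewrite /xsection //= => /set_mem [/= [_ wC'] _];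
  apply: wC; exact: mem_set.
Qed.

Lemma continuation_law (t : 'I_T) (B : set 'M[R]_(D, T)) : measurable B ->
  measurable_fun setT (fun c : 'M[R]_(D, obs t) => nu (S c @^-1` B)).
Proof.
move=> mB; pose F := [set cx : 'M[R]_(D, obs t) * Xi | B (S cx.1 cx.2)].
have mF : measurable F.
  by apply: (mpreim _ mB); apply: (measurable_simulate S_sampler).
have := measurable_fun_xsection nu mF; congr measurable_fun.
by apply/funext => c /=; congr (_ _); apply/seteqP; split=> x; rewrite /xsection /=;
  [move=> /set_mem|move=> ?; exact: mem_set].
Qed.

(** Since the seeds are independent of the whole trajectory, the conditional
    probability of a seed event is constant. *)
Lemma seeds_cond_indep t : cond_indep P (past (obs t)) (seed_algebra t)
  (preimage_set_system setT (fun w => last_cols (obs t) (Y w)) measurable).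
Proof.
move=> E1 _ HE [B2 mB2 <-]; rewrite setTI.
pose B := (@last_cols R D T (obs t)) @^-1` B2.
have mB : measurable B by exact: mpreim (measurable_last_cols (obs t)) mB2.
pose p1 := fine (P E1); pose q (c : 'M[R]_(D, obs t)) := fine (nu (S c @^-1` B)).
have mp : measurable_fun setT (past (obs t)) by exact: measurable_past.
have mE1 := seed_algebra_measurable HE.
have p1E : P E1 = p1%:E.
  by rewrite fineK// ge0_fin_numE// (le_lt_trans (probability_le1 _ _))// ltry.
have mq : measurable_fun setT q.
  by apply: measurableT_comp; [exact: fine_measurable|exact: continuation_law].
have mSc (c : 'M[R]_(D, obs t)) : measurable (S c @^-1` B).
  by apply: (mpreim _ mB); apply: (measurable_simulate S_sampler).
have qE c : nu (S c @^-1` B) = (q c)%:E.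
  by rewrite fineK// ge0_fin_numE// (le_lt_trans (probability_le1 _ _))// ltry.
have pastB A : measurable A -> P (past (obs t) @^-1` A `&` Y @^-1` B) =
    (\int[P]_(w in past (obs t) @^-1` A) (q (past (obs t) w))%:E)%E.
  move=> mA; rewrite [LHS]((S_sampler (obs t)).2 A B mA mB).
  by apply: eq_integral => w _; exact: qE.
exists (fun=> p1), q; split; split=> //.
- move=> A mA; pose A'' := (@first_cols R D T (obs t)) @^-1` A.
  have mA'' : measurable A'' by exact: mpreim (measurable_first_cols (obs t)) mA.
  rewrite [LHS](seed_algebra_indep HE mA'') integral_cst; last exact: mpreim.
  by rewrite p1E.
- by move=> A mA; rewrite setIC; exact: pastB.
- exact: measurable_funM.
move=> A mA; pose A'' := (@first_cols R D T (obs t)) @^-1` A.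
have mA'' : measurable A'' by exact: mpreim (measurable_first_cols (obs t)) mA.
rewrite -setIA [_ `&` (past (obs t) @^-1` A)]setIC.
rewrite [LHS](seed_algebra_indep HE (measurableI _ _ mA'' mB)) preimage_setI.
rewrite [P (_ `&` _)](pastB A mA) p1E -ge0_integralZl_EFin//.
- exact: mpreim.
- by move=> w _; rewrite lee_fin fine_ge0.
- by apply/measurable_EFinP; apply: measurable_funTS; exact: measurableT_comp mq mp.
- exact: fine_ge0.
Qed.

(** The martingale property of [E (f (Y) | F_t)], with respect to the information
    of a randomized decision. *)
Lemma integral_continuation t E (f : 'M[R]_(D, T) -> \bar R) :
    decision_algebra t E -> measurable_fun setT f -> (forall M, 0 <= f M)%E ->
  (\int[P]_(w in E) f (Y w) =
   \int[P]_(w in E) \int[nu]_x f (S (past (obs t) w) x))%E.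
Proof.
move=> HE mf f0; have mE := decision_algebra_measurable HE.
have mfs : measurable_fun setT (fun wx => f (@simulated t wx)).
  exact: measurableT_comp mf (@measurable_simulated t).
rewrite (@integral_transfer _ _ _ _ _ _ _ P (P \x nu)%E E (E `*` setT) Y
  (@simulated t) mE (measurableX mE measurableT) mY (@measurable_simulated t) f)//; last first.
  by move=> B mB; exact: decision_law.
rewrite integral_mkcond [RHS]integral_mkcond.
rewrite fubini_tonelli1/=.
- apply: eq_integral => w _; rewrite /fubini_F patchE; case: ifPn => wE.
    by apply: eq_integral => x _; rewrite patchE ifT// inE; split=> //; exact: set_mem.
  apply: integral0_eq => x _; rewrite patchE ifF//.
  by apply/negbTE; apply: contra wE; rewrite !inE => -[].
- have mET : measurable (E `*` [set: Xi]) by exact: measurableX.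
  by apply: (measurable_restrictT _ mET).1; exact: measurable_funTS.
- by move=> wx; rewrite patchE; case: ifP.
Qed.

Lemma measurable_section_integral (t : 'I_T) (f : 'M[R]_(D, T) -> \bar R) :
  measurable_fun setT f -> (forall M, 0 <= f M)%E ->
  measurable_fun setT (fun w => \int[nu]_x f (S (past (obs t) w) x))%E.
Proof.
move=> mf f0; have mfs : measurable_fun setT (fun wx => f (@simulated t wx)).
  exact: measurableT_comp mf (@measurable_simulated t).
rewrite (_ : (fun w => _) = fubini_F nu (fun wx => f (@simulated t wx)))//.
exact: measurable_fun_fubini_tonelli_F.
Qed.

(** The events [sigma = t] partition the sample space, and [integral_continuation]
    applies to each of them. *)
Lemma optional_continuation (sigma : Omega -> 'I_T) (f : 'M[R]_(D, T) -> \bar R) :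
    (forall t, decision_algebra t [set w | sigma w = t]) ->
    measurable_fun setT f -> (forall M, 0 <= f M)%E ->
  (\int[P]_w f (Y w) = \int[P]_w \int[nu]_x f (S (past (obs (sigma w)) w) x))%E.
Proof.
move=> Hs mf f0; have ms t := decision_algebra_measurable (Hs t).
rewrite (integral_at P ms) ?[RHS](integral_at P ms)//.
- apply: eq_bigr => t _; apply: etrans (integral_continuation (Hs t) mf f0) _.
  by apply: eq_integral => w /set_mem /= ->.
- apply: (@measurable_at _ _ _ _ ms _ _
    (fun t w => \int[nu]_x f (S (past (obs t) w) x))%E) => t.
  exact: measurable_section_integral.
- by move=> w; exact: integral_ge0.
- exact: measurableT_comp.
Qed.

End seeds.

(** * The randomized stopping time *)

Lemma first_stop_exists T (stop : 'I_T -> bool) (t0 : 'I_T) :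
  stop t0 -> exists t, first_stop stop t.
Proof.
move=> st0; case: (@arg_minnP _ t0 stop (fun t => nat_of_ord t) st0) => t st tmin.
by exists t; split=> // s; apply: contraTN => /tmin; rewrite -leqNgt.
Qed.

Lemma first_stop_unique T (stop : 'I_T -> bool) (s t : 'I_T) :
  first_stop stop s -> first_stop stop t -> s = t.
Proof.
move=> [ss fs] [st ft]; apply: val_inj; case: (ltngtP s t) => // [/ft|/fs].
  by rewrite ss.
by rewrite st.
Qed.

Section stopping_decisions.
Context {R : realType} {D T : nat} {d dX : measure_display}
  {Omega : measurableType d} (P : probability Omega R)
  (Y : Omega -> 'M[R]_(D, T)) {Xi : measurableType dX} (nu : probability Xi R)
  (S : forall n : 'I_T.+1, 'M[R]_(D, n) -> Xi -> 'M[R]_(D, T))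
  (xi : 'I_T -> nat -> Omega -> Xi)
  (g : forall t : 'I_T, 'M[R]_(D, obs t) -> R).
Hypotheses (mS : forall n : 'I_T.+1,
     measurable_fun setT (fun cx : 'M[R]_(D, n) * Xi => S cx.1 cx.2))
  (mg : forall t, measurable_fun setT (@g t)).

Lemma natural_filtration_mono (s t : 'I_T) : (s <= t)%N ->
  natural_filtration Y s `<=` natural_filtration Y t.
Proof.
move=> st E [A mA <-].
have le : (obs s <= obs t)%N by rewrite /= /bump /= !add1n ltnS.
pose r (c : 'M[R]_(D, obs t)) : 'M[R]_(D, obs s) := \matrix_(i, j) c i (widen_ord le j).
have mr : measurable_fun setT r.
  apply: measurable_matrix => i j; under eq_fun do rewrite mxE.
  exact: measurable_entry.
exists (r @^-1` A); first exact: mpreim.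
rewrite !setTI; apply/seteqP; split=> w /=; congr A;
  apply/matrixP => i j; rewrite !mxE; congr (Y w i _); exact: val_inj.
Qed.

Lemma decision_algebra_mono (s t : 'I_T) : (s <= t)%N ->
  decision_algebra Y xi s `<=` decision_algebra Y xi t.
Proof.
move=> st; apply: sub_smallest2r; first exact: smallest_sigma_algebra.
move=> E [HE|HE]; [left; exact: natural_filtration_mono HE|right].
exact: seed_algebra_mono HE.
Qed.

(** A run is a measurable function of the history and of the seeds, here for the
    sigma-algebra that these two generate. *)
Lemma decision_algebra_stop (p : forall t : 'I_T, 'M[R]_(D, obs t) -> prog R D T bool) t b :
  mprog g (@p t) -> decision_algebra Y xi t
    [set w | output S g (p t (past Y (obs t) w)) (fun i => xi t i w) = b].
Proof.
move=> mp; pose O := g_sigma_algebraType (natural_filtration Y t `|` seed_algebra xi t).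
have mpast : measurable_fun setT (past Y (obs t) : O -> 'M[R]_(D, obs t)).
  move=> _ B mB; rewrite setTI; apply: sub_sigma_algebra; left.
  by exists B => //; rewrite setTI.
have mxi i : measurable_fun setT (xi t i : O -> Xi).
  move=> _ B mB; rewrite setTI; apply: sub_sigma_algebra; right; apply: sub_sigma_algebra.
  by exists t, i, B.
have mo := mprog_output mS mp mpast mxi.
by have := mo measurableT [set b] I; rewrite setTI.
Qed.

Lemma decision_algebra_first_stop
    (p : forall t : 'I_T, 'M[R]_(D, obs t) -> prog R D T bool) (tau : Omega -> 'I_T) t :
  (forall t, mprog g (@p t)) ->
  (forall w, first_stop (fun t =>
     output S g (p t (past Y (obs t) w)) (fun i => xi t i w)) (tau w)) ->
  decision_algebra Y xi t [set w | tau w = t].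
Proof.
move=> mp ftau; pose dec t w := output S g (p t (past Y (obs t) w)) (fun i => xi t i w).
pose O := g_sigma_algebraType (natural_filtration Y t `|` seed_algebra xi t).
have -> : [set w | tau w = t] = [set w | dec t w = true] `&`
    \bigcap_(s in [set s : 'I_T | (s < t)%N]) [set w | dec s w = false].
  apply/seteqP; split=> w /=.
    by move=> <-; have [st ft] := ftau w; split=> // s /= /ft /negbTE.
  move=> [st ft]; apply: (first_stop_unique (ftau w)); split=> // s /ft /= e.
  by rewrite -[X in ~~ X]/(dec s w) e.
apply: (@measurableI _ O); first exact: decision_algebra_stop.
apply: (@fin_bigcap_measurable _ O) => [|s /= st]; first exact: finite_finset.
apply: (decision_algebra_mono (ltnW st)); exact: decision_algebra_stop.
Qed.

End stopping_decisions.

(** * The value of the stopping time *)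

Section ae_integrals.
Context {R : realType} {d : measure_display} {O : measurableType d} (P : probability O R).
Implicit Types f h : O -> R.

Lemma ae_eq_Rintegral f h (N : set O) : measurable_fun setT f -> measurable_fun setT h ->
  measurable N -> P N = 0%E -> (forall w, ~ N w -> f w = h w) ->
  \int[P]_w f w = \int[P]_w h w.
Proof.
move=> mf mh mN N0 fh; congr fine; apply: ae_eq_integral => //; try exact/measurable_EFinP.
by exists N; split=> // w /= ne; apply: contrapT => /fh e; apply: ne => _; rewrite e.
Qed.

Lemma ae_le_Rintegral f h (N : set O) :
  P.-integrable setT (EFin \o f) -> P.-integrable setT (EFin \o h) ->
  measurable N -> P N = 0%E -> (forall w, ~ N w -> f w <= h w) ->
  \int[P]_w f w <= \int[P]_w h w.
Proof.
move=> fi hi mN N0 fh.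
have mf : measurable_fun setT f by apply/measurable_EFinP; exact: measurable_int fi.
have mh : measurable_fun setT h by apply/measurable_EFinP; exact: measurable_int hi.
pose h' w := Num.max (f w) (h w).
have mh' : measurable_fun setT h' by exact: measurable_maxr.
rewrite (ae_eq_Rintegral mh mh' mN N0); last by move=> w /fh/max_idPr.
apply: le_Rintegral => // [|w _]; last by rewrite le_max lexx.
apply: (le_integrable measurableT _ _ (integrableD measurableT (integrable_abse fi) (integrable_abse hi))).
  exact/measurable_EFinP.
move=> w _ /=; rewrite lee_fin [leRHS]ger0_norm ?addr_ge0//.
by rewrite /h'; case: (leP (f w) (h w)) => _; rewrite ?lerDl ?lerDr.
Qed.

End ae_integrals.

Lemma Rintegral_sum {R : realType} {d : measure_display} {O : measurableType d}
    (P : probability O R) {I : Type} (s : seq I) (f : I -> O -> R) :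
  (forall i, P.-integrable setT (EFin \o f i)) ->
  P.-integrable setT (EFin \o (fun w => \sum_(i <- s) f i w)) /\
  \int[P]_w (\sum_(i <- s) f i w) = \sum_(i <- s) \int[P]_w f i w.
Proof.
move=> fi; elim: s => [|i s [IH1 IH2]].
  under eq_fun do rewrite big_nil; rewrite big_nil; split; last exact: Rintegral_prob_cst.
  by apply: (@bounded_integrable _ _ _ _ _ 0) => // w; rewrite normr0.
under eq_fun do rewrite big_cons; rewrite big_cons -IH2 -(RintegralD measurableT (fi i) IH1).
by split=> //; exact: (integrableD measurableT (fi i) IH1).
Qed.

Section stopped_values.
Context {R : realType} {D T : nat} {d dX : measure_display}
  {Omega : measurableType d} (P : probability Omega R)
  (Y : Omega -> 'M[R]_(D, T)) {Xi : measurableType dX} (nu : probability Xi R)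
  (S : forall n : 'I_T.+1, 'M[R]_(D, n) -> Xi -> 'M[R]_(D, T))
  (xi : 'I_T -> nat -> Omega -> Xi)
  (g : forall t : 'I_T, 'M[R]_(D, obs t) -> R) (U : R).
Hypotheses (mY : measurable_fun setT Y) (S_sampler : conditional_sampler P Y nu S)
  (xi_fresh : fresh_seeds P Y nu xi) (mg : forall t, measurable_fun setT (@g t))
  (reward_ge0 : forall t w, 0 <= reward Y g t w) (T_gt0 : (0 < T)%N) (U_gt0 : 0 < U).
Local Notation past := (past Y).
Local Notation resid := (resid nu S g U).
Local Notation best := (best nu S g U).
Local Notation price := (price nu S g U).
Local Notation good := (good nu S g).

Let mS (n : 'I_T.+1) : measurable_fun setT (fun cx : 'M[R]_(D, n) * Xi => S cx.1 cx.2).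
Proof. by have [] := S_sampler n. Qed.

Let bad := Y @^-1` (~` good).

Let mbad : measurable bad.
Proof. by apply: mpreim => //; apply: measurableC; exact: (measurable_good mY S_sampler mg reward_ge0). Qed.

Let bad0 : P bad = 0%E. Proof. exact: good_ae. Qed.

Let notbad w : ~ bad w -> good (Y w). Proof. exact: contrapT. Qed.

Let gge0 M (t : 'I_T) : good M -> 0 <= g (first_cols (obs t) M).
Proof. exact: good_ge0. Qed.

Let gresample := good_resample mY S_sampler mg reward_ge0.

Lemma floor_abs k (r : R) : floor_of k <= r <= floor_of k + 1 -> `|r| <= 1.
Proof. by case: k => [|k] /=; rewrite ler_norml; lra. Qed.

Definition total_price (k : nat) : R := \sum_(l < k) \int[P]_w best l (Y w).

Section random_date.
Variable sigma : Omega -> 'I_T.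
Hypothesis Hs : forall t, decision_algebra Y xi t [set w | sigma w = t].
Let c w := past (obs (sigma w)) w.

Let ms t : measurable [set w | sigma w = t].
Proof. by apply: (decision_algebra_measurable mY xi_fresh); exact: Hs. Qed.

Lemma measurable_stopped (f : forall t : 'I_T, 'M[R]_(D, obs t) -> R) :
  (forall t, measurable_fun setT (@f t)) -> measurable_fun setT (fun w => f _ (c w)).
Proof.
move=> mf; apply: (@measurable_at _ _ _ _ ms _ _ (fun t w => f t (past (obs t) w))) => t.
have mp : measurable_fun setT (past (obs t)) by exact: measurable_past.
exact: measurableT_comp (mf t) mp.
Qed.

Let mresid k : measurable_fun setT (fun w => resid k (c w)).
Proof. by apply: (measurable_stopped (f := resid k)) => t; exact: measurable_resid. Qed.

Let mprice k : measurable_fun setT (fun w => price k (c w)).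
Proof. by apply: (measurable_stopped (f := price k)) => t; exact: measurable_price. Qed.

Lemma integrable_stopped_resid k : P.-integrable setT (EFin \o (fun w => resid k (c w))).
Proof.
by apply: (@bounded_integrable _ _ _ _ _ 1) => // w; apply: (@floor_abs k); exact: resid_bounds.
Qed.

Lemma integrable_stopped_price k : P.-integrable setT (EFin \o (fun w => price k (c w))).
Proof.
by apply: (@bounded_integrable _ _ _ _ _ 1) => // w; apply: (@floor_abs k); exact: price_bounds.
Qed.

Let mbest k : measurable_fun setT (fun w => best k (Y w)).
Proof.
have mb : measurable_fun setT (best k) by exact: measurable_best.
exact: measurableT_comp mb mY.
Qed.

(** Optional stopping for the martingale [E (max_s Z^(k+1)_s | F_t)] *)
Lemma price_at k : \int[P]_w price k (c w) = \int[P]_w best k (Y w).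
Proof.
have cst_int (dO : measure_display) (O : measurableType dO) (Q : probability O R) (a : R) :
    Q.-integrable setT (EFin \o (fun=> a)).
  exact: (@bounded_integrable _ _ _ _ _ `|a|).
have ib : P.-integrable setT (EFin \o (fun w => best k (Y w))).
  by apply: (@bounded_integrable _ _ _ _ _ 1) => // w; apply: (@floor_abs k); exact: best_bounds.
have ibS (n : 'I_T.+1) (b : 'M[R]_(D, n)) :
    nu.-integrable setT (EFin \o (fun x => best k (S b x))).
  apply: (@bounded_integrable _ _ _ _ _ 1) => [|x]; first exact: measurable_best_simulate.
  by apply: (@floor_abs k); exact: best_bounds.
apply/(addIr (- floor_of k)).
rewrite -[in LHS](Rintegral_prob_cst P (floor_of k)) -[in RHS](Rintegral_prob_cst P (floor_of k)).
have ip := integrable_stopped_price k.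
rewrite -(RintegralB measurableT ip (cst_int _ _ P _)).
rewrite -(RintegralB measurableT ib (cst_int _ _ P _)).
have mb : measurable_fun setT (best k) by exact: measurable_best.
have mf : measurable_fun setT (fun M => (best k M - floor_of k)%:E).
  by apply/measurable_EFinP; exact: measurable_funB.
have f0 M : (0 <= (best k M - floor_of k)%:E)%E.
  by rewrite lee_fin subr_ge0; case/andP: (best_bounds nu S g U_gt0 k M).
rewrite /Rintegral [in RHS](optional_continuation mY S_sampler xi_fresh Hs mf f0).
congr fine; apply: eq_integral => w _.
rewrite -[LHS]fineK// -[RHS]fineK; last first.
  apply: integrable_fin_num => //.
  exact: (integrableB measurableT (ibS _ (c w)) (cst_int _ _ nu (floor_of k))).
congr EFin; rewrite -[RHS]/(\int[nu]_x (best k (S (c w) x) - floor_of k)) [LHS]/=.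
by rewrite (RintegralB measurableT (ibS _ _) (cst_int _ _ nu _)) Rintegral_prob_cst.
Qed.

(** The second term is the same for all decision times: maximizing the truncated
    reward amounts to maximizing the residual. *)
Lemma resid_at k :
  \int[P]_w resid 0 (c w) = \int[P]_w resid k (c w) + total_price k.
Proof.
elim: k => [|k IH]; first by rewrite /total_price big_ord0 addr0.
rewrite {}IH /total_price big_ord_recr [X in _ = _ + X]/= -price_at.
rewrite [X in _ = _ + X]addrC addrA; congr (_ + _).
rewrite -(RintegralD measurableT (integrable_stopped_resid k.+1) (integrable_stopped_price k)).
apply: (ae_eq_Rintegral _ _ mbad bad0) => // [|w /notbad gw].
  exact: measurable_funD.
by rewrite (residS U_gt0 mS mg gresample gw) subrK.
Qed.

Let mreward : measurable_fun setT (fun w => reward Y g (sigma w) w).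
Proof. exact: (measurable_stopped (f := g)). Qed.

Lemma resid0_reward w : U * resid 0 (c w) = Num.min U (reward Y g (sigma w) w).
Proof.
have g0 : 0 <= g (c w) by exact: reward_ge0.
by rewrite /= (max_idPr g0) mulrCA divff ?mulr1// gt_eqF.
Qed.

Let int_resid0 : (\int[P]_w (U * resid 0 (c w))%:E)%E = (U * \int[P]_w resid 0 (c w))%:E.
Proof.
have i0 := integrable_stopped_resid 0.
rewrite -RintegralZl// /Rintegral fineK//; apply: integrable_fin_num => //.
exact: (integrableZl measurableT U i0).
Qed.

Lemma expectation_stopped_ge :
  ((U * \int[P]_w resid 0 (c w))%:E <= 'E_P[fun w => reward Y g (sigma w) w])%E.
Proof.
rewrite unlock -int_resid0; apply: ge0_le_integral => // [w _|||w _].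
- rewrite lee_fin mulr_ge0 ?(ltW U_gt0)//.
  by case/andP: (resid_bounds nu S g U_gt0 0 (c w)).
- by apply/measurable_EFinP; exact: measurable_funM.
- exact/measurable_EFinP.
- by rewrite lee_fin resid0_reward ge_min lexx orbT.
Qed.

Lemma expectation_stopped_le :
  ('E_P[fun w => reward Y g (sigma w) w] <= (U * \int[P]_w resid 0 (c w))%:E +
     U^-1%:E * 'E_P[(fun w => max_reward Y g w ^+ 2)%R])%E.
Proof.
have mM : measurable_fun setT (fun w => max_reward Y g w ^+ 2).
  apply: measurable_funX; apply: measurable_bigmax => t.
  have mp : measurable_fun setT (past (obs t)) by exact: measurable_past.
  exact: measurableT_comp (@mg t) mp.
have U0 := ltW U_gt0.
rewrite unlock -int_resid0 -ge0_integralZl_EFin ?invr_ge0//; last 2 first.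
- by move=> w _; rewrite lee_fin sqr_ge0.
- exact/measurable_EFinP.
have mr : measurable_fun setT (fun w => (U * resid 0 (c w))%:E).
  by apply/measurable_EFinP; exact: measurable_funM.
have mm : measurable_fun setT (fun w => (U^-1%:E * (max_reward Y g w ^+ 2)%:E)%E).
  by apply: measurable_funeM; exact/measurable_EFinP.
have r0 w : (0 <= (U * resid 0 (c w))%:E)%E.
  rewrite lee_fin mulr_ge0//; by case/andP: (resid_bounds nu S g U_gt0 0 (c w)).
have m0 w : (0 <= U^-1%:E * (max_reward Y g w ^+ 2)%:E)%E.
  by rewrite mule_ge0// lee_fin ?invr_ge0 ?sqr_ge0.
rewrite -ge0_integralD//; apply: ge0_le_integral => // [w _|||w _].
- by rewrite lee_fin reward_ge0.
- exact/measurable_EFinP.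
- exact: emeasurable_funD.
rewrite -EFinM -EFinD lee_fin resid0_reward.
set z := reward _ _ _ _; have z0 : 0 <= z by exact: reward_ge0.
have zM : z <= max_reward Y g w by exact: (le_bigmax _ (fun t => reward Y g t w)).
rewrite minC; case: (leP z U) => zU; first by rewrite lerDl mulr_ge0 ?invr_ge0 ?sqr_ge0.
(* beyond the truncation level the reward is dominated by its square *)
apply: (@le_trans _ _ (U^-1 * z ^+ 2)); last first.
  rewrite -[leLHS]add0r lerD// ler_wpM2l ?invr_ge0//.
  by rewrite ler_pXn2r// nnegrE// (le_trans z0).
rewrite mulrC ler_pdivlMr// expr2 ler_wpM2l// ltW//.
Qed.

End random_date.
Lemma measurable_indicator dV (V : measurableType dV) (b : V -> bool) :
  measurable_fun setT b -> measurable_fun setT (fun v => (b v)%:R : R).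
Proof.
move=> mb; rewrite (_ : (fun v => _) = (fun v => if b v then 1 else 0)); last first.
  by apply/funext => v; case: (b v).
exact: measurable_fun_ifT.
Qed.

Section algorithm_stops.
Variables (eps : R) (tau : Omega -> 'I_T).
Hypothesis eps01 : 0 < eps < 1.
Let K := nat_ceil (4 / eps).
Let decision (t : 'I_T) w :=
  output S g (truncated_decide eps U (past (obs t) w)) (fun i => xi t i w).
Hypothesis tau_first : forall w, first_stop (decision ^~ w) (tau w).

Lemma decision_algebra_tau t : decision_algebra Y xi t [set w | tau w = t].
Proof.
apply: (decision_algebra_first_stop mS (p := fun t c => truncated_decide eps U c)) tau_first.
exact: (mprog_decide mg eps U).
Qed.

Let wrong (t : 'I_T) w := (t.+1 != T) &&
  wrong_decision nu S g U eps (past (obs t) w) (decision t w).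

Let mwrong_decision (t : 'I_T) b :
  measurable_fun setT (fun c : 'M[R]_(D, obs t) => wrong_decision nu S g U eps c b).
Proof.
have mr : measurable_fun setT (@resid K t) by exact: measurable_resid.
by case: b; [exact: measurable_fun_ltr|exact: measurable_fun_ler].
Qed.

Let mwrong t : measurable_fun setT (wrong t).
Proof.
rewrite /wrong; case: eqP => _; first exact: measurable_cst.
have [mp mxi _] := fresh_past mY xi_fresh t.
have md := mprog_output mS (mprog_decide mg eps U t) mp mxi.
rewrite (_ : (fun w => _) = (fun w => if decision t w
  then wrong_decision nu S g U eps (past (obs t) w) true
  else wrong_decision nu S g U eps (past (obs t) w) false)); last first.
  by apply/funext => w /=; case: (decision t w).
have mw b : measurable_fun setT (fun w => wrong_decision nu S g U eps (past (obs t) w) b).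
  exact: measurableT_comp (@mwrong_decision t b) mp.
exact: measurable_fun_ifT.
Qed.

(** The accuracy of the estimates, a statement on [wp], becomes a statement on the
    actual decisions because the seeds are fresh. *)
Lemma wrong_rare t : \int[P]_w (wrong t w)%:R <= eps / (4 * T%:R).
Proof.
have [e0 e1] := andP eps01.
have b0 : 0 <= eps / (4 * T%:R) by rewrite divr_ge0 ?mulr_ge0 ?ler0n ?(ltW e0).
rewrite -lee_fin.
have mi : measurable_fun setT (fun w => (wrong t w)%:R : R) by exact: measurable_indicator.
rewrite /Rintegral fineK; last first.
  apply: integrable_fin_num => //; apply: (@bounded_integrable _ _ _ _ _ 1) => // w.
  by case: (wrong t w); rewrite ?normr1 ?normr0.
rewrite /wrong; case: eqP => tT /=; first by rewrite integral0 lee_fin.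
pose F (c : 'M[R]_(D, obs t)) b := ((wrong_decision nu S g U eps c b)%:R%:E : \bar R).
have F0 c b : (0 <= F c b)%E by rewrite lee_fin.
have mF b : measurable_fun setT (F ^~ b).
  apply/measurable_EFinP; apply: measurable_indicator; exact: mwrong_decision.
have fp := fresh_past mY xi_fresh t.
have := mprog_expectation mS (mprog_decide mg eps U t) fp F0 mF.
rewrite /F /= => ->.
rewrite -[leRHS](integral_prob_cst P); apply: ae_ge0_le_integral => //.
- by move=> w _; exact: wp_ge0.
- have mwp : measurable_fun setT (fun c => wp nu S g (truncated_decide eps U c) (F c)).
    exact: (@mprog_wp _ _ _ _ _ nu S g mS _ _ _ (mprog_decide mg eps U t) F F0 mF).
  have [mp _ _] := fp; exact: measurableT_comp mwp mp.
exists bad; split=> // w /=; apply: contra_notP => /notbad gw _.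
by apply: (wpr_decide U_gt0 mS mg T_gt0 gge0 gresample) => //; exact/eqP.
Qed.

(** Without wrong decisions the algorithm stops at a date of large residual.  If
    it reaches the last date, all earlier residuals are small, so the lower bound
    on the maximal one applies to the last residual. *)
Lemma resid_tau_ge w : good (Y w) ->
  - (3 / 4 * eps) - \sum_(t < T) (wrong t w)%:R <= resid K (past (obs (tau w)) w).
Proof.
move=> gw; have [e0 e1] := andP eps01.
have K4 : 4 / eps <= K%:R by apply: le_nat_ceil; rewrite divr_ge0 ?(ltW e0).
have K0 : (0 < K)%N by apply: nat_ceil_gt0; rewrite divr_gt0.
have Kinv : K%:R^-1 <= eps / 4.
  by rewrite -[leRHS]invf_div lef_pV2// posrE ?divr_gt0// ltr0n.
have floorK : floor_of K = -1 :> R by case: (K) K0.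
set t := tau w; have [ft bt] := tau_first w; rewrite -/t in ft bt.
have [/existsP[s ws]|/existsPn nw] := boolP [exists s, wrong s w].
  rewrite (bigD1 s)//= ws; have := resid_bounds nu S g U_gt0 K (past (obs t) w).
  have : 0 <= \sum_(i < T | i != s) (wrong i w)%:R :> R by apply: sumr_ge0.
  rewrite floorK mulr1n; set r := resid _ _; set q := \sum_(_ < _ | _) _; lra.
rewrite big1 ?subr0 => [|s _]; last by rewrite (negbTE (nw s)).
rewrite leNgt; apply/negP => lt.
have := nw t; rewrite /wrong /wrong_decision ft -/K lt andbT negbK => /eqP tT.
(* then every residual along the trajectory lies below the bound of [best_ge] *)
have : best K (Y w) < - (eps / 4).
  apply/bigmax_ltP; split=> [|s _]; first by rewrite floorK; lra.
  have [->|st] := eqVneq s t; first by apply: lt_le_trans lt _; lra.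
  have lts : (s < t)%N.
    have := ltn_ord s; rewrite -{2}tT ltnS leq_eqVlt.
    by rewrite (inj_eq val_inj) (negbTE st).
  have := nw s; rewrite /wrong /wrong_decision (negbTE (bt s lts)) -/K negb_and negbK -ltNge.
  by move=> /orP[/eqP sT|//]; move: lts; rewrite -ltnS tT -[X in (_ < X)%N]sT ltnn.
have := best_ge U_gt0 mS mg T_gt0 gresample gw K0.
by lra.
Qed.

Lemma resid_tau : - eps <= \int[P]_w resid K (past (obs (tau w)) w).
Proof.
have iw t : P.-integrable setT (EFin \o (fun w => (wrong t w)%:R : R)).
  apply: (@bounded_integrable _ _ _ _ _ 1) => [|w]; first exact: measurable_indicator.
  by case: (wrong t w); rewrite ?normr1 ?normr0.
have icst : P.-integrable setT (EFin \o (fun=> - (3 / 4 * eps))).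
  by apply: (@bounded_integrable _ _ _ _ _ `|- (3 / 4 * eps)|).
have [isum sumE] := Rintegral_sum (index_enum 'I_T) iw.
have := ae_le_Rintegral (integrableB measurableT icst isum)
  (integrable_stopped_resid decision_algebra_tau K) mbad bad0
  (fun w nb => resid_tau_ge (notbad nb)).
rewrite (RintegralB measurableT icst isum) Rintegral_prob_cst sumE; apply: le_trans.
have : \sum_(t < T) \int[P]_w (wrong t w)%:R <= T%:R * (eps / (4 * T%:R)).
  rewrite mulr_natl -[X in _ *+ X]card_ord -sumr_const.
  by apply: ler_sum => t _; exact: wrong_rare.
have T0 : T%:R != 0 :> R by rewrite pnatr_eq0 -lt0n.
rewrite (_ : T%:R * (eps / (4 * T%:R)) = eps / 4); last by field.
by lra.
Qed.

End algorithm_stops.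
End stopped_values.

(** * Second moments *)

Section second_moment.
Context {R : realType} {d : measure_display} {O : measurableType d}
  (P : probability O R) (M : O -> R).
Hypotheses (mM : measurable_fun setT M) (M_ge0 : forall w, 0 <= M w)
  (M2_fin : (\int[P]_w (M w ^+ 2)%:E < +oo)%E).
Let m := \int[P]_w M w.
Let v := \int[P]_w M w ^+ 2.

Lemma integrable_sqr : P.-integrable setT (EFin \o (fun w => M w ^+ 2)).
Proof.
apply/integrableP; split; first by apply/measurable_EFinP; exact: measurable_funX.
by under eq_integral do rewrite /= ger0_norm ?sqr_ge0//.
Qed.

Let icst (a : R) : P.-integrable setT (EFin \o (fun=> a)).
Proof. exact: (@bounded_integrable _ _ _ _ _ `|a|). Qed.

Lemma integrable_of_sqr : P.-integrable setT (EFin \o M).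
Proof.
apply: (le_integrable measurableT _ _ (integrableD measurableT (icst 1) integrable_sqr)).
  exact/measurable_EFinP.
move=> w _ /=; rewrite lee_fin !ger0_norm ?addr_ge0 ?sqr_ge0//.
by have := sqr_ge0 (M w - 1); have := M_ge0 w; nra.
Qed.

(** Integrating [b M <= a + c M^2 + q 1_A] bounds the mass of [A] from below;
    minimizing over the coefficients is what the Cauchy-Schwarz inequality does. *)
Let young (a b c q : R) (A : set O) : measurable A -> 0 <= b ->
  (forall w, b * M w <= a + c * M w ^+ 2 + q * \1_A w) ->
  b * m <= a + c * v + q * fine (P A).
Proof.
move=> mA b0 H; have iM := integrable_of_sqr; have i2 := integrable_sqr.
have iA : P.-integrable setT (EFin \o (\1_A : O -> R)).
  apply: (@bounded_integrable _ _ _ _ _ 1) => [|w]; first exact: measurable_indic.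
  by rewrite indicE; case: (w \in A); rewrite ?normr1 ?normr0.
have EA : \int[P]_w \1_A w = fine (P A) by rewrite /Rintegral integral_indic// setIT.
rewrite -EA /m /v -(RintegralZl _ measurableT iM) -(RintegralZl _ measurableT i2).
rewrite -(RintegralZl _ measurableT iA) -[a in leRHS](Rintegral_prob_cst P).
have i2' : P.-integrable setT (EFin \o (fun w => c * M w ^+ 2)).
  exact: (integrableZl measurableT c i2).
have iA' : P.-integrable setT (EFin \o (fun w => q * \1_A w)).
  exact: (integrableZl measurableT q iA).
have i3 : P.-integrable setT (EFin \o (fun w => a + c * M w ^+ 2)).
  exact: (integrableD measurableT (icst a) i2').
rewrite -(RintegralD measurableT (icst a) i2') -(RintegralD measurableT i3 iA').
apply: le_Rintegral => //; first exact: (integrableZl measurableT b iM).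
exact: (integrableD measurableT i3 iA').
Qed.

Hypothesis m_gt0 : 0 < m.

Lemma sqr_mean_le : m ^+ 2 <= v.
Proof.
have := @young (m ^+ 2) (2 * m) 1 0 set0 measurable0.
rewrite mul0r addr0 mul1r -mulrA => /(_ (ltW _)) H.
have : 2 * (m * m) <= m ^+ 2 + v.
  apply: H => [|w]; first by rewrite mulr_gt0.
  by rewrite mul0r addr0 mul1r; have := sqr_ge0 (M w - m); nra.
by move: (m) (v) => a b; rewrite expr2; lra.
Qed.

(** A Paley-Zygmund inequality.  Off the event, [M < m / 2]; on the event,
    [M <= l / 2 M^2 + 1 / (2 l)] for every [l > 0], and [l = m / (2 v)] makes the
    quadratic term contribute [m / 4]. *)
Lemma half_mean_mass : m ^+ 2 / (4 * v) <= fine (P [set w | m / 2 <= M w]).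
Proof.
have v0 : 0 < v by apply: lt_le_trans sqr_mean_le; exact: exprn_gt0.
have mA : measurable [set w | m / 2 <= M w].
  rewrite -[X in measurable X]setTI.
  exact: (measurable_fun_ler (measurable_cst (m / 2)) mM measurableT (Y := [set true])).
set A := [set w | _] in mA *; pose l := m / (2 * v).
have l0 : 0 < l by rewrite divr_gt0// mulr_gt0.
have := @young (m / 2) 1 (l / 2) (2 * l)^-1 A mA ler01; set p := fine _ => H.
have {H} : 1 * m <= m / 2 + l / 2 * v + (2 * l)^-1 * p.
  apply: H => w; rewrite mul1r indicE.
  have Ml := mulr_ge0 (ltW l0) (sqr_ge0 (M w)).
  have [_|/negP wA] := boolP (w \in A); last first.
    have : M w < m / 2 by rewrite ltNge; apply/negP => h; apply: wA; exact: mem_set.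
    by rewrite /= mulr0n; move: (m) => a; lra.
  have : 0 <= (l * M w - 1) ^+ 2 / (2 * l) by rewrite divr_ge0 ?sqr_ge0// mulr_ge0// ltW.
  rewrite (_ : _ / (2 * l) = l / 2 * M w ^+ 2 - M w + (2 * l)^-1); last first.
    by field; rewrite gt_eqF.
  by rewrite /= mulr1n; have := m_gt0; move: (m) => a; lra.
rewrite (_ : l / 2 * v = m / 4); last by rewrite /l; field; rewrite gt_eqF.
rewrite (_ : (2 * l)^-1 = v / m); last by rewrite /l; field; rewrite !gt_eqF.
move=> H; rewrite ler_pdivrMr ?mulr_gt0//.
have : m / 4 * m <= v / m * p * m by rewrite ler_pM2r//; move: H; move: (m) (v / m * p) => a b; lra.
rewrite (_ : v / m * p * m = v * p); last by field; rewrite gt_eqF.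
by rewrite expr2; move: (m) (v) => a b; lra.
Qed.

End second_moment.

(** * The optimal value *)

Section optimal_value.
Context {R : realType} {D T : nat} {d : measure_display}
  {Omega : measurableType d} (P : probability Omega R)
  (Y : Omega -> 'M[R]_(D, T)) (g : forall t : 'I_T, 'M[R]_(D, obs t) -> R).
Hypotheses (mY : measurable_fun setT Y) (mg : forall t, measurable_fun setT (@g t))
  (reward_ge0 : forall t w, 0 <= reward Y g t w) (T_gt0 : (0 < T)%N).
Local Notation M := (max_reward Y g).

Lemma measurable_reward t : measurable_fun setT (reward Y g t).
Proof.
have mp : measurable_fun setT (past Y (obs t)) by exact: measurable_past.
exact: measurableT_comp (@mg t) mp.
Qed.

Lemma measurable_max_reward : measurable_fun setT M.
Proof. by apply: measurable_bigmax => t; exact: measurable_reward. Qed.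

Lemma reward_le_max t w : reward Y g t w <= M w.
Proof. exact: (le_bigmax _ (fun t => reward Y g t w)). Qed.

Lemma max_reward_ge0 w : 0 <= M w.
Proof. by apply: bigmax_ge_id. Qed.

Lemma sigma_algebra_natural_filtration t : sigma_algebra setT (natural_filtration Y t).
Proof. apply: sigma_algebra_preimage; exact: sigma_algebra_measurable. Qed.

Lemma stopping_time_measurable sigma : stopping_time Y sigma ->
  forall t, measurable [set w | sigma w = t].
Proof.
move=> Hs t; have [A mA <-] := Hs t; rewrite setTI; apply: mpreim => //.
exact: measurable_past.
Qed.

(** Stop at the first reward above the level, or at the last date. *)
Lemma threshold_stopping (a : R) : 0 < a -> exists sigma, stopping_time Y sigma /\
  forall w, a <= M w -> a <= reward Y g (sigma w) w.
Proof.
move=> a0; pose stop (t : 'I_T) w := (t.+1 == T) || (a <= reward Y g t w).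
have lastT : (T.-1 < T)%N by rewrite prednK.
have /choice[sigma fs] w : exists t, first_stop (stop ^~ w) t.
  by apply: (@first_stop_exists _ _ (Ordinal lastT)); rewrite /stop /= prednK// eqxx.
exists sigma; split=> [t|w].
  pose O := g_sigma_algebraType (natural_filtration Y t).
  have idN : <<s natural_filtration Y t >> = natural_filtration Y t.
    by apply: sigma_algebra_id; exact: sigma_algebra_natural_filtration.
  have mstop (s : 'I_T) b : (s <= t)%N ->
      @measurable _ O [set w | stop s w = b].
    move=> st; rewrite /measurable /= idN; apply: (natural_filtration_mono st).
    pose h (c : 'M[R]_(D, obs s)) := (s.+1 == T) || (a <= g c).
    have mh : measurable_fun setT h.
      rewrite /h; case: eqP => _ /=; first exact: measurable_cst.
      exact: (measurable_fun_ler (measurable_cst a) (@mg s)).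
    by exists (h @^-1` [set b]); [exact: mpreim|rewrite setTI].
  rewrite -idN.
  have -> : [set w | sigma w = t] = [set w | stop t w = true] `&`
      \bigcap_(s in [set s : 'I_T | (s < t)%N]) [set w | stop s w = false].
    apply/seteqP; split=> w /=.
      by move=> <-; have [st ft] := fs w; split=> // s /= /ft /negbTE.
    move=> [st ft]; apply: (first_stop_unique (fs w)); split=> // s /ft /= e.
    by rewrite e.
  apply: (@measurableI _ O); first exact: mstop.
  apply: (@fin_bigcap_measurable _ O) => [|s /= st]; first exact: finite_finset.
  by apply: mstop; exact: ltnW.
move=> /bigmax_geP[|[s _ as_]]; first by rewrite leNgt a0.
have [st ft] := fs w; move: (st); rewrite /stop => /orP[/eqP tT|//].
have : (s <= sigma w)%N by have := ltn_ord s; rewrite -{2}tT ltnS.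
rewrite leq_eqVlt => /orP[/eqP/val_inj <-//|/ft].
by rewrite /stop as_ orbT.
Qed.

Lemma measurable_stopped_reward sigma : stopping_time Y sigma ->
  measurable_fun setT (fun w => reward Y g (sigma w) w).
Proof.
move=> Hs; apply: (@measurable_at _ _ _ _ (stopping_time_measurable Hs) _ _ (reward Y g)) => t.
exact: measurable_reward.
Qed.

Lemma OPT_le_mean : (OPT P Y g <= 'E_P[M])%E.
Proof.
apply: ub_ereal_sup => _ [sigma Hs <-]; apply: expectation_le.
- exact: measurable_stopped_reward.
- exact: measurable_max_reward.
- by move=> w; exact: reward_ge0.
- exact: max_reward_ge0.
- by apply: nearW => w; exact: reward_le_max.
Qed.

Lemma OPT_ge_level (a : R) : 0 < a -> ((a * fine (P [set w | a <= M w]))%:E <= OPT P Y g)%E.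
Proof.
move=> a0; have [sigma [Hs Ha]] := threshold_stopping a0.
have mA : measurable [set w | a <= M w].
  rewrite -[X in measurable X]setTI.
  exact: (measurable_fun_ler (measurable_cst a) measurable_max_reward measurableT
    (Y := [set true])).
apply: (@le_trans _ _ 'E_P[fun w => reward Y g (sigma w) w]%E); last first.
  by apply: ereal_sup_ubound; exists sigma.
rewrite unlock.
have -> : ((a * fine (P [set w | a <= M w]))%:E =
    \int[P]_w (a * \1_[set w | (a <= M w)%R] w)%:E)%E.
  under eq_integral do rewrite EFinM.
  rewrite ge0_integralZl_EFin ?(ltW a0)//.
  - rewrite integral_indic// setIT EFinM fineK// ge0_fin_numE//.
    by rewrite (le_lt_trans (probability_le1 _ _))// ltry.
  - exact/measurable_EFinP/measurable_indic.
apply: ge0_le_integral => // [w _|||w _].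
- by rewrite lee_fin mulr_ge0 ?(ltW a0).
- by apply/measurable_EFinP; apply: measurable_funM => //; exact: measurable_indic.
- by apply/measurable_EFinP; exact: measurable_stopped_reward.
rewrite lee_fin indicE; case: (boolP (_ \in _)) => [/set_mem /Ha|_].
  by rewrite mulr1.
by rewrite mulr0 reward_ge0.
Qed.

End optimal_value.

(** * The approximation ratio *)

(** Both losses, from the inaccuracy and from the truncation, are half of the
    allowance [e] times the lower bound [m / (8 q)] for the optimum. *)
Lemma balanced_losses {F : realFieldType} (e q m : F) : 0 < e -> 0 < q -> 0 < m ->
  let U := 16 * q ^+ 2 * m / e in
  U * (e ^+ 2 / (256 * q ^+ 3)) = e / 2 * (m / (8 * q)) /\
  U^-1 * (q * m ^+ 2) = e / 2 * (m / (8 * q)).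
Proof. by move=> e0 q0 m0 /=; split; field; rewrite !gt_eqF. Qed.

Lemma accuracy_bounds {F : realFieldType} (e q : F) : 0 < e < 1 -> 1 <= q ->
  0 < e ^+ 2 / (256 * q ^+ 3) < 1.
Proof.
move=> /andP[e0 e1] q1; have e2 : e ^+ 2 <= 1 by rewrite exprn_ile1// ltW.
have : 1 <= q ^+ 3 by rewrite exprn_ege1.
move: (q ^+ 3) => r r1; have d0 : 0 < 256 * r by lra.
apply/andP; split; first by apply: divr_gt0 => //; exact: exprn_gt0.
by rewrite ltr_pdivrMr// mul1r; lra.
Qed.

Section guarantee.
Context {R : realType} {D T : nat} {d dX : measure_display}
  {Omega : measurableType d} (P : probability Omega R)
  (Y : Omega -> 'M[R]_(D, T)) {Xi : measurableType dX} (nu : probability Xi R)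
  (S : forall n : 'I_T.+1, 'M[R]_(D, n) -> Xi -> 'M[R]_(D, T))
  (xi : 'I_T -> nat -> Omega -> Xi)
  (g : forall t : 'I_T, 'M[R]_(D, obs t) -> R).
Hypotheses (mY : measurable_fun setT Y) (S_sampler : conditional_sampler P Y nu S)
  (xi_fresh : fresh_seeds P Y nu xi) (mg : forall t, measurable_fun setT (@g t))
  (reward_ge0 : forall t w, 0 <= reward Y g t w) (T_gt0 : (0 < T)%N).
Local Notation M := (max_reward Y g).

(** Any stopping time collects the same total price as the algorithm and has a
    residual at most 0, while that of the algorithm is at least [- eps] on average.
    The last term pays for the truncation of the rewards. *)
Lemma near_optimal (eps U : R) (tau : Omega -> 'I_T) : 0 < eps < 1 -> 0 < U ->
  (forall w, first_stop (fun t => output S g (truncated_decide eps U (past Y (obs t) w))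
     (fun i => xi t i w)) (tau w)) ->
  (OPT P Y g <= 'E_P[fun w => reward Y g (tau w) w] + (U * eps)%:E +
     U^-1%:E * 'E_P[(fun w => M w ^+ 2)%R])%E.
Proof.
move=> eps01 U0 Ftau; set K := nat_ceil (4 / eps).
have [e0 e1] := andP eps01.
have K0 : (0 < K)%N by apply: nat_ceil_gt0; rewrite divr_gt0.
have Htau t : decision_algebra Y xi t [set w | tau w = t].
  by apply: (decision_algebra_tau S_sampler mg Ftau).
apply: ub_ereal_sup => _ [sigma Hs <-].
have Hsig t : decision_algebra Y xi t [set w | sigma w = t].
  by apply: sub_sigma_algebra; left; exact: Hs.
apply: le_trans (expectation_stopped_le mY S_sampler xi_fresh mg reward_ge0 U0 Hsig) _.
rewrite leeD2r//.
have tau_ge := expectation_stopped_ge mY S_sampler xi_fresh mg reward_ge0 U0 Htau.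
apply: le_trans (leeD2r _ tau_ge).
rewrite -EFinD lee_fin -mulrDr ler_pM2l//.
rewrite (resid_at mY S_sampler xi_fresh mg reward_ge0 U0 Hsig K).
rewrite (resid_at mY S_sampler xi_fresh mg reward_ge0 U0 Htau K).
have := resid_tau mY S_sampler xi_fresh mg reward_ge0 T_gt0 U0 eps01 Ftau.
rewrite -/K; set a := \int[P]_w _ => aE; set b := total_price _ _ _ _ _ _ _.
suff : \int[P]_w resid nu S g U K (past Y (obs (sigma w)) w) <= 0.
  by set c := \int[P]_w _ => c0; lra.
rewrite -[leRHS](Rintegral_prob_cst P 0); apply: le_Rintegral => //.
- by apply: (integrable_stopped_resid mY S_sampler xi_fresh mg U0 Hsig K).
- by apply: (@bounded_integrable _ _ _ _ _ 0) => // w; rewrite normr0.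
- move=> w _; case: (K) K0 => // k _.
  by have := resid_bounds nu S g U0 k.+1 (past Y (obs (sigma w)) w); rewrite /floor_of addNr => /andP[].
Qed.

Hypotheses (OPT_gt0 : (0 < OPT P Y g)%E)
  (gamma0_fin : ('E_P[(fun w => M w ^+ 2)%R] < +oo)%E).
Let m := \int[P]_w M w.
Let v := \int[P]_w M w ^+ 2.
Local Notation gamma := (gamma0 P Y g).

Let mM : measurable_fun setT M. Proof. exact: measurable_max_reward. Qed.
Let M0 w : 0 <= M w. Proof. exact: max_reward_ge0. Qed.
Let M2_fin : (\int[P]_w (M w ^+ 2)%:E < +oo)%E.
Proof. by have := gamma0_fin; rewrite unlock. Qed.

Let meanE : ('E_P[M] = m%:E)%E.
Proof.
rewrite unlock /m /Rintegral fineK//; apply: integrable_fin_num => //.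
exact: integrable_of_sqr.
Qed.

Let sqrE : ('E_P[(fun w => M w ^+ 2)%R] = v%:E)%E.
Proof.
rewrite unlock /v /Rintegral fineK//; apply: integrable_fin_num => //.
exact: integrable_sqr.
Qed.

Lemma mean_gt0 : 0 < fine 'E_P[M]%E.
Proof.
rewrite meanE /= -lte_fin -meanE; apply: lt_le_trans OPT_gt0 _; exact: OPT_le_mean.
Qed.

Let m0 : 0 < m. Proof. by have := mean_gt0; rewrite meanE. Qed.

Let gammaE : v = gamma * m ^+ 2.
Proof. by rewrite /gamma0 meanE sqrE /= divfK// gt_eqF// exprn_gt0. Qed.

Lemma gamma0_ge1 : 1 <= gamma.
Proof.
by rewrite /gamma0 meanE sqrE /= ler_pdivlMr ?exprn_gt0// mul1r; exact: sqr_mean_le.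
Qed.

Let OPT_fin : OPT P Y g = (fine (OPT P Y g))%:E.
Proof.
rewrite fineK// ge0_fin_numE ?(ltW OPT_gt0)//.
by apply: le_lt_trans (OPT_le_mean P mY mg reward_ge0) _; rewrite meanE ltry.
Qed.

(** The bound of [OPT_ge_level] for the level [m / 2], whose mass
    [half_mean_mass] bounds from below *)
Lemma OPT_ge_mean : m / (8 * gamma) <= fine (OPT P Y g).
Proof.
have g0 : 0 < gamma := lt_le_trans ltr01 gamma0_ge1.
have m20 : 0 < m / 2 by rewrite divr_gt0.
rewrite -lee_fin -OPT_fin.
apply: le_trans (OPT_ge_level P mY mg reward_ge0 T_gt0 m20); rewrite lee_fin.
apply: le_trans (ler_wpM2l (ltW m20) (half_mean_mass mM M0 M2_fin m0)).
by rewrite -/m -/v gammaE le_eqVlt; apply/orP; left; apply/eqP; field; rewrite !gt_eqF.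
Qed.

Lemma approximation_ratio (eps : R) (tau : Omega -> 'I_T) : 0 < eps < 1 ->
  let eps' := eps ^+ 2 / (256 * gamma ^+ 3) in
  let U := 16 * gamma ^+ 2 * fine 'E_P[M]%E / eps in
  (forall w, first_stop (fun t => output S g (truncated_decide eps' U (past Y (obs t) w))
     (fun i => xi t i w)) (tau w)) ->
  1 - eps <= fine 'E_P[fun w => reward Y g (tau w) w]%E / fine (OPT P Y g).
Proof.
move=> /andP[e0 e1] eps' U Ftau; have g1 := gamma0_ge1.
have g0 : 0 < gamma := lt_le_trans ltr01 gamma0_ge1.
have U0 : 0 < U by rewrite divr_gt0// mulr_gt0 ?mean_gt0// mulr_gt0// exprn_gt0.
have eps'01 : 0 < eps' < 1 by apply: accuracy_bounds; rewrite ?e0.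
have Htau t : decision_algebra Y xi t [set w | tau w = t].
  by apply: (decision_algebra_tau S_sampler mg Ftau).
have := near_optimal eps'01 U0 Ftau.
have O0 : 0 < fine (OPT P Y g) by rewrite -lte_fin -OPT_fin.
have Zfin : ('E_P[fun w => reward Y g (tau w) w] =
    (fine 'E_P[fun w => reward Y g (tau w) w]%E)%:E)%E.
  have Z0 : (0 <= 'E_P[fun w => reward Y g (tau w) w])%E by apply: expectation_ge0.
  rewrite fineK// ge0_fin_numE//.
  apply: le_lt_trans (expectation_stopped_le mY S_sampler xi_fresh mg reward_ge0 U0 Htau) _.
  by rewrite sqrE -EFinM -EFinD ltry.
move=> near; have {near} : fine (OPT P Y g) <=
    fine 'E_P[fun w => reward Y g (tau w) w]%E + U * eps' + U^-1 * v.
  by rewrite -lee_fin !EFinD -OPT_fin -Zfin [(U^-1 * v)%:E]EFinM -sqrE.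
rewrite ler_pdivlMr//; set o := fine _ in O0 *; set z := fine _ => oz.
have om : m / (8 * gamma) <= o := OPT_ge_mean.
have [] := balanced_losses e0 g0 m0.
have -> : 16 * gamma ^+ 2 * m / eps = U by rewrite /U meanE.
rewrite -/eps' -gammaE => UE VE; rewrite UE VE in oz.
have := ler_wpM2l (ltW e0) om; move: oz; set l := m / _ => oz el; lra.
Qed.

End guarantee.

(** * Running time *)

(** The [N t] calls to the previous level with risk [1 / (16 N t)] dominate: each
    costs [W b u] divided by this risk, hence the factor [n^2 t^2]. *)
Lemma level_cost {F : realFieldType} (W C t u b b' n N L d : F) :
  4 <= W -> C <= W -> 1 <= t -> 1 <= u -> 0 <= b' <= b -> 1 <= b -> 1 <= n ->
  0 <= N <= n -> 0 <= L <= 16 / d -> 0 < d <= 1 ->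
  12 + (L * (8 * (W * b' * u) + (N * (C + (t * (W * b * u * (16 * N * t)) + t)) + (N + 2)))
    + L) <= 476 * (W * b * u * t ^+ 2) * n ^+ 2 / d.
Proof.
move=> W4 CW t1 u1 /andP[b'0 b'b] b1 n1 /andP[N0 Nn] /andP[L0 Ld] /andP[d0 d1].
have Wb1 : W <= W * b by rewrite ler_peMr//; lra.
have Wbu1 : W * b <= W * b * u by rewrite ler_peMr//; lra.
have t2 : t <= t ^+ 2 by rewrite expr2 ler_peMr//; lra.
have q1 : W * b * u <= W * b * u * t ^+ 2 by rewrite ler_peMr//; lra.
have b'q : W * b' * u <= W * b * u by rewrite ler_pM2r ?ler_pM2l//; lra.
have n2 : n <= n ^+ 2 by rewrite expr2 ler_peMr//; lra.
have r4 : 4 <= W * b * u by apply: le_trans Wbu1; exact: le_trans Wb1.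
have tq : t <= W * b * u * t ^+ 2.
  by apply: le_trans t2 _; rewrite ler_peMl ?sqr_ge0//; apply: le_trans r4; rewrite ler1n.
rewrite (_ : t * (W * b * u * (16 * N * t)) = 16 * N * (W * b * u * t ^+ 2)); last by ring.
have Wr := le_trans Wb1 Wbu1.
move: (W * b * u) (W * b' * u) (W * b * u * t ^+ 2) r4 q1 b'q tq Wr {Wb1 Wbu1 u1 b'0 b'b b1}
  => r p q r4 rq pr tq Wr.
have q4 : 4 <= q by lra.
have nq : q <= q * n ^+ 2 by rewrite ler_peMr//; lra.
have Nq x : 0 <= x <= q -> N * x <= q * n ^+ 2.
  by move=> /andP[x0 xq]; rewrite [q * _]mulrC ler_pM//; lra.
have NC : N * C <= q * n ^+ 2.
  case: (lerP 0 C) => [C0|C0]; first by apply: Nq; lra.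
  by apply: (@le_trans _ _ 0); [rewrite mulr_ge0_le0//; lra|lra].
have Nt : N * t <= q * n ^+ 2 by apply: Nq; lra.
have N1 : N * 1 <= q * n ^+ 2 by apply: Nq; lra.
have NN : N * (16 * N * q) <= 16 * (q * n ^+ 2).
  rewrite (_ : N * (16 * N * q) = 16 * (q * (N * N))); last by ring.
  by rewrite ler_pM2l// ler_pM2l ?expr2; [apply: ler_pM|lra].
rewrite -(mulrA 476); move: (q * n ^+ 2) nq NC Nt N1 NN {Nq} => X qX NC Nt N1 NN.
have inner : 8 * p + (N * (C + (16 * N * q + t)) + (N + 2)) <= 28 * X.
  move: NC Nt N1 NN; rewrite !mulrDr mulr1.
  move: (N * C) (N * t) (N * (16 * N * q)) => x y z; clear - rq pr q4 qX; lra.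
have X4 : 1 <= X by clear - q4 qX; lra.
have Zle := ler_wpM2l L0 inner.
have LX : L * (29 * X) <= 16 / d * (29 * X) by rewrite ler_wpM2r//; clear - X4; lra.
have id1 : 1 <= d^-1 by rewrite invf_ge1.
have dX : X <= X / d by rewrite ler_peMr//; clear - X4; lra.
have L29 : L <= L * X by rewrite ler_peMr//.
move: (L * _) Zle => Z Zle; clear - X4 Zle LX dX L29; lra.
Qed.

Section running_times.
Context {R : realType} {D T : nat} {Xi : Type}
  (S : forall n : 'I_T.+1, 'M[R]_(D, n) -> Xi -> 'M[R]_(D, T))
  (g : forall t : 'I_T, 'M[R]_(D, obs t) -> R) (C G : R).
Local Notation prog := (prog R D T).
Local Notation time := (running_time S g C G).

Lemma run_bind (A B : Type) (p : prog A) (f : A -> prog B) (s : nat -> Xi) : exists s',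
  time (bind p f) s = time p s + time (f (output S g p s)) s' /\
  output S g (bind p f) s = output S g (f (output S g p s)) s'.
Proof.
elim: p s => /= [a|n c k IH|t c k IH|op x y k IH|l k IH] s.
- by exists s; rewrite add0r.
- have [s' [tE oE]] := IH (S c (s 0%N)) (fun i => s i.+1).
  by exists s'; rewrite tE addrA.
- by have [s' [tE oE]] := IH (g c) s; exists s'; rewrite tE addrA.
- by have [s' [tE oE]] := IH (arith_val op x y) s; exists s'; rewrite tE addrA.
- by have [s' [tE oE]] := IH (median l) s; exists s'; rewrite tE addrA.
Qed.

(** A time bound and a postcondition valid for all seeds; the postconditions
    record the lengths of lists, on which later costs depend. *)
Definition costs (A : Type) (p : prog A) (b : R) (Q : A -> Prop) :=
  forall s, time p s <= b /\ Q (output S g p s).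

Lemma costs_bind (A B : Type) (p : prog A) (f : A -> prog B) b1 b2 Q1 Q2 :
  costs p b1 Q1 -> (forall a, Q1 a -> costs (f a) b2 Q2) ->
  costs (bind p f) (b1 + b2) Q2.
Proof.
move=> cp cf s; have [s' [-> ->]] := run_bind p f s.
have [tp Qp] := cp s; have [tf Qf] := cf _ Qp s'.
by split=> //; exact: lerD.
Qed.

Lemma costs_le (A : Type) (p : prog A) b b' Q : costs p b Q -> b <= b' -> costs p b' Q.
Proof. by move=> cp bb s; have [tp Qp] := cp s; split=> //; exact: le_trans bb. Qed.

Lemma costs_ret (A : Type) (a : A) (Q : A -> Prop) : Q a -> costs (Ret a) 0 Q.
Proof. by move=> Qa s; split. Qed.

Lemma costs_arith (A : Type) op x y (k : R -> prog A) b Q :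
  costs (k (arith_val op x y)) b Q -> costs (ArithK op x y k) (1 + b) Q.
Proof. by move=> cf s; have [tf Qf] := cf s; split=> //=; rewrite lerD2l. Qed.

Lemma costs_simulate (A : Type) (n : 'I_T.+1) (c : 'M[R]_(D, n)) (f : 'M[R]_(D, T) -> prog A) b Q :
  (forall M, costs (f M) b Q) -> costs (bind (do_simulate c) f) (C + b) Q.
Proof. by move=> cf s /=; have [tf Qf] := cf (S c (s 0%N)) (fun i => s i.+1); split=> //; rewrite lerD2l. Qed.

Lemma costs_map (I A : Type) (f : I -> prog A) (l : seq I) b :
  (forall i, costs (f i) b (fun=> True)) ->
  costs (map_prog f l) ((size l)%:R * b) (fun r => size r = size l).
Proof.
move=> cf; elim: l => [|i l IH]; first by rewrite mul0r; exact: costs_ret.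
apply: (@costs_le _ _ (b + ((size l)%:R * b + 0))); last by rewrite /= -natr1 addr0; lra.
apply: (costs_bind (cf i)) => a _; apply: (costs_bind IH) => r rl.
by apply: costs_ret; rewrite /= rl.
Qed.

Lemma costs_fold op x (l : seq R) : costs (fold_arith D T op x l) (size l)%:R (fun=> True).
Proof.
elim: l x => [|y l IH] x /=; first exact: costs_ret.
by rewrite -nat1r; apply: costs_arith; exact: IH.
Qed.

Lemma costs_fold1 op (l : seq R) : costs (fold1_arith D T op l) (size l)%:R (fun=> True).
Proof.
case: l => [|x l] /=; first exact: costs_ret.
by apply: costs_le (costs_fold op x l) _; rewrite ler_nat.
Qed.

Lemma nat_ceil_le (x : R) : 0 <= x -> (nat_ceil x)%:R <= x + 1.
Proof.
move=> x0; rewrite /nat_ceil natr_absz ger0_norm; last first.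
  by rewrite ceil_ge0 (lt_le_trans _ x0)// ltrN10.
by have := ceilB1_lt x; rewrite intrB; lra.
Qed.

Lemma ln_le_subr1 (x : R) : 0 < x -> ln x <= x - 1.
Proof. by move=> x0; have := @le_ln1Dx R (x - 1); rewrite subrKC; apply; lra. Qed.

Lemma sample_size_le (e : R) : 0 < e <= 1 ->
  let N := nat_ceil (1 / (2 * (e / 4) `^ 2) * ln (2 / (1 / 16))) in
  (0 < N)%N /\ N%:R <= 41 / e ^+ 2.
Proof.
move=> /andP[e0 e1] /=.
have e2 : 0 < e ^+ 2 by exact: exprn_gt0.
have e21 : e ^+ 2 <= 1 by rewrite exprn_ile1// ltW.
rewrite powR_mulrn ?divr_ge0 ?(ltW e0)//.
have -> : 1 / (2 * (e / 4) ^+ 2) = 8 / e ^+ 2 by field; rewrite gt_eqF.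
have -> : 2 / (1 / 16) = 2 ^+ 5 :> R by field.
rewrite lnXn ?ltr0n//.
have -> : ln 2 *+ 5 = 5 * ln 2 :> R by rewrite mulr_natl.
have l2 : 0 < ln 2 :> R by apply: ln_gt0; lra.
have l1 : ln 2 <= 1 :> R by have := @ln_le_subr1 2; lra.
have ie : 1 <= (e ^+ 2)^-1 by rewrite invf_ge1.
have x0 : 0 < 8 / e ^+ 2 * (5 * ln 2) by rewrite mulr_gt0 ?divr_gt0 ?mulr_gt0.
split; first exact: nat_ceil_gt0.
apply: le_trans (nat_ceil_le (ltW x0)) _.
by move: (e ^+ 2)^-1 (ln 2) ie l2 l1 {x0} => i l; nra.
Qed.

Lemma repetitions_le (d : R) : 0 < d <= 1 ->
  (nat_ceil (8 * ln (2 / d)))%:R <= 16 / d.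
Proof.
move=> /andP[d0 d1].
have d2 : 0 < 2 / d by rewrite divr_gt0.
have id1 : 1 <= d^-1 by rewrite invf_ge1.
have := ln_le_subr1 d2; have : 0 <= ln (2 / d) by apply: ln_ge0; lra.
move: (ln _) => l l0 ld; apply: le_trans (nat_ceil_le _) _; lra.
Qed.

End running_times.

Section algorithm_time.
Context {R : realType} {D T : nat} {Xi : Type}
  (S : forall n : 'I_T.+1, 'M[R]_(D, n) -> Xi -> 'M[R]_(D, T))
  (g : forall t : 'I_T, 'M[R]_(D, obs t) -> R) (C G U : R).
Hypotheses (C_ge0 : 0 <= C) (G_ge0 : 0 <= G) (T_gt0 : (0 < T)%N).
Local Notation prog := (prog R D T).
Local Notation costs := (costs S g C G).
Local Notation ev := (@truncated_reward R D T U).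
Let W := C + G + 4.
Let t : R := T%:R.

(** The solution of [b (k + 1) e = 2^20 / e^4 * b k (e / 4)], bounded by the
    power of its largest factor *)
Definition blowup (k : nat) (e : R) : R := (2 ^+ 20 * (4 ^+ k / e) ^+ 4) ^+ k.

Let t1 : 1 <= t. Proof. by rewrite ler1n. Qed.
Let W4 : 4 <= W. Proof. by rewrite /W; have := C_ge0; have := G_ge0; lra. Qed.

Let W0 : 0 <= W. Proof. by apply: le_trans W4; rewrite ler0n. Qed.
Let CW : C <= W. Proof. by rewrite /W -addrA lerDl addr_ge0. Qed.
Let sample_cost : 476 * 41 ^+ 2 <= 2 ^+ 20 :> R. Proof. lra. Qed.
Let halves (e : R) : 0 < e <= 1 -> [/\ 0 < e / 2 <= 1, 0 < e / 4 <= 1 & e / 4 <= e / 2].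
Proof. by move=> /andP[e0 e1]; split; lra. Qed.

Let factor_ge1 k (e : R) : 0 < e <= 1 -> 1 <= 2 ^+ 20 * (4 ^+ k / e) ^+ 4.
Proof.
move=> /andP[e0 e1]; have p4 : 1 <= 4 ^+ k :> R by rewrite exprn_ege1//; lra.
have q : 1 <= 4 ^+ k / e by rewrite ler_pdivlMr// mul1r; exact: le_trans p4.
have : 1 <= (4 ^+ k / e) ^+ 4 by rewrite exprn_ege1.
by move: (_ ^+ 4) => x x1; apply: (le_trans x1); rewrite ler_peMl//; [lra|rewrite exprn_ege1//; lra].
Qed.

Lemma blowup_ge1 k (e : R) : 0 < e <= 1 -> 1 <= blowup k e.
Proof. by move=> e01; rewrite exprn_ege1// factor_ge1. Qed.

Lemma blowup_anti k (e e' : R) : 0 < e -> e <= e' -> blowup k e' <= blowup k e.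
Proof.
move=> e0 ee; have e'0 := lt_le_trans e0 ee.
have q e1 : 0 < e1 -> 0 <= 4 ^+ k / e1 by move=> e10; rewrite divr_ge0 ?exprn_ge0 ?(ltW e10).
have f e1 : 0 < e1 -> 0 <= 2 ^+ 20 * (4 ^+ k / e1) ^+ 4.
  by move=> e10; apply: mulr_ge0; rewrite exprn_ge0 ?q.
apply: lerXn2r; rewrite ?nnegrE; [exact: f|exact: f|].
apply: ler_wpM2l; first by rewrite exprn_ge0.
apply: lerXn2r; rewrite ?nnegrE; [exact: q|exact: q|].
by apply: ler_wpM2l; [rewrite exprn_ge0|rewrite lef_pV2// posrE].
Qed.

Lemma blowupS k (e : R) : 0 < e <= 1 ->
  2 ^+ 20 / e ^+ 4 * blowup k (e / 4) <= blowup k.+1 e.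
Proof.
move=> /andP[e0 e1]; rewrite {2}/blowup [leRHS]exprS.
have -> : 4 ^+ k.+1 / e = 4 ^+ k / (e / 4) by rewrite exprS; field; rewrite gt_eqF.
rewrite -/(blowup k (e / 4)).
have b1 : 1 <= blowup k (e / 4) by apply: blowup_ge1; lra.
rewrite ler_pM2r ?(lt_le_trans ltr01)//.
rewrite ler_pM2l ?exprn_gt0// -exprVn.
have p4 : 1 <= 4 ^+ k :> R by rewrite exprn_ege1//; lra.
apply: lerXn2r; rewrite ?nnegrE ?invr_ge0 ?(ltW e0)//.
  by rewrite !divr_ge0 ?(ltW e0)//; lra.
rewrite invf_div mulrA ler_peMl ?invr_ge0 ?(ltW e0)//; lra.
Qed.

(** Within one level, the accuracies [e / 2] and [e / 4] are both charged as
    [e / 4]. *)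
Lemma costs_calB k (s : 'I_T) (c : 'M[R]_(D, obs s)) (e d : R) : 0 < e <= 1 -> 0 < d <= 1 ->
  costs (calB ev k.+1 c e d) (W * blowup k e * t ^+ (2 * k) / d) (fun=> True).
Proof.
elim: k s c e d => [|k IH] s c e d e01 d01.
  have [d0 d1] := andP d01.
  move=> seeds; split=> //=; rewrite muln0 !mulr1 addr0.
  apply: (@le_trans _ _ W); last by rewrite ler_peMr ?invf_ge1.
  by rewrite /W; have := C_ge0; have := G_ge0; lra.
have [e0 e1] := andP e01; have [d0 d1] := andP d01.
pose N := nat_ceil (1 / (2 * (e / 4) `^ 2) * ln (2 / (1 / 16))).
pose L := nat_ceil (8 * ln (2 / d)).
have [N0 Nn] := sample_size_le e01; rewrite -/N in N0 Nn.
have Ld := repetitions_le d01; rewrite -/L in Ld.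
have N1 : 1 <= N%:R :> R by rewrite ler1n.
pose eta := 1 / (16 * N%:R * t).
have eta01 : 0 < eta <= 1.
  rewrite /eta divr_gt0 ?mulr_gt0 ?ltr0n//= ler_pdivrMr ?mulr_gt0 ?ltr0n// mul1r.
  by have := ler_pM ler01 ler01 N1 t1; lra.
have [e2 e4 e42] := halves e01; have [e40 _] := andP e4.
have d8 : 0 < (1 / 8 : R) <= 1 by rewrite div1r invr_gt0 ltr0n invf_le1 ?ltr0n// ler1n.
pose u := t ^+ (2 * k); pose b := blowup k (e / 4).
pose draw : prog R :=
  let! A1 := do_simulate c in
  let! A2 := map_prog (fun j : 'I_T => calB ev k.+1 (first_cols (obs j) A1) (e / 4) eta)
    (enum 'I_T) in
  fold1_arith _ _ Max A2.
have tE : t = (size (enum 'I_T))%:R by rewrite size_enum_ord.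
have cdraw : costs draw (C + (t * (W * b * u * (16 * N%:R * t)) + t)) (fun=> True).
  apply: costs_simulate => A1.
  apply: (costs_bind (Q1 := fun A2 : seq R => size A2 = size (enum 'I_T))) => [|A2 sA2].
    rewrite {1}tE; apply: costs_map => j.
    apply: costs_le (IH _ _ _ _ e4 eta01) _.
    by rewrite /eta div1r invrK -/b -/u.
  by rewrite tE -sA2; exact: costs_fold1.
pose run : prog R :=
  let! A3 := calB ev k.+1 c (e / 2) (1 / 8) in
  let! A0 := map_prog (fun=> draw) (iota 1 N) in
  let! total := fold1_arith _ _ Add A0 in
  let! mean := do_arith _ _ Div total N%:R in
  do_arith _ _ Defs.Sub A3 mean.
pose b' := blowup k (e / 2).
have crun : costs run (8 * (W * b' * u) +
    (N%:R * (C + (t * (W * b * u * (16 * N%:R * t)) + t)) + (N%:R + 2))) (fun=> True).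
  apply: (costs_bind (Q1 := fun=> True)) => [|A3 _].
    apply: costs_le (IH _ c _ _ e2 d8) _.
    by rewrite -/b' -/u div1r invrK mulrC.
  apply: (costs_bind (Q1 := fun A0 : seq R => size A0 = N)) => [|A0 sA0].
    by have := costs_map (iota 1 N) (fun=> cdraw); rewrite size_iota; exact.
  apply: (costs_bind (Q1 := fun=> True)) => [|total _].
    by rewrite -sA0; exact: costs_fold1.
  rewrite (_ : 2 = 1 + (1 + 0)); last by ring.
  by do 2!apply: costs_arith; exact: costs_ret.
have call : costs (calB ev k.+2 c e d) (12 + (L%:R * (8 * (W * b' * u) +
    (N%:R * (C + (t * (W * b * u * (16 * N%:R * t)) + t)) + (N%:R + 2))) + L%:R)) (fun=> True).
  rewrite (_ : 12 + _ = 1 + (1 + (1 + (1 + (1 + (1 + (1 + (1 + (1 + (1 + (1 + (1 +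
    (L%:R * (8 * (W * b' * u) + (N%:R * (C + (t * (W * b * u * (16 * N%:R * t)) + t)) +
    (N%:R + 2))) + L%:R))))))))))))); last by ring.
  do 12 apply: costs_arith.
  apply: (@costs_bind _ _ _ _ _ _ _ _ _ _ (map_prog (fun=> run) (iota 1 L)) (do_median D T)
    _ _ (fun l => size l = L)) => [|l sl].
    by have := costs_map (iota 1 L) (fun=> crun); rewrite size_iota; exact.
  by move=> seeds; split=> //=; rewrite addr0 sl.
apply: costs_le call _.
have bb' : 0 <= b' <= b.
  by rewrite (le_trans ler01) ?blowup_ge1//=; exact: blowup_anti.
have u1 : 1 <= u by rewrite exprn_ege1.
have b1 : 1 <= b by apply: blowup_ge1.
have n1 : 1 <= 41 / e ^+ 2.
  rewrite ler_pdivlMr ?exprn_gt0// mul1r.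
  by apply: (@le_trans _ _ 1); [rewrite exprn_ile1// ltW|rewrite ler1n].
apply: le_trans (level_cost W4 CW t1 u1 bb' b1 n1 _ _ d01) _.
- by rewrite ler0n.
- by rewrite ler0n.
rewrite ler_pM2r ?invr_gt0//.
have := blowupS k e01; rewrite -/b => bS.
have Wut : 0 <= W * (u * t ^+ 2) by rewrite mulr_ge0// mulr_ge0// exprn_ge0// ler0n.
apply: le_trans (le_trans _ (ler_wpM2l Wut bS)) _; last first.
  by rewrite mulnS exprD -/u le_eqVlt; apply/orP; left; apply/eqP; ring.
rewrite (_ : _ * (41 / e ^+ 2) ^+ 2 = W * (u * t ^+ 2) * (476 * 41 ^+ 2 / e ^+ 4 * b)); last first.
  by field; rewrite gt_eqF.
apply: ler_wpM2l => //; apply: ler_wpM2r; first exact: le_trans ler01 b1.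
by apply: ler_wpM2r sample_cost; rewrite invr_ge0 exprn_ge0// ltW.
Qed.

End algorithm_time.

Lemma le_expR (R : realType) (x : R) : x <= expR x.
Proof. by have := @expR_ge1Dx R x; lra. Qed.

Lemma expR1_ge2 (R : realType) : 2 <= expR 1 :> R.
Proof. by have := @expR_ge1Dx R 1; lra. Qed.

(** Every factor is compared with an exponential through [2 <= exp 1] and
    [x <= exp x]. *)
Lemma blowup_le_exp (R : realType) (E : R) k : 1 <= E -> k%:R <= 5 * E ->
  blowup k (1 / (4 * E)) <= expR (100 * E + 280 * E ^+ 2).
Proof.
move=> E1 kE; rewrite /blowup.
have k0 : 0 <= k%:R :> R by rewrite ler0n.
have pow2 n : 2 ^+ n <= expR n%:R :> R.
  rewrite -[n%:R]mulr1 expRM_natl; apply: lerXn2r; rewrite ?nnegrE ?expR_ge0//.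
  exact: expR1_ge2.
have pow4 : 4 ^+ k <= expR (k%:R * 2) :> R.
  rewrite -natrM (_ : 4 = 2 ^+ 2 :> R) -?exprM; last by ring.
  by rewrite mulnC; exact: pow2.
have E4 : 4 * E <= expR (4 * E) by exact: le_expR.
have q0 : 0 <= 4 ^+ k * (4 * E) by rewrite mulr_ge0 ?exprn_ge0//; lra.
have q : 4 ^+ k * (4 * E) <= expR (k%:R * 2 + 4 * E).
  by rewrite expRD ler_pM// ?exprn_ge0//; lra.
rewrite div1r invrK.
have f0 : 0 <= 2 ^+ 20 * (4 ^+ k * (4 * E)) ^+ 4 by apply: mulr_ge0; rewrite exprn_ge0.
have f : 2 ^+ 20 * (4 ^+ k * (4 * E)) ^+ 4 <= expR (20%:R + 4%:R * (k%:R * 2 + 4 * E)).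
  rewrite expRD expRM_natl; apply: ler_pM; rewrite ?exprn_ge0//.
  by apply: lerXn2r; rewrite ?nnegrE ?expR_ge0.
apply: (@le_trans _ _ (expR (20%:R + 4%:R * (k%:R * 2 + 4 * E)) ^+ k)).
  by apply: lerXn2r; rewrite ?nnegrE ?expR_ge0.
rewrite -expRM_natl ler_expR.
have : k%:R * (20 + 8 * k%:R + 16 * E) <= 5 * E * (20 + 56 * E) by apply: ler_pM; lra.
rewrite expr2; move: k%:R => x; lra.
Qed.

Lemma decision_overhead {F : realFieldType} (W B Q : F) : 4 <= W -> 1 <= Q -> B <= W * Q ->
  1 + (1 + (1 + (1 + (B + (1 + 0))))) <= W * (4 * Q).
Proof.
move=> W4 Q1 BQ; have WQ : W <= W * Q by rewrite ler_peMr//; lra.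
by rewrite mulrCA; move: (W * Q) BQ WQ => x; lra.
Qed.

Lemma exponent_ge0 {F : realFieldType} (E : F) : 256 <= E -> 0 <= 104 * E + 280 * E ^+ 2.
Proof. by move=> E256; have := sqr_ge0 E; lra. Qed.

Lemma exponent_slack {F : realFieldType} (E : F) : 256 <= E ->
  2 + (104 * E + 280 * E ^+ 2) <= 281 * E ^+ 2.
Proof. by move=> E256; have : 256 * E <= E ^+ 2; [rewrite expr2 ler_wpM2r//|]; lra. Qed.

Lemma level_slack {F : realFieldType} (E k : F) : 256 <= E -> k <= 5 * E -> 2 * k + 1 <= 11 * E.
Proof. by lra. Qed.

Section decision_time.
Context {R : realType} {D T : nat} {Xi : Type}
  (S : forall n : 'I_T.+1, 'M[R]_(D, n) -> Xi -> 'M[R]_(D, T))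
  (g : forall t : 'I_T, 'M[R]_(D, obs t) -> R) (C G U : R).
Hypotheses (C_ge0 : 0 <= C) (G_ge0 : 0 <= G) (T_gt0 : (0 < T)%N).

(** There are at most [5 E] levels.  Since [256 <= E], the step from 280 to 281 in
    the coefficient of [E^2] absorbs the lower order terms of the exponent. *)
Lemma decide_time (E : R) (t : 'I_T) (c : 'M[R]_(D, obs t)) (s : nat -> Xi) : 256 <= E ->
  running_time S g C G (truncated_decide (1 / E) U c) s <=
  (C + G + 4) * expR (281 * E ^+ 2) * T%:R `^ (11 * E).
Proof.
move=> E256; set W := C + G + 4.
have W4 : 4 <= W by rewrite /W; have := C_ge0; have := G_ge0; lra.
have W0 : 0 <= W by apply: le_trans W4; rewrite ler0n.
have T1 : 1 <= T%:R :> R by rewrite ler1n.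
rewrite /truncated_decide /decide; case: eqP => _.
  by rewrite /= !mulr_ge0 ?expR_ge0 ?powR_ge0.
set p := bind _ _; pose K := nat_ceil (4 / (1 / E)).
have E0 : 0 < E by apply: lt_le_trans E256; rewrite ltr0n.
have E1 : 1 <= E by apply: le_trans E256; rewrite ler1n.
have KE : K%:R <= 5 * E.
  have K4 : 4 / (1 / E) = 4 * E by rewrite div1r invrK.
  by rewrite /K K4; apply: le_trans (nat_ceil_le _) _; lra.
have iE : E^-1 <= 1 by rewrite invf_le1.
have iE0 : 0 < E^-1 by rewrite invr_gt0.
have e01 : 0 < 1 / E / 4 <= 1 by lra.
have d01 : 0 < 1 / E / (4 * T%:R) <= 1.
  have iT : T%:R^-1 <= 1 :> R by rewrite invf_le1// ltr0n.
  have iT0 : 0 < T%:R^-1 :> R by rewrite invr_gt0 ltr0n.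
  have iTE : E^-1 * T%:R^-1 <= 1 * 1 by apply: ler_pM => //; exact: ltW.
  have iTE0 : 0 < E^-1 * T%:R^-1 by exact: mulr_gt0.
  by rewrite invfM mulrCA; lra.
have cB := @costs_calB R D T Xi S g C G U C_ge0 G_ge0 T_gt0 K t c _ _ e01 d01.
set B := (X in costs _ _ _ _ _ X _) in cB.
have cp : costs S g C G p (1 + (1 + (1 + (1 + (B + (1 + 0)))))) (fun=> True).
  do 4!apply: costs_arith.
  by apply: costs_bind cB _ => b _; apply: costs_arith; exact: costs_ret.
apply: le_trans (cp s).1 _.
have blow : blowup K (1 / E / 4) <= expR (100 * E + 280 * E ^+ 2).
  have -> : 1 / E / 4 = 1 / (4 * E) by field; rewrite gt_eqF.
  exact: blowup_le_exp.
have E4 : 4 * E <= expR (4 * E) by exact: le_expR.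
pose Q := expR (104 * E + 280 * E ^+ 2) * T%:R ^+ (2 * K).+1.
have Q1 : 1 <= Q.
  rewrite -[1]mulr1 ler_pM// ?exprn_ege1//.
  by rewrite -[leLHS]expR0 ler_expR exponent_ge0.
have BQ : B <= W * Q.
  rewrite /B -/W [leLHS](_ : _ = W * (blowup K (1 / E / 4) * (4 * E)) * T%:R ^+ (2 * K).+1).
    rewrite /Q -mulrA ler_wpM2l//.
    apply: ler_wpM2r; first by rewrite exprn_ge0.
    rewrite (_ : 104 * E + _ = 100 * E + 280 * E ^+ 2 + 4 * E); last by ring.
    rewrite expRD ler_pM//; last by rewrite mulr_ge0// ltW.
    by rewrite (le_trans ler01)// blowup_ge1.
  by rewrite exprS; field; rewrite !gt_eqF// ltr0n.
apply: le_trans (decision_overhead W4 Q1 BQ) _; rewrite -mulrA ler_wpM2l//.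
have four : 4 <= expR 2 :> R.
  rewrite (_ : 2 = 1 + 1 :> R)// expRD (_ : 4 = 2 * 2 :> R); last by ring.
  by apply: ler_pM => //; exact: expR1_ge2.
rewrite /Q mulrA; apply: ler_pM; rewrite ?mulr_ge0 ?expR_ge0 ?exprn_ge0//.
  apply: (@le_trans _ _ (expR 2 * expR (104 * E + 280 * E ^+ 2))).
    by rewrite ler_wpM2r ?expR_ge0.
  by rewrite -expRD ler_expR exponent_slack.
rewrite -powR_mulrn ?ler0n// ler_powR// -natr1 natrM.
exact: level_slack.
Qed.

End decision_time.

(** * Choice of the parameters *)

(** As [q] and [1 / e] are at least 1, larger exponents only help. *)
Lemma accuracy_budget {F : realFieldType} (e q : F) : 0 < e < 1 -> 1 <= q ->
  let E := 256 * q ^+ 3 / e ^+ 2 in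
  [/\ 256 <= E, 281 * E ^+ 2 <= 16 / 10 * 10 ^+ 9 * q ^+ 8 * e ^- 6 &
      11 * E <= 3 * 10 ^+ 4 * q ^+ 4 * e ^- 3].
Proof.
move=> /andP[e0 e1] q1 /=; set i := e^-1.
have i1 : 1 <= i by rewrite invf_ge1// ltW.
have le_exp (x : F) m n : 1 <= x -> (m <= n)%N -> x ^+ m <= x ^+ n.
  by move=> x1 mn; exact: ler_weXn2l.
have q0 n : 0 <= q ^+ n by rewrite exprn_ge0// (le_trans ler01).
have i0 n : 0 <= i ^+ n by rewrite exprn_ge0// (le_trans ler01).
(* [256^2 <= 10^6] and [281 <= 1.6 * 10^3]; the numerals are unary, so the large
   powers stay unevaluated *)
have const : 0 <= (281 * 256 ^+ 2 : F) <= 16 / 10 * 10 ^+ 9.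
  have -> : 10 ^+ 9 = (10 ^+ 3) ^+ 2 * 10 ^+ 3 :> F by rewrite -exprM -exprD.
  have k : (256 : F) <= 10 ^+ 3 by lra.
  have k2 : (256 : F) ^+ 2 <= (10 ^+ 3) ^+ 2 by apply: lerXn2r k; rewrite nnegrE; lra.
  have l : (281 : F) <= 16 / 10 * 10 ^+ 3 by lra.
  have gen (x y z : F) : 0 <= x -> x <= y -> 281 <= 16 / 10 * z ->
      0 <= 281 * x <= 16 / 10 * (y * z).
    move=> x0 xy z1; have c0 : (0 : F) <= 281 by lra.
    rewrite [y * z]mulrC mulrA; apply/andP; split; [exact: mulr_ge0|exact: ler_pM].
  by apply: gen; [exact: sqr_ge0|exact: k2|exact: l].
rewrite -!exprVn -/i; split.
- have := ler_pM ler01 ler01 (exprn_ege1 3 q1) (exprn_ege1 2 i1).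
  by rewrite mulr1 -mulrA; move: (_ * _) => x x1; lra.
- rewrite (_ : 281 * _ = 281 * 256 ^+ 2 * (q ^+ 6 * i ^+ 4)); last by ring.
  move: (281 * 256 ^+ 2) (16 / 10 * 10 ^+ 9) const => x y /andP[x0 xy].
  by rewrite -mulrA; apply: (ler_pM x0 (mulr_ge0 (q0 6) (i0 4)) xy); rewrite ler_pM// le_exp.
- rewrite (_ : 11 * _ = 11 * 256 * (q ^+ 3 * i ^+ 2)); last by ring.
  have : (11 * 256 : F) <= 3 * 10 ^+ 4 by lra.
  have : (0 : F) <= 11 * 256 by lra.
  move: (11 * 256) (3 * 10 ^+ 4) => x y x0 xy; rewrite -mulrA.
  by apply: (ler_pM x0 (mulr_ge0 (q0 3) (i0 2)) xy); rewrite ler_pM// le_exp.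
Qed.

Theorem theorem6 (R : realType) (D T : nat) (D_gt0 : (0 < D)%N) (T_gt0 : (0 < T)%N)
  (d : measure_display) (Omega : measurableType d) (P : probability Omega R)
  (Y : Omega -> 'M[R]_(D, T)) (mY : measurable_fun setT Y)
  (g : forall t : 'I_T, 'M[R]_(D, obs t) -> R)
  (mg : forall t : 'I_T, measurable_fun setT (@g t))
  (reward_ge0 : forall (t : 'I_T) (w : Omega), 0 <= reward Y g t w)
  (reward_int : forall t : 'I_T, P.-integrable setT (EFin \o reward Y g t))
  (OPT_gt0 : (0 < OPT P Y g)%E)
  (gamma0_fin : ('E_P[(fun w => max_reward Y g w ^+ 2)%R] < +oo)%E)
  (dX : measure_display) (Xi : measurableType dX) (nu : probability Xi R)
  (S : forall n : 'I_T.+1, 'M[R]_(D, n) -> Xi -> 'M[R]_(D, T))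
  (S_sampler : conditional_sampler P Y nu S)
  (xi : 'I_T -> nat -> Omega -> Xi) (xi_fresh : fresh_seeds P Y nu xi)
  (C G : R) (C_ge0 : 0 <= C) (G_ge0 : 0 <= G)
  (eps : R) (eps_gt0 : 0 < eps) (eps_lt1 : eps < 1) :
  exists eps' U : R,
    [/\ 0 < eps' < 1,
        0 < U,
        exists tau : Omega -> 'I_T,
          [/\ forall w, first_stop (fun t => output S g
                (truncated_decide eps' U (first_cols (obs t) (Y w)))
                (fun i => xi t i w)) (tau w),
              randomized_stopping_time P Y tau &
              1 - eps <= fine 'E_P[fun w => reward Y g (tau w) w]%E / fine (OPT P Y g)] &
        forall (t : 'I_T) (c : 'M[R]_(D, obs t)) (s : nat -> Xi),
          running_time S g C G (truncated_decide eps' U c) s <=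
          (C + G + 4)
          * expR (16 / 10 * 10 ^+ 9 * gamma0 P Y g ^+ 8 * eps ^- 6)
          * T%:R `^ (3 * 10 ^+ 4 * gamma0 P Y g ^+ 4 * eps ^- 3)].
Proof.
have eps01 : 0 < eps < 1 by rewrite eps_gt0.
set q := gamma0 P Y g; have q1 : 1 <= q by exact: gamma0_ge1.
have m0 := mean_gt0 mY mg reward_ge0 OPT_gt0 gamma0_fin.
have q0 : 0 < q := lt_le_trans ltr01 q1.
have mS (n : 'I_T.+1) := (S_sampler n).1.
pose eps' := eps ^+ 2 / (256 * q ^+ 3); pose U := 16 * q ^+ 2 * fine 'E_P[max_reward Y g]%E / eps.
have U0 : 0 < U by rewrite divr_gt0// mulr_gt0// mulr_gt0// exprn_gt0.
exists eps', U; split=> //; first exact: accuracy_bounds.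
  have lastT : (T.-1 < T)%N by rewrite prednK.
  have /choice[tau Ftau] w : exists t, first_stop (fun t => output S g
      (truncated_decide eps' U (first_cols (obs t) (Y w))) (fun i => xi t i w)) t.
    apply: (@first_stop_exists _ _ (Ordinal lastT)).
    by rewrite /truncated_decide /decide /= prednK// eqxx.
  exists tau; split=> //; last exact: (approximation_ratio mY S_sampler xi_fresh mg).
  exists (seed_algebra xi); split=> [t|s t|t|t].
  - split; [exact: smallest_sigma_algebra|exact: (seed_algebra_measurable xi_fresh)].
  - exact: seed_algebra_mono.
  - exact: (seeds_cond_indep mY S_sampler xi_fresh).
  - exact: (decision_algebra_tau S_sampler mg Ftau).
move=> t c s; have [E256 expE powE] := accuracy_budget eps01 q1.
have -> : eps' = 1 / (256 * q ^+ 3 / eps ^+ 2) by rewrite /eps' div1r invf_div.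
have W0 : 0 <= C + G + 4 by rewrite !addr_ge0.
apply: le_trans (decide_time S g U C_ge0 G_ge0 T_gt0 c s E256) _.
move: (16 / 10 * _ * _ * _) (3 * _ * _ * _) expE powE => x y Ex Ey.
apply: ler_pM; [by rewrite mulr_ge0 ?expR_ge0|exact: powR_ge0| |].
  by rewrite ler_wpM2l// ler_expR.
by rewrite ler_powR// ler1n.
Qed.
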